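(* Consider the random field Ising model with bimodal field in dimension $d=2$. For every $0\le \beta<\beta_c(2)$ there exists $H_1(\beta)>0$, where $$H_1(\beta)=\infty \text{ if } \beta\in[0,\beta_P(2)],\qquad H_1(\beta)\in(0,\infty)\text{ if }\beta\in(\beta_P(2),\beta_c(2)),$$ such that for each $H\in[0,H_1(\beta))$ there are constants $C_1(\beta,H),C_2(\beta,H)\in(0,\infty)$ depending only on $\beta,H$ with $$\sup_{\eta,\eta'\in\{-1,+1\}^{\partial_{ex}\Lambda_L}}\left[\langle\sigma_0\rangle^{\vec h}_{\Lambda_L,\eta,\beta,H}-\langle\sigma_0\rangle^{\vec h}_{\Lambda_L,\eta',\beta,H}\right]\le C_2(\beta,H)\,e^{-C_1(\beta,H)L}$$ for every integer $L\ge 0$ and every realization $\vec h\in\{-1,+1\}^{\Lambda_L}$ of the field.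
   Context: For a finite $\Lambda\subseteq\mathbb{Z}^d$, $\partial_{ex}\Lambda$ is the set of vertices of $\mathbb{Z}^d\setminus\Lambda$ having a nearest neighbor in $\Lambda$. For $\beta\ge0$, $H\ge 0$, $\eta\in\{-1,+1\}^{\partial_{ex}\Lambda}$ and $\vec h\in\mathbb{R}^\Lambda$, $P^{\vec h}_{\Lambda,\eta,\beta,H}$ is the probability measure on $\{-1,+1\}^\Lambda$ given by $$P^{\vec h}_{\Lambda,\eta,\beta,H}(\sigma)\propto\exp\Big[\beta\sum_{\{u,v\}}\sigma_u\sigma_v+\beta\sum_{\{u,v\}:u\in\Lambda,v\in\partial_{ex}\Lambda}\sigma_u\eta_v+H\sum_{u\in\Lambda}h_u\sigma_u\Big],$$ where the first sum is over (unordered) nearest neighbor pairs in $\Lambda$ and the second over nearest neighbor pairs; $\langle\cdot\rangle^{\vec h}_{\Lambda,\eta,\beta,H}$ is its expectation. In the random field Ising model (RFIM), $\vec h$ is a realization of i.i.d. random variables $H_u$ of mean $0$ and variance $1$; the bimodal field has $\mathrm{Prob}(H_u=+1)=\mathrm{Prob}(H_u=-1)=1/2$, so $\vec h$ takes values in $\{-1,+1\}^\Lambda$. $\Lambda_L:=[-L,L]^d\cap\mathbb{Z}^d$. $\beta_c(d)$ is the critical inverse temperature of the (homogeneous, nearest neighbor) Ising model on $\mathbb{Z}^d$ with $H=0$. $\beta_P(d)$ is defined by $1-e^{-2\beta_P(d)}=p_c^b(d)$, where $p_c^b(d)$ is the critical probability of independent Bernoulli bond percolation on $\mathbb{Z}^d$.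 *)

(* Defs.v *)
From HB Require Import structures.
From mathcomp Require Export all_boot all_order all_algebra finmap.
From mathcomp Require Export all_classical all_reals all_analysis.
From mathcomp Require Import lra zify.
Export Order.TTheory GRing.Theory Num.Theory.
Export numFieldNormedType.Exports.

Set Implicit Arguments.
Unset Strict Implicit.
Unset Printing Implicit Defensive.

Local Open Scope classical_set_scope.
Local Open Scope ring_scope.

Notation site d := 'rV[int]_d.

Section Lattice.
Variable d : nat.

Definition nn (x y : site d) : bool := \sum_i `|x 0 i - y 0 i| == 1.

Definition unit_steps : {fset site d} :=
  ([fset delta_mx 0 i | i in 'I_d] `|` [fset (- delta_mx 0 i)%R | i in 'I_d])%fset.

(* See [mem_ex_boundary] for the usual characterisation. *)
Definition ex_boundary (Lam : {fset site d}) : {fset site d} :=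
  ([fset (x + e)%R | x in Lam, e in unit_steps] `\` Lam)%fset.

(* The cube [-L, L]^d; see [mem_box]. *)
Definition box (L : nat) : {fset site d} :=
  [fset (\row_i ((f i)%:Z - L%:Z))%R | f : {ffun 'I_d -> 'I_(L.*2.+1)} in predT]%fset.

Lemma mem_box L (x : site d) : (x \in box L) = [forall i, `|x 0 i| <= L%:Z].
Proof.
apply/imfsetP/forallP => [[f _ ->] i|xL].
  rewrite mxE ler_norml; have := ltn_ord (f i); set k := nat_of_ord _; lia.
exists [ffun i => inord (absz (x 0 i + L%:Z))] => //.
apply/rowP => i; rewrite mxE ffunE; have := xL i; rewrite ler_norml => xiL.
rewrite inordK; set z := x 0 i in xiL *; lia.
Qed.

Lemma origin_in_box L : 0 \in box L.
Proof. by rewrite mem_box; apply/forallP => i; rewrite mxE. Qed.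

Definition origin L : box L := [` origin_in_box L]%fset.

Lemma nn_unit_steps (x y : site d) : nn x y = (y - x \in unit_steps).
Proof.
have sumdelta (z : int) i : `|z| = 1 ->
    \sum_j `|(z *: (delta_mx 0 i : site d)) 0 j| = 1 :> int.
  move=> z1; rewrite (bigD1 i) //= big1 => [|j /negbTE ji].
    by rewrite !mxE !eqxx mulr1 addr0.
  by rewrite !mxE eqxx ji mulr0 normr0.
have nnE : nn x y = (\sum_i `|(y - x) 0 i| == 1).
  by congr (_ == _); apply: eq_bigr => i _; rewrite !mxE distrC.
rewrite nnE; move: (y - x) => v; apply/eqP/idP => [v1|].
  have [i vi] : exists i, v 0 i != 0.
    apply/existsP; apply: contra_eqT v1; rewrite negb_exists => /forallP v0.
    by rewrite big1 // => i _; have /negPn/eqP -> := v0 i; rewrite normr0.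
  have le1 : `|v 0 i| <= 1.
    by rewrite -v1 (bigD1 i) //= lerDl sumr_ge0.
  have vi1 : `|v 0 i| = 1 by lia.
  have vj j : j != i -> v 0 j = 0.
    move=> ji; move: v1; rewrite (bigD1 i) //= vi1 => /eqP.
    rewrite -subr_eq0 addrAC subrr add0r psumr_eq0 // => /allP /(_ j).
    by rewrite mem_index_enum ji normr_eq0 => /(_ isT) /eqP.
  have ve : v = v 0 i *: delta_mx 0 i.
    apply/rowP => j; rewrite !mxE eqxx /=.
    by have [->|/vj ->] := eqVneq j i; rewrite ?mulr1 ?mulr0.
  rewrite ve in_fsetU; apply/orP.
  have [->|->] : v 0 i = 1 \/ v 0 i = -1 by lia.
    by left; rewrite scale1r; apply/imfsetP; exists i.
  by right; rewrite scaleN1r; apply/imfsetP; exists i.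
rewrite in_fsetU => /orP[] /imfsetP[i _ ->].
  by rewrite -(scale1r (delta_mx 0 i)) sumdelta.
by rewrite -scaleN1r sumdelta.
Qed.

Lemma mem_ex_boundary (Lam : {fset site d}) (y : site d) :
  (y \in ex_boundary Lam) = (y \notin Lam) && [exists x : Lam, nn (val x) y].
Proof.
rewrite in_fsetD; congr (_ && _).
apply/imfset2P/existsP => [[x xL [e eS ->]]|[x xy]].
  by exists [` xL]%fset; rewrite nn_unit_steps /= addrC addKr.
exists (val x); first exact: fsvalP.
by exists (y - val x); rewrite -?nn_unit_steps // addrC subrK.
Qed.

End Lattice.

Section Ising.
Variables (R : realType) (d : nat).

(* {-1,+1}^V, with [true] encoding +1. *)
Definition spins (V : {fset site d}) := {ffun V -> bool}.

Definition spin (b : bool) : R := if b then 1 else -1.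

Variables (Lam : {fset site d}) (h : Lam -> R) (eta : spins (ex_boundary Lam)).
Variables (beta H : R).

(* The first sum is halved because it runs over ordered pairs. *)
Definition gibbs_weight (s : spins Lam) : R :=
  expR (beta * (2^-1 * \sum_(u : Lam) \sum_(v : Lam | nn (val u) (val v))
                         spin (s u) * spin (s v))
        + beta * (\sum_(u : Lam) \sum_(v : ex_boundary Lam | nn (val u) (val v))
                     spin (s u) * spin (eta v))
        + H * \sum_(u : Lam) h u * spin (s u)).

Definition gibbs_prob (s : spins Lam) : R :=
  gibbs_weight s / \sum_(s' : spins Lam) gibbs_weight s'.

Definition gibbs_mean (f : spins Lam -> R) : R :=
  \sum_(s : spins Lam) f s * gibbs_prob s.

End Ising.

Section Criticality.
Variables (R : realType) (d : nat).

Definition mean_spin0 (L : nat) (h : box d L -> R)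
    (eta : spins (ex_boundary (box d L))) (beta H : R) : R :=
  gibbs_mean h eta beta H (fun s => spin R (s (origin d L))).

(* The spontaneous magnetization m*(beta) of the homogeneous Ising model. *)
Definition magnetization (beta : R) : R :=
  limn (fun L => @mean_spin0 L (fun=> 0) [ffun=> true] beta 0).

(* Equal to +oo when there is no phase transition (d = 1). *)
Definition beta_c : \bar R :=
  ereal_inf [set b%:E | b in [set b : R | 0 <= b /\ 0 < magnetization b]].

(* (x, i) stands for the edge between x and x + e_i: this enumerates each edge
   of Z^d exactly once. *)
Definition edge : Type := (site d * 'I_d)%type.

Definition edge_config : Type :=
  g_sigma_algebraType [set [set w : edge -> bool | w e] | e in [set: edge]].

Definition open_nn (w : edge_config) (x y : site d) : bool :=
  [exists i, (y == x + delta_mx 0 i) && w (x, i)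
          || (x == y + delta_mx 0 i) && w (y, i)].

Definition cluster (w : edge_config) (x : site d) : set (site d) :=
  [set y | exists p : seq (site d), path (open_nn w) x p /\ last x p = y].

Definition bernoulli_percolation (p : R) (P : probability edge_config R) : Prop :=
  forall (A : {fset edge}) (b : edge -> bool),
    P [set w | forall e, e \in A -> w e = b e] =
    (\prod_(e <- A) (if b e then p else 1 - p))%:E.

(* P is the product measure of parameter p, which exists and is unique; so this
   says that p_c^b = sup {p in [0,1] : theta(p) = 0}. *)
Definition p_c_bond : R :=
  sup [set p : R | 0 <= p <= 1 /\
    exists2 P : probability edge_config R, bernoulli_percolation p P &
      P [set w | infinite_set (cluster w 0)] = 0%E].

(* Extended-valued so that the equation is solvable even if p_c^b = 1. *)
Definition beta_P : \bar R :=
  get [set b : \bar R | (1 - expeR (- (2%:E * b)) = p_c_bond%:E)%E].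

Lemma beta_PE : (1 - expeR (- (2%:E * beta_P)) = p_c_bond%:E)%E.
Proof.
have pc_ub : ubound [set p : R | 0 <= p <= 1 /\
    exists2 P : probability edge_config R, bernoulli_percolation p P &
      P [set w | infinite_set (cluster w 0)] = 0%E] 1.
  by move=> p [/andP[]].
have pc_le1 : p_c_bond <= 1.
  have [E0|/set0P E0] := eqVneq [set p : R | 0 <= p <= 1 /\
    exists2 P : probability edge_config R, bernoulli_percolation p P &
      P [set w | infinite_set (cluster w 0)] = 0%E] set0.
    by rewrite /p_c_bond E0 sup0.
  exact: ge_sup.
have [y yE] : exists y, expeR y = (1 - p_c_bond)%:E.
  by apply: expeR_total; rewrite lee_fin subr_ge0.
rewrite /beta_P; case: xgetP => [b _ //|/(_ (- ((2^-1)%:E * y))%E) []] /=.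
by rewrite -muleN oppeK muleA -EFinM divff ?mul1e // yE -EFinB subKr.
Qed.

End Criticality.

(* Main.v *)
(* Call frozen a site whose spin is fixed. Two facts are obtained by the
   same device: explore the bonds touching frozen sites one at a time, a closed
   bond being deleted and an open one freezing its other end; every quantity of
   interest is then compared with a mixture of its values in the two outcomes.
   (i) For bond percolation and for the zero-field Ising model with plus
   boundary, if phi(S) >= 1 for every finite S containing 0 (phi(S) being the
   expected number of connections from 0 in S through the boundary of S, resp.
   the tanh-weighted boundary sum of the free correlations <s_0 s_x>_S), then
   the one-arm probability, resp. the magnetization m, satisfies f' >= 1 - f;
   so phi(S) < 1 for some S strictly below criticality, as in the proof of
   Duminil-Copin and Tassion.
   (ii) The influence of a boundary spin on the spin at 0, whatever the field,
   is at most twice a connection probability of Bernoulli percolation of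
   parameter popen < 1 - exp (-2 beta): an explored site takes the opposite
   spin with probability bounded below, because its field and its number of
   neighbours are bounded. The strict inequality settles beta = beta_P.
   If the influences of the boundary sites of some S on 0 sum to less than 1,
   uniformly in the field and the other boundary spins, monotonicity in the
   boundary spins lets one iterate and yields exponential decay. For
   beta <= beta_P these influences are bounded by (ii) and phi(S) < 1. For
   beta < beta_c, Lieb's inequality and phi(S) < 1 give exponential decay at
   zero field, which makes a large cube S satisfy the condition at H = 0, hence
   for small H, by comparison of the Gibbs weights. *)

Require Import Defs.
From mathcomp Require Import ring lra zify.

Set Implicit Arguments.
Unset Strict Implicit.
Unset Printing Implicit Defensive.

Local Open Scope classical_set_scope.
Local Open Scope ring_scope.

(** * Sums over spin configurations *)

(** If the end [u] of a bond is frozen at $c$, then $e^{b\sigma_u\sigma_v} = e^{-b} +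
    (e^b-e^{-b})1_{\{\sigma_v=c\}}$; the closed and open outcomes of the exploration are these two
    summands, and no random-cluster measure has to be built. The device needs all frozen spins to be
    equal, so in (ii) the boundary spins other than the tested one are first absorbed into the
    field, which is why the field there is arbitrary up to a bound. As the set of free sites keeps
    shrinking, a configuration lives on all sites, a volume is a list, and freezing is deletion from
    that list. The obstacle in (i) is that a covariance is not linear in a mixture; the defect is
    $q(1-q)$ times the product of two increments, both nonnegative by Griffiths' second inequality.
    The obstacle in (ii) is that a bond has different opening probabilities under plus and minus;
    since freezing moves the two means apart, both can be raised to a common bound. A fixed
    realization of the field is not translation invariant, so the condition on [S] has to hold for
    all fields at once before it can be iterated. *)

Section Configurations.
Variables (T : eqType) (R : realType).

Definition conf := T -> bool.
Implicit Types (s t a b : conf) (vs ws : seq T) (f g w : conf -> R).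

Definition upd s v c : conf := fun x => if x == v then c else s x.

Lemma updE s v c : upd s v c v = c.
Proof. by rewrite /upd eqxx. Qed.

Lemma updN s v c x : x != v -> upd s v c x = s x.
Proof. by rewrite /upd => /negbTE ->. Qed.

Lemma upd_id s v : upd s v (s v) = s.
Proof. by apply/funext => x; rewrite /upd; case: eqP => // ->. Qed.

Lemma upd_upd s v c c' : upd (upd s v c) v c' = upd s v c'.
Proof. by apply/funext => x; rewrite /upd; case: eqP. Qed.

Lemma updC s v u c c' : v != u -> upd (upd s v c) u c' = upd (upd s u c') v c.
Proof.
move=> vw; apply/funext => x; rewrite /upd.
by case: (eqVneq x u) => // ->; rewrite eq_sym (negbTE vw).
Qed.

Definition cle s t := forall x, s x ==> t x.

Lemma cle_refl s : cle s s.
Proof. by move=> x; apply: implybb. Qed.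

Lemma cle_upd s t v c c' : cle s t -> c ==> c' -> cle (upd s v c) (upd t v c').
Proof. by move=> st cc x; rewrite /upd; case: eqP. Qed.

Definition mono f := forall s t, cle s t -> f s <= f t.

(* [isum vs f s] sums [f] over the configurations that agree with [s] off
   [vs]; so [s] is the boundary condition, and [avg vs w f s] is the mean of
   [f] in the finite-volume Gibbs state of weight [w]. *)
Fixpoint isum vs f s : R :=
  if vs is v :: vs' then isum vs' f (upd s v true) + isum vs' f (upd s v false)
  else f s.

Definition avg vs w f s := isum vs (fun t => f t * w t) s / isum vs w s.

(** Both sums run over the same spins on [vs], so their terms can be matched even when the integrand
    and the boundary condition change together. *)
Lemma isum_rel vs f g a b :
  (forall s t, {in vs, s =1 t} -> (forall x, x \notin vs -> s x = a x) ->
     (forall x, x \notin vs -> t x = b x) -> f s = g t) ->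
  isum vs f a = isum vs g b.
Proof.
elim: vs a b => [|v vs IH] a b fg /=; first by apply: fg.
have step c : isum vs f (upd a v c) = isum vs g (upd b v c).
  apply: IH => s t st sa tb; apply: fg => x; rewrite in_cons ?negb_or.
  - have [->|_] := eqVneq x v => /=; last exact: st.
    by case: (boolP (v \in vs)) => [/st //|vn] _; rewrite sa // tb // !updE.
  - by case/andP => xv xn; rewrite sa // updN.
  - by case/andP => xv xn; rewrite tb // updN.
by rewrite !step.
Qed.

Lemma eq_isum_in vs f g a :
  (forall s, (forall x, x \notin vs -> s x = a x) -> f s = g s) ->
  isum vs f a = isum vs g a.
Proof.
move=> fg; apply: isum_rel => s t st sa ta.
have -> : s = t.
  apply/funext => x; case: (boolP (x \in vs)) => [/st //|xn].
  by rewrite sa // ta.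
exact: fg.
Qed.

Lemma eq_isum vs f g a : f =1 g -> isum vs f a = isum vs g a.
Proof. by move=> fg; apply: eq_isum_in. Qed.

Lemma isum_base vs f a b : (forall x, x \notin vs -> a x = b x) ->
  isum vs f a = isum vs f b.
Proof.
move=> ab; apply: isum_rel => s t st sa tb; congr f; apply/funext => x.
case: (boolP (x \in vs)) => [/st //|xn].
by rewrite sa // tb // ab.
Qed.

Lemma isumD vs f g s : isum vs (fun t => f t + g t) s = isum vs f s + isum vs g s.
Proof. by elim: vs s => //= v vs IH s; rewrite !IH addrACA. Qed.

Lemma isumZ vs c f s : isum vs (fun t => c * f t) s = c * isum vs f s.
Proof. by elim: vs s => //= v vs IH s; rewrite !IH mulrDr. Qed.

Lemma isumB vs f g s : isum vs (fun t => f t - g t) s = isum vs f s - isum vs g s.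
Proof.
rewrite -mulN1r -isumZ -isumD; apply: eq_isum => t; by rewrite mulN1r.
Qed.

Lemma isum0 vs s : isum vs (fun=> 0) s = 0.
Proof. by elim: vs s => //= v vs IH s; rewrite !IH addr0. Qed.

Lemma isum_sum I (r : seq I) (P : pred I) (F : I -> conf -> R) vs s :
  isum vs (fun t => \sum_(i <- r | P i) F i t) s = \sum_(i <- r | P i) isum vs (F i) s.
Proof.
elim: r => [|i r IH].
  by rewrite big_nil -[RHS](isum0 vs s); apply: eq_isum => t; rewrite big_nil.
rewrite big_cons -IH; case: ifP => Pi.
  by rewrite -isumD; apply: eq_isum => t; rewrite big_cons Pi.
by apply: eq_isum => t; rewrite big_cons Pi.
Qed.

Lemma le_isum vs f g s : (forall t, f t <= g t) -> isum vs f s <= isum vs g s.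
Proof. by move=> fg; elim: vs s => //= v vs IH s; apply: lerD. Qed.

Lemma isum_ge0 vs f s : (forall t, 0 <= f t) -> 0 <= isum vs f s.
Proof. by move=> fg; rewrite -(isum0 vs s); apply: le_isum. Qed.

Lemma isum_gt0 vs f s : (forall t, 0 < f t) -> 0 < isum vs f s.
Proof. by move=> fg; elim: vs s => //= v vs IH s; apply: addr_gt0. Qed.

Lemma isum_cat vs ws f s : isum (vs ++ ws) f s = isum vs (isum ws f) s.
Proof. by elim: vs s => //= v vs IH s; rewrite !IH. Qed.

Lemma isum_upd vs f s v c : v \notin vs ->
  isum vs f (upd s v c) = isum vs (fun t => f (upd t v c)) s.
Proof.
elim: vs s => //= w vs IH s; rewrite in_cons negb_or => /andP[vw vn].
by rewrite !(updC _ _ _ vw) !IH.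
Qed.

Lemma isum_inv vs f g s : (forall t v c, v \in vs -> g (upd t v c) = g t) ->
  isum vs (fun t => g t * f t) s = g s * isum vs f s.
Proof.
elim: vs s => //= w vs IH s gi.
by rewrite !IH ?gi ?mem_head -?mulrDr // => t v c vin; apply: gi; rewrite in_cons vin orbT.
Qed.

Lemma isum_swap vs ws (F : conf -> conf -> R) a b :
  isum vs (fun s => isum ws (F s) b) a = isum ws (fun t => isum vs (F^~ t) a) b.
Proof. by elim: vs a => //= v vs IH a; rewrite !IH -isumD. Qed.

Lemma isum_rem vs v f s : uniq vs -> v \in vs -> isum vs f s = isum (v :: rem v vs) f s.
Proof.
elim: vs s => //= w vs IH s /andP[wn uvs]; rewrite in_cons.
have [->|wv] := eqVneq w v; first by rewrite ?eqxx.
rewrite /= => vin.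
rewrite !IH //= !(updC _ _ _ wv).
by rewrite addrACA.
Qed.

Lemma isum_perm vs ws f s : uniq vs -> perm_eq vs ws -> isum vs f s = isum ws f s.
Proof.
elim: vs ws s => [|v vs IH] ws s uvs pe.
  by move: pe; rewrite perm_sym => /perm_nilP ->.
have uws : uniq ws by rewrite -(perm_uniq pe).
have vin : v \in ws by rewrite -(perm_mem pe) mem_head.
have pe' : perm_eq vs (rem v ws).
  by rewrite -(perm_cons v) (perm_trans pe) // perm_to_rem.
rewrite (isum_rem _ _ uws vin) /= !(IH (rem v ws)) //; by case/andP: uvs.
Qed.

Lemma avg_cst vs w c s : (forall t, 0 < w t) -> avg vs w (fun=> c) s = c.
Proof.
by move=> w0; rewrite /avg isumZ mulfK // gt_eqF // isum_gt0.
Qed.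

Lemma avgD vs w f g s : avg vs w (fun t => f t + g t) s = avg vs w f s + avg vs w g s.
Proof.
rewrite /avg -mulrDl -isumD; congr (_ / _); apply: eq_isum => t.
by rewrite mulrDl.
Qed.

Lemma avgZ vs w c f s : avg vs w (fun t => c * f t) s = c * avg vs w f s.
Proof.
rewrite /avg mulrA -isumZ; congr (_ / _); apply: eq_isum => t.
by rewrite mulrA.
Qed.

Lemma avgB vs w f g s : avg vs w (fun t => f t - g t) s = avg vs w f s - avg vs w g s.
Proof.
rewrite /avg -mulrBl -isumB; congr (_ / _); apply: eq_isum => t.
by rewrite mulrBl.
Qed.

Lemma le_avg vs w f g s : (forall t, 0 < w t) -> (forall t, f t <= g t) ->
  avg vs w f s <= avg vs w g s.
Proof.
move=> w0 fg; rewrite ler_pM2r ?invr_gt0 ?isum_gt0 //.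
by apply: le_isum => t; rewrite ler_pM2r.
Qed.

Lemma eq_avg vs w f g s : f =1 g -> avg vs w f s = avg vs w g s.
Proof. by move=> fg; congr (_ / _); apply: eq_isum => t; rewrite fg. Qed.

Lemma avg_sum I (r : seq I) (P : pred I) (F : I -> conf -> R) vs w s :
  avg vs w (fun t => \sum_(i <- r | P i) F i t) s = \sum_(i <- r | P i) avg vs w (F i) s.
Proof.
rewrite /avg -mulr_suml -isum_sum; congr (_ / _); apply: eq_isum => t.
by rewrite mulr_suml.
Qed.

(** The constant [c] absorbs the factors of the weight that depend on frozen spins only; it cancels
    in the quotient. *)
Lemma avg_wscale vs w w' c f a b : c != 0 ->
  (forall s t, {in vs, s =1 t} -> (forall x, x \notin vs -> s x = a x) ->
     (forall x, x \notin vs -> t x = b x) -> w s = c * w' t /\ f s = f t) ->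
  avg vs w f a = avg vs w' f b.
Proof.
move=> c0 H; rewrite /avg.
have -> : isum vs w a = c * isum vs w' b.
  by rewrite -isumZ; apply: isum_rel => s t h1 h2 h3; case: (H s t).
have -> : isum vs (fun t => f t * w t) a = c * isum vs (fun t => f t * w' t) b.
  rewrite -isumZ; apply: isum_rel => s t h1 h2 h3; case: (H s t) => // -> ->.
  by rewrite mulrCA.
by rewrite invfM mulrACA divff // mul1r.
Qed.

(** * Stochastic monotonicity *)

(* Log-supermodularity, tested one spin at a time. *)
Definition lat w := (forall s, 0 < w s) /\
  forall v s t, cle s t ->
    w (upd s v true) * w (upd t v false) <= w (upd t v true) * w (upd s v false).

(** Averaging over the other sites first leaves a two-point mixture at [v]. Raising the boundary
    condition raises both conditional means, and also the share of the larger one. *)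
Lemma avg_mono vs w f : uniq vs -> lat w -> mono f -> mono (avg vs w f).
Proof.
move=> + [w0 wlat].
elim: vs f => [|v vs IH] f /=.
  move=> _ fm s t st; rewrite /avg /= !mulfK ?gt_eqF //; exact: fm.
move=> /andP[vn uvs] fm s t st.
pose A (e : bool) r := isum vs (fun u => f u * w u) (upd r v e).
pose Z (e : bool) r := isum vs w (upd r v e).
have Z0 e r : 0 < Z e r by apply: isum_gt0.
have Am e c r r' : cle r r' -> e ==> c -> A e r / Z e r <= A c r' / Z c r'.
  by move=> rr bc; apply: (IH f uvs fm); apply: cle_upd.
(* the ratio of the two partition functions is a mean of the increasing
   single-spin ratio *)
have Zr : Z true s * Z false t <= Z true t * Z false s.
  pose rho r := w (upd r v true) / w (upd r v false).
  have rm : mono rho.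
    move=> r r' rr; rewrite /rho ler_pdivrMr // mulrAC ler_pdivlMr //.
    exact: wlat.
  have ZE r : Z true r / Z false r = avg vs w rho (upd r v false).
    rewrite /avg; congr (_ / _); rewrite /Z !isum_upd //.
    apply: eq_isum => u; rewrite /rho !upd_upd divfK // gt_eqF //.
  have := IH rho uvs rm (upd s v false) (upd t v false).
  rewrite -!ZE ler_pdivrMr // mulrAC ler_pdivlMr //; apply.
  exact: cle_upd.
have AE e r : A e r = (A e r / Z e r) * Z e r by rewrite divfK // gt_eqF.
rewrite /avg /= -/(A true s) -/(A false s) -/(A true t) -/(A false t).
rewrite -/(Z true s) -/(Z false s) -/(Z true t) -/(Z false t).
rewrite (AE true s) (AE false s) (AE true t) (AE false t).
have m1 := Am true true s t st isT.
have m2 := Am false false s t st isT.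
have m3 := Am false true t t (cle_refl t) isT.
move: m1 m2 m3 (Z0 true s) (Z0 false s) (Z0 true t) (Z0 false t) Zr.
move: (A true s / _) (A false s / _) (A true t / _) (A false t / _).
move: (Z true s) (Z false s) (Z true t) (Z false t).
move=> z1 z2 z3 z4 m1 m2 m3 m4 h1 h2 h3 p1 p2 p3 p4 hz.
rewrite ler_pdivrMr ?addr_gt0 // mulrAC ler_pdivlMr ?addr_gt0 //.
apply: (@le_trans _ _ ((m3 * z1 + m4 * z2) * (z3 + z4))).
  rewrite ler_pM2r ?addr_gt0 // lerD // ler_pM2r //.
rewrite -subr_ge0.
rewrite [X in 0 <= X](_ : _ = (m3 - m4) * (z3 * z2 - z1 * z4)); last by ring.
by apply: mulr_ge0; rewrite subr_ge0.
Qed.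

Lemma latM w w' : lat w -> lat w' -> lat (fun s => w s * w' s).
Proof.
move=> [w0 wl] [w'0 wl']; split=> [s|v s t st]; first exact: mulr_gt0.
rewrite mulrACA [leRHS]mulrACA.
have g0 x y : 0 <= w x * w y by rewrite mulr_ge0 ?ltW.
have g0' x y : 0 <= w' x * w' y by rewrite mulr_ge0 ?ltW.
by apply: ler_pM; rewrite ?wl ?wl'.
Qed.

Lemma lat_cst c : 0 < c -> lat (fun=> c).
Proof. by move=> c0; split. Qed.

End Configurations.

(** * Ising weights and Griffiths' inequalities *)

Section Griffiths.
Variables (T : eqType) (R : realType).
Implicit Types (s t : conf T) (vs A B : seq T) (f g : conf T -> R) (u v x : T).
Notation "s `_[ x ]" := (spin R (s x)) (at level 2, format "s `_[ x ]").

Lemma spin_sqr b : spin R b * spin R b = 1.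
Proof. by case: b => /=; rewrite ?mulrNN mulr1. Qed.

Lemma spin_le1 b : spin R b <= 1.
Proof. by case: b => //=; lra. Qed.

Lemma spin_geN1 b : -1 <= spin R b.
Proof. by case: b => //=; lra. Qed.

Lemma spin_eqb b c : spin R (b == c) = spin R b * spin R c.
Proof. by case: b; case: c => /=; rewrite ?mulr1 ?mul1r ?mulrNN ?mulr1. Qed.

Lemma spinN b : spin R (~~ b) = - spin R b.
Proof. by case: b => //=; rewrite opprK. Qed.

Lemma spin_mono b c : b ==> c -> spin R b <= spin R c.
Proof. by case: b; case: c => //= _; lra. Qed.

Definition chi A s : R := \prod_(x <- A) s`_[x].

Lemma chi1 x s : chi [:: x] s = s`_[x].
Proof. exact: big_seq1. Qed.

Lemma chi2 x y s : chi [:: x; y] s = s`_[x] * s`_[y].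
Proof. by rewrite /chi big_cons big_seq1. Qed.

Lemma chi_le1 A s : chi A s <= 1.
Proof.
suff [->|->] : chi A s = 1 \/ chi A s = -1 by [|lra].
elim: A => [|x A IH]; first by left; rewrite /chi big_nil.
rewrite /chi big_cons -/(chi A s).
by case: (s x) IH => /= -[->|->]; rewrite ?mulrNN ?mulr1 ?mul1r; auto.
Qed.

(** With [true] for +1, multiplication of spins is Boolean equality, so this is the pointwise
    product of configurations; for fixed [s] it is a bijection, hence a change of variables. *)
Definition cxor s t : conf T := fun x => s x == t x.

Lemma chi_cxor A s t : chi A (cxor s t) = chi A s * chi A t.
Proof. by rewrite /chi -big_split; apply: eq_bigr => x _; rewrite /cxor spin_eqb. Qed.

Lemma isum_cxor vs f s b : isum vs (fun t => f (cxor s t)) b = isum vs f (cxor s b).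
Proof.
elim: vs b => //= v vs IH b; rewrite !IH.
have xu c : cxor s (upd b v c) = upd (cxor s b) v (s v == c).
  by apply/funext => x; rewrite /cxor /upd; case: (x =P v) => [->|_].
by rewrite !xu; case: (s v) => //=; rewrite addrC.
Qed.

(* Nonnegative combinations of the characters [chi A]. *)
Inductive pos : (conf T -> R) -> Prop :=
| pos_cst c : 0 <= c -> pos (fun=> c)
| pos_spin x : pos (fun s => s`_[x])
| pos_add f g : pos f -> pos g -> pos (fun s => f s + g s)
| pos_mul f g : pos f -> pos g -> pos (fun s => f s * g s).

Lemma pos_ext f g : f =1 g -> pos f -> pos g.
Proof. by move=> /funext ->. Qed.

Lemma pos_true f : pos f -> 0 <= f (fun=> true).
Proof.
by elim => //= *; [rewrite addr_ge0|rewrite mulr_ge0].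
Qed.

Lemma pos_chi A : pos (chi A).
Proof.
elim: A => [|x A IH].
  by apply: (pos_ext _ (pos_cst ler01)) => s; rewrite /chi big_nil.
by apply: (pos_ext _ (pos_mul (pos_spin x) IH)) => s; rewrite /chi big_cons.
Qed.

(** Isolates the part odd in the spin at [v]: summing over that spin kills it and doubles the rest,
    so [pos_isum] never meets a negative coefficient. *)
Lemma pos_split v f : pos f -> exists f0 f1, [/\ pos f0, pos f1,
  forall s c, f0 (upd s v c) = f0 s, forall s c, f1 (upd s v c) = f1 s &
  forall s, f s = f0 s + s`_[v] * f1 s].
Proof.
elim => [c c0|x|g h _ [g0 [g1 [p0 p1 i0 i1 gE]]] _ [h0 [h1 [q0 q1 j0 j1 hE]]]|
         g h _ [g0 [g1 [p0 p1 i0 i1 gE]]] _ [h0 [h1 [q0 q1 j0 j1 hE]]]].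
- exists (fun=> c), (fun=> 0); split=> //; try by [apply: pos_cst].
  by move=> s; rewrite mulr0 addr0.
- have [->|xv] := eqVneq x v.
    exists (fun=> 0), (fun=> 1); split=> //; try by [apply: pos_cst].
    by move=> s; rewrite mulr1 add0r.
  exists (fun s => s`_[x]), (fun=> 0); split=> //; try by [apply: pos_cst|apply: pos_spin].
    by move=> s c; rewrite updN.
  by move=> s; rewrite mulr0 addr0.
- exists (fun s => g0 s + h0 s), (fun s => g1 s + h1 s); split.
  + exact: pos_add.
  + exact: pos_add.
  + by move=> s c; rewrite i0 j0.
  + by move=> s c; rewrite i1 j1.
  + by move=> s; rewrite gE hE; ring.
- exists (fun s => g0 s * h0 s + g1 s * h1 s), (fun s => g0 s * h1 s + g1 s * h0 s); split.
  + by apply: pos_add; apply: pos_mul.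
  + by apply: pos_add; apply: pos_mul.
  + by move=> s c; rewrite i0 j0 i1 j1.
  + by move=> s c; rewrite i0 j0 i1 j1.
  + move=> s; rewrite gE hE.
    have := spin_sqr (s v); move: (s`_[v]) => a a2.
    rewrite mulrDl !mulrDr; rewrite (mulrACA a _ a) a2 mul1r; ring.
Qed.

Lemma pos_isum vs f : pos f -> pos (isum vs f).
Proof.
elim: vs => //= v vs IH /IH /(pos_split v)[f0 [f1 [p0 _ i0 i1 fE]]].
apply: (pos_ext _ (pos_add p0 p0)) => s.
by rewrite !fE !updE i0 i1 i0 i1 /=; ring.
Qed.

(** For a sign $\epsilon$ one has $e^{J\epsilon}=\cosh J+\epsilon\sinh J$, with both coefficients
    nonnegative. *)
Lemma pos_exp J u v : 0 <= J -> pos (fun s => expR (J * (s`_[u] * s`_[v]))).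
Proof.
move=> J0.
have h0 : 0 <= (expR J + expR (- J)) / 2.
  by rewrite divr_ge0 // addr_ge0 // expR_ge0.
have h1 : 0 <= (expR J - expR (- J)) / 2.
  by rewrite divr_ge0 // subr_ge0 ler_expR; lra.
apply: (pos_ext _ (pos_add (pos_cst h0)
  (pos_mul (pos_cst h1) (pos_mul (pos_spin u) (pos_spin v))))) => s.
have [->|->] : s`_[u] * s`_[v] = 1 \/ s`_[u] * s`_[v] = -1.
  by case: (s u); case: (s v); rewrite /= ?mulr1 ?mulrNN ?mul1r ?mulr1; auto.
- by rewrite !mulr1; field.
- by rewrite !mulrN1; field.
Qed.

End Griffiths.

Section Ising_weights.
Variables (T Ed : eqType) (R : realType) (e1 e2 : Ed -> T).
Implicit Types (s t : conf T) (vs A B : seq T) (f g : conf T -> R) (u v x : T).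
Implicit Types (e : Ed) (E : seq Ed) (b : R).
Notation "s `_[ x ]" := (spin R (s x)) (at level 2, format "s `_[ x ]").

Definition ends e := [:: e1 e; e2 e].

Definition bond s e : R := s`_[e1 e] * s`_[e2 e].

Lemma chi_ends e : chi R (ends e) = bond^~ e.
Proof. by apply/funext => s; rewrite chi2. Qed.

Lemma bondPN s e : bond s e = 1 \/ bond s e = -1.
Proof.
by rewrite /bond; case: (s _); case: (s _); rewrite /= ?mulr1 ?mul1r ?mulrNN ?mulr1; auto.
Qed.

Definition en E s : R := \sum_(e <- E) bond s e.

Definition wt b E s : R := expR (b * en E s).

Lemma wt_gt0 b E s : 0 < wt b E s.
Proof. exact: expR_gt0. Qed.
Hint Resolve wt_gt0 : core.

Lemma wt_cons b e E s : wt b (e :: E) s = expR (b * bond s e) * wt b E s.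
Proof. by rewrite /wt /en big_cons mulrDr expRD. Qed.

Lemma wt_perm b E E' : perm_eq E E' -> wt b E = wt b E'.
Proof.
by move=> pe; apply/funext => s; rewrite /wt /en (perm_big _ pe).
Qed.

Lemma wt_cat b E E' s : wt b (E ++ E') s = wt b E s * wt b E' s.
Proof. by rewrite /wt /en big_cat mulrDr expRD. Qed.

Lemma lat_exp_sum I (r : seq I) (F : I -> conf T -> R) :
  (forall i, lat (fun s => expR (F i s))) -> lat (fun s => expR (\sum_(i <- r) F i s)).
Proof.
move=> h; elim: r => [|i r IH].
  have -> : (fun s => expR (\sum_(i <- [::]) F i s)) = fun=> 1.
    by apply/funext => s; rewrite big_nil expR0.
  exact: lat_cst.
have -> : (fun s => expR (\sum_(i <- i :: r) F i s)) =
    fun s => expR (F i s) * expR (\sum_(i <- r) F i s).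
  by apply/funext => s; rewrite big_cons expRD.
exact: latM.
Qed.

Lemma lat_bond b e : 0 <= b -> lat (fun s => expR (b * bond s e)).
Proof.
move=> b0; split=> [s|v s t st]; first exact: expR_gt0.
rewrite -!expRD ler_expR -!mulrDr ler_wpM2l // /bond /upd.
have m x := spin_mono R (st x).
case: (e1 e == v); case: (e2 e == v) => /=; rewrite ?mulr1 ?mul1r ?mulN1r ?mulrN1 ?opprK //.
- by have := m (e2 e); lra.
- by have := m (e1 e); lra.
- by rewrite addrC.
Qed.

Lemma lat_wt b E : 0 <= b -> lat (wt b E).
Proof.
move=> b0; have -> : wt b E = fun s => expR (\sum_(e <- E) b * bond s e).
  by apply/funext => s; rewrite /wt mulr_sumr.
by apply: lat_exp_sum => e; apply: lat_bond.
Qed.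

Lemma lat_field (k : R) x : lat (fun s => expR (k * s`_[x])).
Proof.
split=> [s|v s t st]; first exact: expR_gt0.
by rewrite mulrC /upd; case: eqP => // _; rewrite mulrC.
Qed.

Definition plus : conf T := fun=> true.

Lemma GKS1 vs b E A : 0 <= b -> 0 <= avg vs (wt b E) (chi R A) plus.
Proof.
move=> b0; apply: divr_ge0; last by rewrite ltW // isum_gt0.
apply: (pos_true (pos_isum _ _)); apply: pos_mul; first exact: pos_chi.
elim: E => [|e E IH].
  by apply: (pos_ext _ (pos_cst _ ler01)) => s; rewrite /wt /en big_nil mulr0 expR0.
apply: (pos_ext _ (pos_mul (pos_exp (e1 e) (e2 e) b0) IH)) => s.
by rewrite wt_cons.
Qed.

(* Ginibre's duplication: with [s' = s t], the integrand
   [chi B s * (chi A s - chi A s') * wt s * wt s'] is, for each fixed [t], a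
   nonnegative combination of characters of [s]. *)
Lemma GKS2 vs b E A B : 0 <= b ->
  avg vs (wt b E) (chi R A) plus * avg vs (wt b E) (chi R B) plus <=
  avg vs (wt b E) (fun s => chi R A s * chi R B s) plus.
Proof.
move=> b0; set w := wt b E.
have Z0 : 0 < isum vs w plus by apply: isum_gt0 => s; apply: wt_gt0.
suff main : 0 <= isum vs (fun s => isum vs (fun t =>
    chi R B s * (chi R A s - chi R A t) * (w s * w t)) plus) plus.
  have dist : isum vs (fun s => isum vs (fun t =>
     chi R B s * (chi R A s - chi R A t) * (w s * w t)) plus) plus =
     isum vs (fun s => chi R A s * chi R B s * w s) plus * isum vs w plus -
     isum vs (fun s => chi R A s * w s) plus * isum vs (fun s => chi R B s * w s) plus.
    have inner s : isum vs (fun t => chi R B s * (chi R A s - chi R A t) * (w s * w t)) plus =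
      isum vs w plus * (chi R A s * chi R B s * w s) -
      isum vs (fun s => chi R A s * w s) plus * (chi R B s * w s).
      rewrite [X in _ = X - _]mulrC [X in _ = _ - X]mulrC -!isumZ -isumB.
      by apply: eq_isum => t; ring.
    rewrite (eq_isum _ _ inner) isumB !isumZ; ring.
  rewrite /avg -/w; move: main; rewrite dist subr_ge0 => main.
  rewrite mulrACA -invfM ler_pdivrMr ?mulr_gt0 // mulrA divfK ?gt_eqF //.
have -> : isum vs (fun s => isum vs (fun t =>
    chi R B s * (chi R A s - chi R A t) * (w s * w t)) plus) plus =
  isum vs (fun s => isum vs (fun t =>
    chi R B s * (chi R A s - chi R A (cxor s t)) * (w s * w (cxor s t))) plus) plus.
  apply: eq_isum_in => s sE.
  rewrite (isum_cxor vs (fun r => chi R B s * (chi R A s - chi R A r) * (w s * w r))).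
  by apply: isum_base => x xn; rewrite /cxor sE.
rewrite isum_swap; apply: isum_ge0 => t.
apply: (pos_true (pos_isum _ _)).
have pw : pos (fun s => w s * w (cxor s t)).
  rewrite /w; elim: E {w Z0} => [|e E IH].
    by apply: (pos_ext _ (pos_cst _ ler01)) => s; rewrite /wt /en !big_nil mulr0 expR0 mulr1.
  have J0 : 0 <= b * (1 + bond t e).
    by rewrite mulr_ge0 //; case: (bondPN t e) => ->; lra.
  apply: (pos_ext _ (pos_mul (pos_exp (e1 e) (e2 e) J0) IH)) => s.
  have bx : bond (cxor s t) e = bond s e * bond t e.
    by rewrite /bond /cxor !spin_eqb; ring.
  rewrite !wt_cons bx [RHS]mulrACA; congr (_ * _).
  by rewrite -expRD; congr (expR _); rewrite /bond; ring.
have c0 : 0 <= 1 - chi R A t by rewrite subr_ge0 chi_le1.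
apply: (pos_ext _ (pos_mul (pos_mul (pos_chi R B) (pos_mul (pos_chi R A) (pos_cst _ c0))) pw)) => s.
by rewrite chi_cxor; ring.
Qed.

(** Up to the factor $\cosh b$, which cancels, the new bond multiplies the weight by one plus $\tanh
    b$ times the product of its end spins. *)
Lemma avg_cons vs b e E f s : let t := (expR b - expR (- b)) / (expR b + expR (- b)) in
  avg vs (wt b (e :: E)) f s =
  (avg vs (wt b E) f s + t * avg vs (wt b E) (fun r => f r * bond r e) s) /
  (1 + t * avg vs (wt b E) (bond^~ e) s).
Proof.
move=> t; have S0 : 0 < expR b + expR (- b) :> R by rewrite addr_gt0 ?expR_gt0.
have Z0 : 0 < isum vs (wt b E) s by apply: isum_gt0.
have eE r : wt b (e :: E) r = (expR b + expR (- b)) / 2 * ((1 + t * bond r e) * wt b E r).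
  rewrite wt_cons mulrA; congr (_ * _); rewrite /t.
  by case: (bondPN r e) => ->; rewrite ?mulr1 ?mulrN1; field; rewrite gt_eqF.
rewrite /avg.
have -> : isum vs (wt b (e :: E)) s = (expR b + expR (- b)) / 2 *
   (isum vs (wt b E) s + t * isum vs (fun r => bond r e * wt b E r) s).
  rewrite -!isumZ -isumD -isumZ; apply: eq_isum => r; rewrite eE; ring.
have -> : isum vs (fun r => f r * wt b (e :: E) r) s = (expR b + expR (- b)) / 2 *
   (isum vs (fun r => f r * wt b E r) s + t * isum vs (fun r => f r * bond r e * wt b E r) s).
  rewrite -!isumZ -isumD -isumZ; apply: eq_isum => r; rewrite eE; ring.
rewrite -mulf_div divff ?mul1r; last by rewrite gt_eqF // divr_gt0.
rewrite !mulrA -[X in _ = _ / (X + _)](divff (lt0r_neq0 Z0)) -!mulrDl.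
by rewrite -mulf_div divff ?mulr1 // invr_neq0 // gt_eqF.
Qed.

Definition tanhb b : R := (expR b - expR (- b)) / (expR b + expR (- b)).

Lemma tanhb_ge0 b : 0 <= b -> 0 <= tanhb b.
Proof.
move=> b0; apply: divr_ge0; last by rewrite addr_ge0 ?expR_ge0.
by rewrite subr_ge0 ler_expR; lra.
Qed.

Lemma tanhb_le1 b : tanhb b <= 1.
Proof.
rewrite ler_pdivrMr ?addr_gt0 ?expR_gt0 // mul1r.
have := expR_gt0 (- b); lra.
Qed.

Lemma GKS_cons vs b e E A : 0 <= b ->
  avg vs (wt b E) (chi R A) plus <= avg vs (wt b (e :: E)) (chi R A) plus.
Proof.
move=> b0; rewrite avg_cons -/(tanhb b).
have := GKS2 vs E A (ends e) b0; rewrite chi_ends => h.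
have := GKS1 vs E (ends e) b0; rewrite chi_ends => h'.
have t0 := tanhb_ge0 b0.
rewrite ler_pdivlMr ?mulrDr ?mulr1 ?lerD2l; last first.
  by rewrite ltr_pwDl // mulr_ge0.
by rewrite mulrCA ler_wpM2l.
Qed.

Lemma GKS_filter vs b E (P : pred Ed) A : 0 <= b ->
  avg vs (wt b [seq e <- E | P e]) (chi R A) plus <= avg vs (wt b E) (chi R A) plus.
Proof.
move=> b0; have pe : perm_eq ([seq e <- E | predC P e] ++ [seq e <- E | P e]) E.
  by rewrite perm_catC perm_filterC.
rewrite -(wt_perm b pe); elim: [seq e <- E | predC P e] => //= e F IH.
by rewrite (le_trans IH) // GKS_cons.
Qed.

End Ising_weights.

(** * Exploration of bonds from the frozen sites *)

Section Exploration.
Variables (T Ed : eqType) (R : realType) (e1 e2 : Ed -> T).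
Implicit Types (s t : conf T) (vs A B : seq T) (f g w : conf T -> R) (u v x : T).
Implicit Types (e : Ed) (E : seq Ed) (b : R).
Notation "s `_[ x ]" := (spin R (s x)) (at level 2, format "s `_[ x ]").
Notation bond := (bond R e1 e2).
Notation wt := (wt e1 e2).

Definition inside vs e := (e1 e \in vs) && (e2 e \in vs).

(* The free sites once the ends of [e] have been frozen. *)
Definition del e vs := [seq x <- vs | (x != e1 e) && (x != e2 e)].

Lemma mem_del e vs x : (x \in del e vs) = [&& x != e1 e, x != e2 e & x \in vs].
Proof. by rewrite mem_filter andbA. Qed.

Lemma del_uniq e vs : uniq vs -> uniq (del e vs).
Proof. exact: filter_uniq. Qed.

Lemma explore_ind (P : seq T -> seq Ed -> Prop) :
  (forall vs E E', perm_eq E E' -> P vs E -> P vs E') ->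
  (forall vs E, uniq vs -> all (inside vs) E -> P vs E) ->
  (forall vs e E, uniq vs -> ~~ inside vs e -> P vs E -> P (del e vs) E ->
     P vs (e :: E)) ->
  forall vs E, uniq vs -> P vs E.
Proof.
move=> Pp P0 PS vs E; have [n] := ubnP (size E).
elim: n vs E => // n IH vs E sE uvs.
have [/P0 h|/allPn[e eE en]] := boolP (all (inside vs) E); first exact: h.
apply: (Pp _ (e :: rem e E)); first by rewrite perm_sym perm_to_rem.
have sr : (size (rem e E) < n)%N.
  by move: sE; rewrite size_rem // ltnS; case: E eE => //= *; lia.
by apply: PS => //; apply: IH => //; apply: del_uniq.
Qed.

Lemma isum_split1 vs f u s : uniq vs -> u \in vs ->
  isum vs f s = isum [seq x <- vs | x != u] f (upd s u true) +
                isum [seq x <- vs | x != u] f (upd s u false).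
Proof. by move=> uvs uin; rewrite (isum_rem _ _ uvs uin) rem_filter. Qed.

(** Because the boundary condition is [c] everywhere, the indicator that the spin at [v] equals [c]
    is imposed by dropping [v] from the list. If [v] is already frozen, the two coefficients add up
    to $e^b$. *)
Lemma isum_freeze1 vs f b u v c : uniq vs -> u \notin vs ->
  isum vs (fun s => expR (b * (s`_[u] * s`_[v])) * f s) (fun=> c) =
  expR (- b) * isum vs f (fun=> c) +
  (expR b - expR (- b)) *
    isum [seq x <- vs | (x != u) && (x != v)] f (fun=> c).
Proof.
move=> uvs un.
have -> : [seq x <- vs | (x != u) && (x != v)] = [seq x <- vs | x != v].
  by apply: eq_in_filter => x xin; case: eqP xin un => // -> ->.
have uE s : (forall x, x \notin vs -> s x = c) -> s u = c by apply.
have [vin|vn] := boolP (v \in vs); last first.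
  have -> : [seq x <- vs | x != v] = vs.
    by rewrite (eq_in_filter (a2 := predT)) ?filter_predT // => x xin; case: eqP xin vn => // -> ->.
  rewrite -mulrDl addrCA subrr addr0 -isumZ.
  by apply: eq_isum_in => s sE; rewrite !sE // spin_sqr mulr1.
rewrite !(isum_split1 _ _ uvs vin).
have upc : upd (fun=> c) v c = (fun=> c) :> conf T.
  by apply/funext => x; rewrite /upd; case: ifP.
set ws := [seq x <- vs | x != v].
have vw : v \notin ws by rewrite mem_filter eqxx.
have uw : u \notin ws by rewrite mem_filter negb_and un orbT.
have uv : u != v by apply: contraNneq un => ->.
have key c' : isum ws (fun s => expR (b * (s`_[u] * s`_[v])) * f s) (upd (fun=> c) v c') =
    expR (b * (spin R c * spin R c')) * isum ws f (upd (fun=> c) v c').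
  rewrite -isumZ; apply: eq_isum_in => s sE.
  by rewrite !sE // updE updN.
rewrite !key; case: {key} c upc {uE} => /= ->; rewrite /= ?mulrNN ?mulr1 ?mul1r ?mulrN1 ?mulNr ?mulrN ?opprK ?mulr1; ring.
Qed.

Lemma isum_freeze vs f b e c : uniq vs -> ~~ inside vs e ->
  isum vs (fun s => expR (b * bond s e) * f s) (fun=> c) =
  expR (- b) * isum vs f (fun=> c) +
  (expR b - expR (- b)) * isum (del e vs) f (fun=> c).
Proof.
move=> uvs; rewrite negb_and => /orP[un|un].
  by rewrite isum_freeze1.
have -> : del e vs = [seq x <- vs | (x != e2 e) && (x != e1 e)].
  by apply: eq_filter => x; rewrite andbC.
rewrite -isum_freeze1 //.
by apply: eq_isum => s; rewrite /bond (mulrC s`_[e1 e]).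
Qed.

(* The conditional probability that the bond is open. *)
Definition openp vs w b e c : R :=
  (expR b - expR (- b)) * isum (del e vs) w (fun=> c) /
  (expR (- b) * isum vs w (fun=> c) +
   (expR b - expR (- b)) * isum (del e vs) w (fun=> c)).

Lemma avg_freeze vs w b e c f : uniq vs -> ~~ inside vs e -> 0 <= b ->
  (forall s, 0 < w s) -> let q := openp vs w b e c in
  avg vs (fun s => expR (b * bond s e) * w s) f (fun=> c) =
  (1 - q) * avg vs w f (fun=> c) + q * avg (del e vs) w f (fun=> c).
Proof.
move=> uvs en b0 w0 q; rewrite /avg isum_freeze //.
have -> : isum vs (fun s => f s * (expR (b * bond s e) * w s)) (fun=> c) =
  isum vs (fun s => expR (b * bond s e) * (f s * w s)) (fun=> c).
  by apply: eq_isum => s; rewrite mulrCA.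
rewrite isum_freeze // /q /openp.
have Z0 : 0 < isum vs w (fun=> c) by apply: isum_gt0.
have Z1 : 0 < isum (del e vs) w (fun=> c) by apply: isum_gt0.
have d0 : 0 <= expR b - expR (- b) by rewrite subr_ge0 ler_expR; lra.
have c0 := expR_gt0 (- b).
move: d0 c0 Z0 Z1; move: (expR b - expR (- b)) => d; move: (expR (- b)) => k.
move: (isum vs w _) (isum (del e vs) w _) => z1 z2 d0 k0 z10 z20.
have S0 : 0 < k * z1 + d * z2 by rewrite ltr_pwDl ?mulr_gt0 // mulr_ge0 // ltW.
by field; rewrite !gt_eqF.
Qed.

Lemma openp_ge0 vs w b e c : 0 <= b -> (forall s, 0 < w s) -> 0 <= openp vs w b e c.
Proof.
move=> b0 w0.
have d0 : 0 <= expR b - expR (- b) by rewrite subr_ge0 ler_expR; lra.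
have Z1 : 0 <= isum (del e vs) w (fun=> c) by apply: isum_ge0 => s; rewrite ltW.
have Z0 : 0 <= isum vs w (fun=> c) by apply: isum_ge0 => s; rewrite ltW.
by rewrite divr_ge0 ?addr_ge0 ?mulr_ge0 ?expR_ge0.
Qed.

Lemma openp_le1 vs w b e c : 0 <= b -> (forall s, 0 < w s) -> openp vs w b e c <= 1.
Proof.
move=> b0 w0.
have d0 : 0 <= expR b - expR (- b) by rewrite subr_ge0 ler_expR; lra.
have Z1 : 0 < isum (del e vs) w (fun=> c) by apply: isum_gt0.
have Z0 : 0 < isum vs w (fun=> c) by apply: isum_gt0.
rewrite ler_pdivrMr ?mul1r ?lerDr ?mulr_ge0 ?expR_ge0 ?(ltW Z0) //.
by rewrite ltr_pwDl ?mulr_gt0 ?expR_gt0 // mulr_ge0 // ltW.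
Qed.

End Exploration.

(** * Sharpness for the Ising model *)

Section Ising_sharpness.
Variables (T Ed : eqType) (R : realType) (e1 e2 : Ed -> T).
Implicit Types (s t : conf T) (vs A B S : seq T) (f g w : conf T -> R) (u v x o : T).
Implicit Types (e : Ed) (E : seq Ed) (b k : R).
Notation "s `_[ x ]" := (spin R (s x)) (at level 2, format "s `_[ x ]").
Notation bond := (bond R e1 e2).
Notation wt := (wt e1 e2).
Notation inside := (inside e1 e2).
Notation del := (del e1 e2).
Notation chi := (chi R).
Notation ends := (ends e1 e2).
Notation plus := (@plus T).

(** Conditioning on a plus spin at [u] multiplies the weight by $(1+\sigma_u)/2$, so this is
    Griffiths' second inequality for [A] and [u]. *)
Lemma GKS_freeze1 vs b E A u : 0 <= b -> uniq vs -> u \in vs ->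
  avg vs (wt b E) (chi A) plus <= avg [seq x <- vs | x != u] (wt b E) (chi A) plus.
Proof.
move=> b0 uvs uin; set w := wt b E; set ws := [seq x <- vs | x != u].
have w0 s : 0 < w s by apply: wt_gt0.
have up : upd plus u true = plus by apply/funext => x; rewrite /upd; case: ifP.
have half f : isum ws f plus = (isum vs f plus + isum vs (fun s => f s * s`_[u]) plus) / 2.
  rewrite -isumD (isum_split1 _ _ uvs uin) -/ws up.
  have uw : u \notin ws by rewrite mem_filter eqxx.
  rewrite [X in (_ + X) / _](_ : _ = 0).
    rewrite addr0 mulrC -isumZ; apply: eq_isum_in => s sE.
    by rewrite sE //= mulr1; field.
  rewrite -[RHS](isum0 R ws (upd plus u false)); apply: eq_isum_in => s sE.
  by rewrite sE // updE mulrN1 subrr.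
have Z0 : 0 < isum vs w plus by apply: isum_gt0.
have Z1 : 0 < isum ws w plus by apply: isum_gt0.
have h := GKS2 e1 e2 vs E A [:: u] b0.
have E1 : isum vs (fun s => chi [:: u] s * w s) plus = isum vs (fun s => w s * s`_[u]) plus.
  by apply: eq_isum => s; rewrite chi1 mulrC.
have E2 : isum vs (fun s => chi A s * chi [:: u] s * w s) plus =
    isum vs (fun s => chi A s * w s * s`_[u]) plus.
  by apply: eq_isum => s; rewrite chi1 mulrAC.
rewrite /avg -/w E1 E2 in h.
rewrite /avg in h *; rewrite (half w) (half (fun t => chi A t * w t)).
rewrite (half w) in Z1.
move: h Z0 Z1; move: (isum vs (fun t => chi A t * w t) _) => a.
move: (isum vs (fun t => chi A t * w t * _) _) => aS.
move: (isum vs (fun t => w t * _) _) => zS; move: (isum vs w _) => z h z0 z1.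
rewrite mulrACA -invfM ler_pdivrMr ?mulr_gt0 // mulrA divfK ?gt_eqF // in h.
rewrite ler_pdivrMr // mulrAC ler_pdivlMr //.
rewrite -subr_ge0 (_ : _ - _ = (aS * z - a * zS) / 2); last by field.
by rewrite divr_ge0 // subr_ge0.
Qed.

Lemma GKS_freeze vs b E A e : 0 <= b -> uniq vs -> ~~ inside vs e ->
  avg vs (wt b E) (chi A) plus <= avg (del e vs) (wt b E) (chi A) plus.
Proof.
move=> b0 uvs en.
have aux u v : u \notin vs -> avg vs (wt b E) (chi A) plus <=
    avg [seq x <- vs | (x != u) && (x != v)] (wt b E) (chi A) plus.
  move=> un.
  have -> : [seq x <- vs | (x != u) && (x != v)] = [seq x <- vs | x != v].
    by apply: eq_in_filter => x xin; case: eqP xin un => // -> ->.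
  have [vin|vn] := boolP (v \in vs); first exact: GKS_freeze1.
  rewrite (eq_in_filter (a2 := predT)) ?filter_predT // => x xin.
  by case: eqP xin vn => // -> ->.
move: en; rewrite negb_and => /orP[|] /aux; first exact.
by move=> /(_ (e1 e)); rewrite (eq_filter (a2 := fun x => (x != e1 e) && (x != e2 e))) // => x; rewrite andbC.
Qed.

(** No bond of [E] reaches a frozen site, so flipping all spins of [vs] preserves the weight. *)
Lemma avg_odd vs b E f s0 : all (inside vs) E ->
  (forall s t, (forall x, x \in vs -> s x = ~~ t x) -> f s = - f t) ->
  avg vs (wt b E) f s0 = 0.
Proof.
move=> /allP Ein fodd; rewrite /avg; set N := isum _ _ _.
suff h : N = - N.
  have -> : N = 0 by lra.
  by rewrite mul0r.
pose F t := f t * wt b E t; rewrite /N -/F.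
have {1}-> : s0 = cxor (fun=> false) (cxor (fun=> false) s0).
  by apply/funext => x; rewrite /cxor; case: (s0 x).
rewrite -isum_cxor -mulN1r -isumZ; apply: isum_rel => s t st sE tE.
have nst x : x \in vs -> cxor (fun=> false) s x = ~~ t x.
  by move=> /st xE; rewrite /cxor xE; case: (t x).
rewrite mulN1r /F (fodd _ _ nst) mulNr; congr (- (_ * expR (_ * _))).
apply: eq_big_seq => e /Ein /andP[i1 i2].
by rewrite /bond !nst // !spinN mulrNN.
Qed.

Definition cut S e := (e1 e \in S) (+) (e2 e \in S).

Definition inner S e := if e1 e \in S then e1 e else e2 e.

Definition outer S e := if e1 e \in S then e2 e else e1 e.

Lemma bond_io S s e : bond s e = s`_[inner S e] * s`_[outer S e].
Proof. by rewrite /inner /outer /bond; case: ifP => //; rewrite mulrC. Qed.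

Lemma cut_inner S e : cut S e -> inner S e \in S.
Proof. by rewrite /cut /inner; case: (boolP (e1 e \in S)); case: (boolP (e2 e \in S)). Qed.

Lemma cut_outer S e : cut S e -> outer S e \notin S.
Proof. by rewrite /cut /outer; case: (boolP (e1 e \in S)); case: (boolP (e2 e \in S)). Qed.

Definition cov vs w f g s := avg vs w (fun r => f r * g r) s - avg vs w f s * avg vs w g s.

(** The covariance of a mixture is the mixture of the covariances plus $q(1-q)$ times the product of
    the increments of the two means, which [GKS_freeze] makes nonnegative. The same [q] serves all
    [B], so the inequality can be summed over bonds. *)
Lemma cov_freeze vs b e E A : 0 <= b -> uniq vs -> ~~ inside vs e ->
  exists2 q, 0 <= q <= 1 &
  (avg vs (wt b (e :: E)) (chi A) plus = (1 - q) * avg vs (wt b E) (chi A) plus +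
     q * avg (del e vs) (wt b E) (chi A) plus) /\
  forall B, (1 - q) * cov vs (wt b E) (chi A) (chi B) plus +
     q * cov (del e vs) (wt b E) (chi A) (chi B) plus <=
    cov vs (wt b (e :: E)) (chi A) (chi B) plus.
Proof.
move=> b0 uvs en.
have w0 s : 0 < wt b E s by apply: wt_gt0.
have q0 := openp_ge0 e1 e2 vs e true b0 w0.
have q1 := openp_le1 e1 e2 vs e true b0 w0.
have fz f := avg_freeze true f uvs en b0 w0.
move: (openp _ _ _ _ _ _ _) q0 q1 fz => q q0 q1 fz.
have {}fz f : avg vs (wt b (e :: E)) f plus = (1 - q) * avg vs (wt b E) f plus +
     q * avg (del e vs) (wt b E) f plus.
  by rewrite -fz; congr (avg _ _ _ _); apply/funext => s; rewrite wt_cons.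
exists q; first by rewrite q0.
split=> // C; rewrite /cov !fz.
have := GKS_freeze E A b0 uvs en; have := GKS_freeze E C b0 uvs en.
move: (avg vs _ (chi A) _) (avg (del e vs) _ (chi A) _) => a a'.
move: (avg vs _ (chi C) _) (avg (del e vs) _ (chi C) _) => c c' cc aa.
rewrite -subr_ge0; set X := avg vs _ _ _; set Y := avg (del e vs) _ _ _.
rewrite [X in 0 <= X](_ : _ = q * (1 - q) * ((a' - a) * (c' - c))); last by ring.
by rewrite !mulr_ge0 // subr_ge0.
Qed.

(* Freezing bonds one at a time from the boundary decreases the sum of
   covariances at most to its average over the final free regions [S], where it
   is the boundary sum of the hypothesis. *)
Lemma sum_cov_ge vs0 E0 b k o : 0 <= b -> uniq E0 ->
  (forall S, uniq S -> {subset S <= vs0} -> o \in S ->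
     k <= \sum_(e <- E0 | cut S e)
       avg S (wt b [seq e <- E0 | inside S e]) (fun s => s`_[o] * bond s e) plus) ->
  forall vs E, uniq vs -> uniq E -> {subset E <= E0} ->
    (forall e, e \in E0 -> inside vs e -> e \in E) -> {subset vs <= vs0} ->
  k * (1 - avg vs (wt b E) (chi [:: o]) plus) <=
  \sum_(e <- E0) cov vs (wt b E) (chi [:: o]) (chi (ends e)) plus.
Proof.
move=> b0 uE0 kS vs E uvs; move: vs E uvs.
apply: (explore_ind (e1 := e1) (e2 := e2)).
- move=> vs E E' pe IH uE' sE' iE' svs; rewrite -(wt_perm e1 e2 b pe).
  apply: IH => //; first by rewrite (perm_uniq pe).
    by move=> e eE; apply: sE'; rewrite -(perm_mem pe).
  by move=> e eE ie; rewrite (perm_mem pe); apply: iE'.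
- move=> vs E uvs aE uE sE iE svs.
  have [oin|on] := boolP (o \in vs); last first.
    have one f : avg vs (wt b E) (fun s => chi [:: o] s * f s) plus = avg vs (wt b E) f plus.
      congr (_ / _); apply: eq_isum_in => s sEq.
      by rewrite chi1 sEq // mul1r.
    have one1 : avg vs (wt b E) (chi [:: o]) plus = 1.
      have := one (fun=> 1); rewrite (eq_avg _ _ (g := chi [:: o])); last by move=> s; rewrite mulr1.
      by rewrite avg_cst // => s; apply: wt_gt0.
    rewrite one1 subrr mulr0 sumr_ge0 // => e _.
    by rewrite /cov one one1 mul1r subrr.
  (* The free region is now decoupled, so the mean at [o] vanishes and covariances are plain means.
     They are zero for bonds inside [vs] (odd integrand) and for bonds with both ends frozen; the
     cut bonds give the boundary sum. *)
  have o0 : avg vs (wt b E) (chi [:: o]) plus = 0.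
    apply: avg_odd => // s t st; by rewrite !chi1 st // spinN.
  rewrite o0 subr0 mulr1 (le_trans (kS vs uvs svs oin)) // big_mkcond /=.
  have pE : perm_eq [seq e <- E0 | inside vs e] E.
    apply: uniq_perm; rewrite ?filter_uniq // => e; rewrite mem_filter.
    apply/andP/idP => [[ie /iE]|eE]; first exact.
    by split; [move/allP: aE; apply | apply: sE].
  rewrite (wt_perm e1 e2 b pE); apply: ler_sum => e _.
  rewrite /cov o0 mul0r subr0; case: ifP => ce.
    by rewrite le_eqVlt; apply/orP; left; apply/eqP/eq_avg => s; rewrite chi1 chi_ends.
  have [ie|ne] := boolP (inside vs e).
    rewrite avg_odd // => s t st; rewrite chi1 chi1 chi_ends.
    by case/andP: ie => i1 i2; rewrite /bond !st // !spinN; ring.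
  have n1 : e1 e \notin vs.
    by move: ne ce; rewrite /inside /cut; case: (e1 e \in vs); case: (e2 e \in vs).
  have n2 : e2 e \notin vs.
    by move: ne ce; rewrite /inside /cut; case: (e1 e \in vs); case: (e2 e \in vs).
  rewrite -[leLHS]o0 le_eqVlt; apply/orP; left; apply/eqP; congr (_ / _).
  apply: eq_isum_in => s sEq.
  by rewrite chi_ends /bond !sEq // /= !mulr1.
- move=> vs e E uvs en IH1 IH2 uE sE iE svs.
  have [q /andP[q0 q1] [mE cE]] := cov_freeze E [:: o] b0 uvs en.
  have uE' : uniq E by case/andP: uE.
  have sE' : {subset E <= E0} by move=> x xE; apply: sE; rewrite in_cons xE orbT.
  have iE' e0 : e0 \in E0 -> inside vs e0 -> e0 \in E.
    move=> xE ix; have := iE e0 xE ix; rewrite in_cons => /orP[/eqP xe|//].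
    by move: en; rewrite -xe ix.
  have h1 := IH1 uE' sE' iE' svs.
  have h2 : k * (1 - avg (del e vs) (wt b E) (chi [:: o]) plus) <=
      \sum_(e0 <- E0) cov (del e vs) (wt b E) (chi [:: o]) (chi (ends e0)) plus.
    apply: IH2 => //.
      move=> e0 xE /andP[]; rewrite !mem_del => /and3P[_ _ i1] /and3P[_ _ i2].
      by apply: iE' => //; apply/andP.
    by move=> x; rewrite mem_del => /and3P[_ _ xin]; apply: svs.
  apply: (@le_trans _ _ (\sum_(e0 <- E0)
     ((1 - q) * cov vs (wt b E) (chi [:: o]) (chi (ends e0)) plus +
      q * cov (del e vs) (wt b E) (chi [:: o]) (chi (ends e0)) plus))); last first.
    by apply: ler_sum => e0 _; apply: cE.
  rewrite big_split /= -!mulr_sumr mE.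
  rewrite [leLHS](_ : _ = (1 - q) * (k * (1 - avg vs (wt b E) (chi [:: o]) plus)) +
     q * (k * (1 - avg (del e vs) (wt b E) (chi [:: o]) plus))); last by ring.
  by rewrite lerD // ler_wpM2l // subr_ge0.
Qed.

(* Lieb's improvement of Simon's inequality, by removal of a bond at [o]. *)
Lemma simon_lieb vs S b E o : 0 <= b -> (forall e, e1 e != e2 e) ->
  uniq vs -> {subset S <= vs} -> o \in S ->
  avg vs (wt b E) (chi [:: o]) plus <=
  \sum_(e <- E | cut S e) tanhb b *
    avg vs (wt b [seq e <- E | inside S e]) (chi [:: o; inner S e]) plus *
    avg vs (wt b E) (chi [:: outer S e]) plus.
Proof.
move=> b0 nl uvs Svs; have [n] := ubnP (size E); elim: n E o => // n IH E o sE oS.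
have t0 := tanhb_ge0 b0.
have [/hasP[e eE eo]|/hasPn no] := boolP (has (fun e => (o == e1 e) || (o == e2 e)) E); last first.
  have -> : avg vs (wt b E) (chi [:: o]) plus = 0.
    rewrite /avg (isum_split1 _ _ uvs (Svs _ oS)).
    set ws := [seq x <- vs | x != o]; pose F s := chi [:: o] s * wt b E s; rewrite -/F.
    have -> : isum ws F (upd plus o false) = - isum ws F (upd plus o true).
      have ow : o \notin ws by rewrite mem_filter eqxx.
      rewrite -mulN1r -isumZ; apply: isum_rel => s t st sE' tE.
      have sto x : x != o -> s x = t x.
        move=> xo; case: (boolP (x \in ws)) => [/st //|xn].
        by rewrite sE' // tE // !updN.
      rewrite /F !chi1 sE' // tE // !updE /= mul1r.
      congr (-1 * expR (_ * _)); apply: eq_big_seq => e /no.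
      by rewrite negb_or => /andP[n1 n2]; rewrite /bond !sto // eq_sym.
    by rewrite subrr mul0r.
  by apply: sumr_ge0 => e _; apply: mulr_ge0; [apply: mulr_ge0|]; first exact: t0; apply: GKS1.
set F := rem e E; have pE : perm_eq E (e :: F) by apply: perm_to_rem.
have sF : (size F < n)%N.
  by move: sE; rewrite (perm_size pE) ltnS.
rewrite (wt_perm e1 e2 b pE) (perm_big _ pE) /=.
rewrite [leRHS](eq_bigr (fun e' => tanhb b *
    avg vs (wt b [seq e <- e :: F | inside S e]) (chi [:: o; inner S e']) plus *
    avg vs (wt b (e :: F)) (chi [:: outer S e']) plus)); last first.
  move=> e' _; congr (_ * avg _ _ _ _ * _).
  by apply: wt_perm; apply: perm_filter.
pose u := if o == e1 e then e2 e else e1 e.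
have bu s : bond s e = s`_[o] * s`_[u].
  rewrite /u /bond; case: eqP eo => [->|_ /= /eqP ->] //=; exact: mulrC.
have ou : o != u.
  by rewrite /u; case: (eqVneq o (e1 e)) eo => [-> _|_ /= /eqP ->]; rewrite ?nl // eq_sym nl.
have gE G : avg vs (wt b (e :: G)) (chi [:: o]) plus =
    (avg vs (wt b G) (chi [:: o]) plus + tanhb b * avg vs (wt b G) (chi [:: u]) plus) /
    (1 + tanhb b * avg vs (wt b G) (chi [:: o; u]) plus).
  rewrite avg_cons; congr ((_ + _ * _) / (_ + _ * _)); apply: eq_avg => s.
    by rewrite bu !chi1 mulrA spin_sqr mul1r.
  by rewrite bu chi2.
have gE2 G x : avg vs (wt b (e :: G)) (chi [:: o; x]) plus =
    (avg vs (wt b G) (chi [:: o; x]) plus + tanhb b * avg vs (wt b G) (chi [:: u; x]) plus) /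
    (1 + tanhb b * avg vs (wt b G) (chi [:: o; u]) plus).
  rewrite avg_cons; congr ((_ + _ * _) / (_ + _ * _)); apply: eq_avg => s.
    by rewrite bu !chi2 mulrACA spin_sqr mul1r mulrC.
  by rewrite bu chi2.
have D1 G : 1 <= 1 + tanhb b * avg vs (wt b G) (chi [:: o; u]) plus.
  by rewrite lerDl mulr_ge0 // GKS1.
have D0 G : 0 < 1 + tanhb b * avg vs (wt b G) (chi [:: o; u]) plus.
  exact: lt_le_trans (D1 G).
have IHo := IH F o sF oS.
set G := [seq e <- F | inside S e] in IHo *.
(* If [u] is in [S], the bond belongs both to the region and to the volume: the induction hypotheses
   at [o] and [u] combine, and the denominators compare because the region has fewer bonds. *)
have [uS|uS] := boolP (u \in S).
  have insS : inside S e.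
    move: oS uS; rewrite /inside /u; case: eqP eo => [<- _ -> ->|_ /= /eqP <- -> ->] //.
  have ncut : cut S e = false.
    by move: insS; rewrite /cut => /andP[-> ->].
  have IHu := IH F u sF uS; rewrite -/G in IHu.
  rewrite big_cons ncut [[seq _ <- _ :: _ | _]]/= insS -/G gE.
  have GF : 1 + tanhb b * avg vs (wt b G) (chi [:: o; u]) plus <=
            1 + tanhb b * avg vs (wt b F) (chi [:: o; u]) plus.
    by rewrite lerD2l ler_wpM2l // GKS_filter.
  rewrite ler_pdivrMr //.
  apply: (le_trans (lerD IHo (ler_wpM2l t0 IHu))).
  rewrite mulr_sumr -big_split /= mulr_suml; apply: ler_sum => e' ce.
  have h0 := GKS1 e1 e2 vs F [:: outer S e'] b0.
  have h1 := GKS_cons e1 e2 vs e F [:: outer S e'] b0.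
  have k0 := GKS1 e1 e2 vs G [:: o; inner S e'] b0.
  have k1 := GKS1 e1 e2 vs G [:: u; inner S e'] b0.
  rewrite gE2; move: h0 h1 k0 k1 GF (D0 G); rewrite -/G.
  move: (avg vs _ (chi [:: outer S e']) plus) (avg vs _ (chi [:: outer S e']) plus).
  move: (avg vs _ (chi [:: o; inner S e']) plus) (avg vs _ (chi [:: u; inner S e']) plus).
  set dG := 1 + tanhb b * avg vs (wt b G) _ _; set dF := 1 + tanhb b * avg vs (wt b F) _ _.
  move: dG dF (tanhb b) t0 => dG dF t t0 a a' c' c h0 h1 k0 k1 GF dG0.
  rewrite [leLHS](_ : _ = t * (a + t * a') * c); last by ring.
  rewrite [leRHS](_ : _ = (t * (a + t * a')) * (c' * (dF / dG))); last by ring.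
  have n0 : 0 <= t * (a + t * a') by rewrite mulr_ge0 // addr_ge0 // mulr_ge0.
  apply: ler_wpM2l => //; apply: (le_trans h1).
  by rewrite ler_peMr ?(le_trans h0 h1) // ler_pdivlMr // mul1r.
(* Here the removed bond is itself a cut bond with inner end [o]; its own term pays for the
   contribution of [u], and the denominator, at least 1, is dropped. *)
have cE : cut S e.
  rewrite /cut; move: oS uS; rewrite /u; case: eqP eo => [<- _ -> /negbTE -> |_ /= /eqP <- -> /negbTE ->] //.
have nin : inside S e = false.
  by move: cE; rewrite /cut /inside; case: (e1 e \in S); case: (e2 e \in S).
have iE : inner S e = o.
  move: oS uS; rewrite /inner /u; case: eqP eo => [<- _ ->|_ /= /eqP <- _ /negbTE ->] //.
have oE : outer S e = u.
  move: oS uS; rewrite /outer /u; case: eqP eo => [<- _ ->|_ /= /eqP <- _ /negbTE ->] //.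
rewrite big_cons cE [[seq _ <- _ :: _ | _]]/= nin -/G iE oE gE.
have -> : avg vs (wt b G) (chi [:: o; o]) plus = 1.
  rewrite (eq_avg _ _ (g := fun=> 1)) ?avg_cst // => s; first exact: wt_gt0.
  by rewrite chi2 spin_sqr.
have n0 : 0 <= avg vs (wt b F) (chi [:: o]) plus + tanhb b * avg vs (wt b F) (chi [:: u]) plus.
  by apply: addr_ge0; [|apply: mulr_ge0]; first [exact: t0|exact: GKS1].
apply: (@le_trans _ _ (avg vs (wt b F) (chi [:: o]) plus + tanhb b * avg vs (wt b F) (chi [:: u]) plus)).
  by rewrite ler_pdivrMr // ler_peMr.
rewrite mulr1 [leRHS]addrC; apply: lerD; last by rewrite ler_wpM2l // GKS_cons.
apply: (le_trans IHo); apply: ler_sum => e' ce; apply: ler_wpM2l.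
  by apply: mulr_ge0; first [exact: t0|exact: GKS1].
exact: GKS_cons.
Qed.

End Ising_sharpness.

(** * A differential inequality *)

Section Growth.
Variable R : realType.
Implicit Types (f df : R -> R).

Lemma nondecr_derive f df (a b : R) : a <= b -> (forall x : R, is_derive x 1 f (df x)) ->
  (forall x, a <= x <= b -> 0 <= df x) -> f a <= f b.
Proof.
move=> ab fd df0; have [|c cin E] := MVT_segment ab (fun x _ => fd x).
  apply: continuous_subspaceT => x.
  by apply/differentiable_continuous/derivable1_diffP; have [] := fd x.
by rewrite -subr_ge0 E mulr_ge0 ?subr_ge0 // df0.
Qed.

(** The function $(f-1)e^x$ is nondecreasing on the interval and at least $-e^a$ at its left end. *)
Lemma saturation_derive f df (a b : R) : a <= b -> (forall x : R, is_derive x 1 f (df x)) ->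
  (forall x, a <= x <= b -> 1 - f x <= df x) -> 0 <= f a ->
  1 - expR (a - b) <= f b.
Proof.
move=> ab fd dfge fa0.
pose g x := (f x - 1) * expR x.
pose dg x := (f x - 1) *: expR x + expR x *: (df x - 0).
have gd (x : R) : is_derive x 1 g (dg x).
  have ? := fd x.
  have -> : g = (f - cst 1) * expR by apply/funext.
  exact: is_deriveM.
have := nondecr_derive ab gd.
have dg0 x : a <= x <= b -> 0 <= dg x.
  move=> /dfge h; rewrite /dg /GRing.scale /= subr0 mulrC -mulrDr mulr_ge0 ?expR_ge0 //; lra.
move=> /(_ dg0); rewrite /g.
rewrite expRD expRN => h.
have eb := expR_gt0 b; have ea := expR_gt0 a.
suff : - (expR a / expR b) <= f b - 1 by lra.
rewrite -mulNr ler_pdivrMr //; apply: le_trans h.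
by rewrite mulrBl mul1r lerBrDl subrr mulr_ge0 // ltW.
Qed.

End Growth.

(** * Differentiation in the inverse temperature *)

Section Derivative.
Variables (T Ed : eqType) (R : realType) (e1 e2 : Ed -> T).
Implicit Types (s t : conf T) (vs : seq T) (f g : conf T -> R) (E : seq Ed).
Notation wt := (wt e1 e2).
Notation en := (en R e1 e2).

Lemma is_derive_isum vs E g a (b : R) :
  is_derive b 1 (fun b => isum vs (fun s => g s * wt b E s) a)
    (isum vs (fun s => g s * en E s * wt b E s) a).
Proof.
elim: vs a => [|v vs IH] a /=; last exact: is_deriveD.
rewrite /wt.
have h : is_derive b 1 (expR \o ( *%R^~ (en E a))) (expR (b * en E a) * en E a).
  have hd : is_derive b 1 ( *%R^~ (en E a)) (en E a).
    have -> : *%R^~ (en E a) = en E a \*: id :> (R -> R).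
      by apply/funext => x; rewrite /GRing.scale /= mulrC.
    apply: is_derive_eq; by rewrite /GRing.scale /= mulr1.
  exact: is_derive1_comp.
have -> : (fun b => g a * expR (b * en E a)) = g a \*: (expR \o ( *%R^~ (en E a))).
  by apply/funext.
apply: is_derive_eq; rewrite /GRing.scale /=; ring.
Qed.

Lemma is_derive_avg vs E f a (b : R) :
  is_derive b 1 (fun b => avg vs (wt b E) f a)
    (\sum_(e <- E) cov vs (wt b E) f (bond R e1 e2 ^~ e) a).
Proof.
have Z0 (x : R) : isum vs (wt x E) a != 0 by rewrite gt_eqF // isum_gt0 // => s; apply: wt_gt0.
have h1 := is_derive_isum vs E f a b.
have h2 := is_derive_isum vs E (fun=> 1) a b.
have h2' : is_derive b 1 (fun b => isum vs (wt b E) a) (isum vs (fun s => en E s * wt b E s) a).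
  rewrite (_ : isum vs (fun s => en E s * wt b E s) a =
    isum vs (fun s => 1 * en E s * wt b E s) a); last by apply: eq_isum => s; rewrite mul1r.
  rewrite (_ : (fun b => isum vs (wt b E) a) = fun b => isum vs (fun s => 1 * wt b E s) a) //.
  by apply/funext => x; apply: eq_isum => s; rewrite mul1r.
have h3 := is_deriveV (Z0 b) h2'.
have := is_deriveM h1 h3.
rewrite /GRing.scale /= => h.
apply: (is_derive_eq h).
have Zb := Z0 b; rewrite /cov sumrB -mulr_sumr -!avg_sum /avg.
rewrite (_ : isum vs (fun t => (\sum_(i <- E) f t * bond R e1 e2 t i) * wt b E t) a =
  isum vs (fun s => f s * en E s * wt b E s) a); last first.
  by apply: eq_isum => s; rewrite -mulr_sumr.
rewrite (_ : isum vs (fun t => (\sum_(i <- E) bond R e1 e2 t i) * wt b E t) a =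
  isum vs (fun s => en E s * wt b E s) a) //.
by field.
Qed.

End Derivative.

(** * Growth of the magnetization while the criterion fails *)

Section Ising_saturation.
Variables (T Ed : eqType) (R : realType) (e1 e2 : Ed -> T).
Implicit Types (vs S : seq T) (E : seq Ed) (b : R).
Notation wt := (wt e1 e2).
Notation chi := (chi R).
Notation plus := (@plus T).
Notation inside := (inside e1 e2).
Notation cut := (cut e1 e2).

Lemma ising_mono vs E A (a b : R) : 0 <= a -> a <= b ->
  avg vs (wt a E) (chi A) plus <= avg vs (wt b E) (chi A) plus.
Proof.
move=> a0 ab.
apply: (nondecr_derive ab (fun x => is_derive_avg e1 e2 vs E (chi A) plus x)) => x /andP[ax _].
apply: sumr_ge0 => e _; rewrite /cov subr_ge0.
by have := GKS2 e1 e2 vs E A (ends e1 e2 e) (le_trans a0 ax); rewrite chi_ends.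
Qed.

Lemma ising_saturation vs E o (a b : R) : 0 <= a -> a <= b -> uniq vs -> uniq E ->
  (forall x S, a <= x <= b -> uniq S -> {subset S <= vs} -> o \in S ->
     1 <= \sum_(e <- E | cut S e)
       avg S (wt x [seq e <- E | inside S e]) (fun s => spin R (s o) * bond R e1 e2 s e) plus) ->
  1 - expR (a - b) <= avg vs (wt b E) (chi [:: o]) plus.
Proof.
move=> a0 ab uvs uE H.
apply: (saturation_derive ab (fun x => is_derive_avg e1 e2 vs E (chi [:: o]) plus x)); last exact: GKS1.
move=> x xab; have x0 : 0 <= x by rewrite (le_trans a0) //; case/andP: xab.
have := @sum_cov_ge T Ed R e1 e2 vs E x 1 o x0 uE (fun S => H x S xab) vs E uvs uE.
rewrite mul1r => h; apply: (le_trans (h _ _ _)) => //.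
by rewrite le_eqVlt; apply/orP; left; apply/eqP; apply: eq_bigr => e _; rewrite chi_ends.
Qed.

End Ising_saturation.

(** * Sharpness for bond percolation *)

Section Percolation.
Variables (T Ed : eqType) (R : realType) (e1 e2 : Ed -> T).
Implicit Types (C : pred T) (l E : seq Ed) (e : Ed) (x y o : T) (p : R) (vs S : seq T).
Implicit Types (f g : seq Ed -> R).
Notation inside := (inside e1 e2).
Notation del := (del e1 e2).
Notation cut := (cut e1 e2).
Notation inner := (inner e1 e2).

(** Connection to a target set [C] by the bonds of [l]. A set rather than a single site is used as
    target because opening a bond at a target site just enlarges it ([conn_freeze]). *)
Inductive conn C l : T -> Prop :=
| conn_in x : C x -> conn C l x
| conn_fwd e : e \in l -> conn C l (e2 e) -> conn C l (e1 e)
| conn_bwd e : e \in l -> conn C l (e1 e) -> conn C l (e2 e).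

Lemma conn_sub C C' l l' x : subpred C C' -> {subset l <= l'} -> conn C l x -> conn C' l' x.
Proof.
move=> CC ll; elim=> [y /CC|e /ll el _|e /ll el _]; first exact: conn_in.
  exact: conn_fwd.
exact: conn_bwd.
Qed.

Lemma conn_freeze C l e x : C (e1 e) || C (e2 e) ->
  conn C (e :: l) x <-> conn (fun y => C y || (y \in ends e1 e2 e)) l x.
Proof.
move=> Ce; split.
  elim=> {x} [x Cx|e' el _ IH|e' el _ IH].
  - by apply: conn_in; rewrite /= Cx.
  - move: el; rewrite in_cons => /orP[/eqP ->|el]; last exact: conn_fwd.
    by apply: conn_in; rewrite /= mem_head orbT.
  - move: el; rewrite in_cons => /orP[/eqP ->|el]; last exact: conn_bwd.
    by apply: conn_in; rewrite /= !in_cons eqxx !orbT.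
elim=> {x} [x|e' el _ IH|e' el _ IH].
- rewrite /= !in_cons in_nil orbF => /orP[Cx|/orP[/eqP ->|/eqP ->]]; first exact: conn_in.
    case/orP: Ce => Ce; first exact: conn_in.
    by apply: conn_fwd; [rewrite mem_head|exact: conn_in].
  case/orP: Ce => Ce; last exact: conn_in.
  by apply: conn_bwd; [rewrite mem_head|exact: conn_in].
- by apply: conn_fwd => //; rewrite in_cons el orbT.
- by apply: conn_bwd => //; rewrite in_cons el orbT.
Qed.

Lemma conn_predU C C' l x : conn (fun y => C y || C' y) l x -> conn C l x \/ conn C' l x.
Proof.
elim=> {x} [x /orP[Cx|Cx]|e el _ [h|h]|e el _ [h|h]];
  by [left; apply: conn_in|right; apply: conn_in|left; apply: conn_fwd|
      right; apply: conn_fwd|left; apply: conn_bwd|right; apply: conn_bwd].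
Qed.

Lemma conn_inside S C l x : all (inside S) l -> conn C l x -> x \in S ->
  exists2 y, y \in S & C y.
Proof.
move=> /allP lS; elim=> {x} [x Cx xS|e /lS/andP[h1 h2] _ IH _|e /lS/andP[h1 h2] _ IH _].
- by exists x.
- exact: IH.
- exact: IH.
Qed.

Definition connR C o l : R := `[< conn C l o >]%:R.

(** Inclusion is that of the underlying sets, so such a function also ignores order and repetitions
    in the list ([eq_incr]). *)
Definition incr f := forall l l', {subset l <= l'} -> f l <= f l'.

Lemma incr_connR C o : incr (connR C o).
Proof.
move=> l l' ll; rewrite /connR; case: asboolP => [h|_]; last by case: asboolP.
by rewrite asboolT //; apply: conn_sub h.
Qed.

Lemma connR_ge0 C o l : 0 <= connR C o l.
Proof. exact: ler0n. Qed.

Lemma le_connR C C' o l l' : (conn C l o -> conn C' l' o) -> connR C o l <= connR C' o l'.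
Proof. by move=> h; rewrite /connR; case: asboolP => [/h hc|_]; [rewrite asboolT|rewrite ler0n]. Qed.

Lemma eq_incr f l l' : incr f -> l =i l' -> f l = f l'.
Proof.
by move=> fi ll; apply/eqP; rewrite eq_le !fi // => e; rewrite ll.
Qed.

(* The mean of [f] over the bonds that are open when those of [l] are and those
   of [E] are so independently with probability [p]. *)
Fixpoint perc p E f l : R :=
  if E is e :: E' then (1 - p) * perc p E' f l + p * perc p E' f (e :: l) else f l.

Lemma eq_perc_in p E f g l : (forall l', {subset l' <= E ++ l} -> f l' = g l') ->
  perc p E f l = perc p E g l.
Proof.
elim: E l => [|e E IH] l fg /=; first by apply: fg.
congr (_ * _ + _ * _); apply: IH => l' h; apply: fg => x /h; rewrite !(mem_cat, in_cons);
  by case: (x \in E); case: (x == e); case: (x \in l) => //=.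
Qed.

Lemma eq_perc p E f g l : f =1 g -> perc p E f l = perc p E g l.
Proof. by move=> fg; apply: eq_perc_in. Qed.

Lemma le_perc_in p E f g l : 0 <= p <= 1 ->
  (forall l', {subset l' <= E ++ l} -> f l' <= g l') ->
  perc p E f l <= perc p E g l.
Proof.
move=> /andP[p0 p1]; elim: E l => [|e E IH] l fg /=; first by apply: fg.
have q0 : 0 <= 1 - p by rewrite subr_ge0.
rewrite lerD // ler_wpM2l // IH // => l' h; apply: fg => x /h; rewrite !(mem_cat, in_cons);
  by case: (x \in E); case: (x == e); case: (x \in l) => //=.
Qed.

Lemma percB p E f g l : perc p E (fun l => f l - g l) l = perc p E f l - perc p E g l.
Proof. elim: E l => //= e E IH l; rewrite !IH; ring. Qed.

Lemma percD p E f g l : perc p E (fun l => f l + g l) l = perc p E f l + perc p E g l.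
Proof. elim: E l => //= e E IH l; rewrite !IH; ring. Qed.

Lemma perc_cst p E c l : perc p E (fun=> c) l = c.
Proof. elim: E l => //= e E IH l; rewrite !IH; ring. Qed.

Lemma perc_ge0 p E f l : 0 <= p <= 1 -> (forall l, 0 <= f l) -> 0 <= perc p E f l.
Proof.
move=> /andP[p0 p1] f0; elim: E l => //= e E IH l.
by rewrite addr_ge0 // mulr_ge0 // subr_ge0.
Qed.

Lemma perc_sum I (r : seq I) (F : I -> seq Ed -> R) p E l :
  perc p E (fun l => \sum_(i <- r) F i l) l = \sum_(i <- r) perc p E (F i) l.
Proof.
elim: r => [|i r IH].
  by rewrite big_nil -[RHS](perc_cst p E 0 l); apply: eq_perc => l'; rewrite big_nil.
by rewrite big_cons -IH -percD; apply: eq_perc => l'; rewrite big_cons.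
Qed.

Lemma perc_incr p E f : 0 <= p <= 1 -> incr f -> incr (perc p E f).
Proof.
move=> /andP[p0 p1] fi; elim: E => //= e E IH l l' ll.
rewrite lerD // ler_wpM2l ?subr_ge0 //; apply: IH => // x.
by rewrite !in_cons => /orP[->//|/ll ->]; rewrite orbT.
Qed.

Lemma perc_acc p E f e l : 0 <= p <= 1 -> incr f ->
  perc p E f (e :: l) = perc p E (fun l => f (e :: l)) l.
Proof.
move=> p01 fi; elim: E l => //= e' E IH l; rewrite -!IH; congr (_ + _ * _).
apply: (eq_incr (perc_incr _ p01 fi)) => x; rewrite !in_cons.
by rewrite orbCA.
Qed.

Lemma perc_rem p E f e l : 0 <= p <= 1 -> incr f -> e \in E ->
  perc p E f l = perc p (e :: rem e E) f l.
Proof.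
move=> p01 fi; elim: E l => // e' E IH l; rewrite in_cons /=.
have [->|ne] := eqVneq e' e; first by [].
move=> /= eE; rewrite !IH //=.
rewrite [perc p _ f (e :: e' :: l)](eq_incr (perc_incr _ p01 fi) (l' := e' :: e :: l)).
  ring.
by move=> x; rewrite !in_cons orbCA.
Qed.

Lemma perc_perm p E E' f l : 0 <= p <= 1 -> incr f -> perm_eq E E' ->
  perc p E f l = perc p E' f l.
Proof.
move=> p01 fi; elim: E E' l => [|e E IH] E' l pe.
  by move: pe; rewrite perm_sym => /perm_nilP ->.
have eE : e \in E' by rewrite -(perm_mem pe) mem_head.
have pe' : perm_eq E (rem e E').
  by rewrite -(perm_cons e) (perm_trans pe) // perm_to_rem.
by rewrite (perc_rem _ p01 fi eE) /= !(IH (rem e E')).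
Qed.

Definition tgt vs : pred T := fun x => x \notin vs.

Lemma conn_del vs e l o : ~~ inside vs e ->
  conn (tgt vs) (e :: l) o <-> conn (tgt (del e vs)) l o.
Proof.
rewrite negb_and => en; rewrite (conn_freeze _ _ en).
have E x : (tgt vs x || (x \in ends e1 e2 e)) = tgt (del e vs) x.
  by rewrite /= /tgt mem_del !in_cons in_nil; do 2 case: (x == _); case: (x \in vs).
by split; apply: conn_sub => // x; rewrite E.
Qed.

Lemma connR_del vs e l o : ~~ inside vs e ->
  connR (tgt vs) o (e :: l) = connR (tgt (del e vs)) o l.
Proof.
move=> en; apply/eqP; rewrite eq_le; apply/andP.
by split; apply: le_connR => /(conn_del _ _ en).
Qed.

(** Percolation twin of [sum_cov_ge]; here the increments pass to the mixture exactly, by linearity.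
    In a final free region [S] nothing is connected to the target, and opening a cut bond connects
    exactly what its inner end reaches inside [S]. *)
Lemma sum_pivotal_ge vs0 E0 p k o : 0 <= p <= 1 -> uniq E0 ->
  (forall S, uniq S -> {subset S <= vs0} -> o \in S ->
     k <= \sum_(e <- E0 | cut S e)
       perc p [seq e <- E0 | inside S e] (connR (pred1 (inner S e)) o) [::]) ->
  forall vs E, uniq vs -> uniq E -> {subset E <= E0} ->
    (forall e, e \in E0 -> inside vs e -> e \in E) -> {subset vs <= vs0} ->
  k * (1 - perc p E (connR (tgt vs) o) [::]) <=
  \sum_(e <- E0) perc p E (fun l => connR (tgt vs) o (e :: l) - connR (tgt vs) o l) [::].
Proof.
move=> p01 uE0 kS vs E uvs; move: vs E uvs.
have piv0 vs l e : 0 <= connR (tgt vs) o (e :: l) - connR (tgt vs) o l.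
  by rewrite subr_ge0; apply: incr_connR => x xl; rewrite in_cons xl orbT.
have iD vs e : incr (fun l => connR (tgt vs) o (e :: l)).
  move=> l l' ll; apply: incr_connR => x; rewrite !in_cons => /orP[->//|/ll ->].
  by rewrite orbT.
apply: (explore_ind (e1 := e1) (e2 := e2)).
- move=> vs E E' pe IH uE' sE' iE' svs.
  rewrite -(perc_perm _ p01 _ pe); last exact: incr_connR.
  rewrite (eq_bigr (fun e => perc p E (fun l => connR (tgt vs) o (e :: l) - connR (tgt vs) o l) [::])).
    apply: IH => //; first by rewrite (perm_uniq pe).
      by move=> e eE; apply: sE'; rewrite -(perm_mem pe).
    by move=> e eE ie; rewrite (perm_mem pe); apply: iE'.
  move=> e _; rewrite !percB; congr (_ - _); apply/esym/perc_perm => //.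
  exact: incr_connR.
- move=> vs E uvs aE uE sE iE svs.
  have p0 : forall F f l, (forall l', 0 <= f l') -> 0 <= perc p F f l.
    by move=> F f l h; apply: perc_ge0.
  have [oin|on] := boolP (o \in vs); last first.
    rewrite (eq_perc_in _ (g := fun=> 1)); last first.
      by move=> l' _; rewrite /connR asboolT //; apply: conn_in.
    by rewrite perc_cst subrr mulr0 sumr_ge0 // => e _; apply: p0.
  have nc l : {subset l <= E} -> connR (tgt vs) o l = 0.
    move=> lE; rewrite /connR asboolF // => /conn_inside -/(_ vs).
    case=> //; first by apply/allP => e /lE; move/allP: aE; apply.
    by move=> y yv; rewrite /tgt yv.
  rewrite (eq_perc_in _ (g := fun=> 0)); last by move=> l'; rewrite cats0; apply: nc.
  rewrite perc_cst subr0 mulr1 (le_trans (kS vs uvs svs oin)) // big_mkcond /=.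
  have pE : perm_eq [seq e <- E0 | inside vs e] E.
    apply: uniq_perm; rewrite ?filter_uniq // => e; rewrite mem_filter.
    apply/andP/idP => [[ie /iE]|eE]; first exact.
    by split; [move/allP: aE; apply | apply: sE].
  apply: ler_sum => e _; case: ifP => ce; last exact: p0.
  rewrite (perc_perm _ p01 _ pE); last exact: incr_connR.
  apply: le_perc_in => // l'; rewrite cats0 => lE; rewrite (nc l' lE) subr0.
  have en : ~~ inside vs e by move: ce; rewrite /cut /inside; case: (_ \in _); case: (_ \in _).
  rewrite connR_del //; apply: le_connR; apply: conn_sub => // x /eqP ->.
  by rewrite /tgt mem_del /inner; case: ifP; rewrite eqxx ?andbF.
- move=> vs e E uvs en IH1 IH2 uE sE iE svs.
  have uE' : uniq E by case/andP: uE.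
  have sE' : {subset E <= E0} by move=> x xE; apply: sE; rewrite in_cons xE orbT.
  have iE' e0 : e0 \in E0 -> inside vs e0 -> e0 \in E.
    move=> xE ix; have := iE e0 xE ix; rewrite in_cons => /orP[/eqP xe|//].
    by move: en; rewrite -xe ix.
  have h1 := IH1 uE' sE' iE' svs.
  have h2 : k * (1 - perc p E (connR (tgt (del e vs)) o) [::]) <=
      \sum_(e0 <- E0) perc p E (fun l => connR (tgt (del e vs)) o (e0 :: l) - connR (tgt (del e vs)) o l) [::].
    apply: IH2 => //.
      move=> e0 xE /andP[]; rewrite !mem_del => /and3P[_ _ i1] /and3P[_ _ i2].
      by apply: iE' => //; apply/andP.
    by move=> x; rewrite mem_del => /and3P[_ _ xin]; apply: svs.
  have [p0 p1] := andP p01.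
  rewrite /= (perc_acc _ _ _ p01); last exact: incr_connR.
  rewrite (eq_perc _ _ (f := fun l => connR (tgt vs) o (e :: l)) (g := connR (tgt (del e vs)) o)); last by move=> l; rewrite connR_del.
  rewrite (eq_bigr (fun e0 =>
     (1 - p) * perc p E (fun l => connR (tgt vs) o (e0 :: l) - connR (tgt vs) o l) [::] +
     p * perc p E (fun l => connR (tgt (del e vs)) o (e0 :: l) - connR (tgt (del e vs)) o l) [::])); last first.
    move=> e0 _; congr (_ + _ * _); rewrite !percB.
    rewrite !(perc_acc _ _ _ p01) //; last exact: incr_connR.
    congr (_ - _); apply: eq_perc => l; rewrite -connR_del //.
    by apply: (eq_incr (@incr_connR _ _)) => x; rewrite !in_cons orbCA.
  rewrite big_split /= -!mulr_sumr.
  rewrite [leLHS](_ : _ = (1 - p) * (k * (1 - perc p E (connR (tgt vs) o) [::])) +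
     p * (k * (1 - perc p E (connR (tgt (del e vs)) o) [::]))); last by ring.
  by rewrite lerD // ler_wpM2l // subr_ge0.
Qed.

Fixpoint dperc p E f l : R :=
  if E is e :: E' then perc p E' f (e :: l) - perc p E' f l +
    ((1 - p) * dperc p E' f l + p * dperc p E' f (e :: l))
  else 0.

Lemma is_derive_perc E f l p : is_derive p 1 (fun p => perc p E f l) (dperc p E f l).
Proof.
elim: E l => [|e E IH] l /=; first exact: is_derive_cst.
have h1 := IH l; have h2 := IH (e :: l).
have -> : (fun p => (1 - p) * perc p E f l + p * perc p E f (e :: l)) =
  (cst 1 - id) * (fun p => perc p E f l) + id * (fun p => perc p E f (e :: l)) by apply/funext.
apply: is_derive_eq; rewrite /GRing.scale /= ?fctE /=.
by rewrite sub0r mulrN mulr1 mulr1 addrACA addrC [perc _ _ _ (e :: l) + _]addrC -addrA; congr (_ + _); rewrite addrC.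
Qed.

(** Russo's formula: the derivative sums the full influence of each bond, whereas the left side
    counts it only when the bond is closed, hence with an extra factor $1-p$. *)
Lemma sum_pivotal_le_dperc p E f l : 0 <= p <= 1 -> incr f ->
  \sum_(e <- E) perc p E (fun l => f (e :: l) - f l) l <= dperc p E f l.
Proof.
move=> p01 fi; have [p0 p1] := andP p01.
have ic e : incr (fun l => f (e :: l)).
  by move=> r r' rr; apply: fi => x; rewrite !in_cons => /orP[->//|/rr ->]; rewrite orbT.
elim: E l => [|e E IH] l; first by rewrite big_nil.
rewrite big_cons; apply: lerD.
  rewrite percB /= (perc_acc _ _ _ p01 fi) !(perc_acc _ _ _ p01 (ic e)).
  rewrite (eq_perc _ _ (f := fun l => f (e :: e :: l)) (g := fun l => f (e :: l))).
    have AF : 0 <= perc p E (fun l => f (e :: l)) l - perc p E f l.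
      by rewrite subr_ge0 le_perc_in // => r _; apply: fi => x xr; rewrite in_cons xr orbT.
    rewrite [leLHS](_ : _ = (1 - p) * (perc p E (fun l => f (e :: l)) l - perc p E f l)); last by ring.
    by rewrite ler_piMl // gerBl.
  by move=> r; apply: (eq_incr fi) => x; rewrite !in_cons orbA orbb.
rewrite /= big_split /= -!mulr_sumr lerD // ler_wpM2l ?subr_ge0 //.
Qed.

Lemma perc_saturation vs E o (a b : R) : 0 <= a -> a <= b -> b <= 1 -> uniq vs -> uniq E ->
  (forall (q : R) S, a <= q <= b -> uniq S -> {subset S <= vs} -> o \in S ->
     1 <= \sum_(e <- E | cut S e)
       perc q [seq e <- E | inside S e] (connR (pred1 (inner S e)) o) [::]) ->
  1 - expR (a - b) <= perc b E (connR (tgt vs) o) [::].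
Proof.
move=> a0 ab b1 uvs uE H.
apply: (saturation_derive ab (fun q => is_derive_perc E (connR (tgt vs) o) [::] q)); last first.
  by apply: perc_ge0 => [|l]; [rewrite a0 (le_trans ab)|exact: connR_ge0].
move=> x xab; have x01 : 0 <= x <= 1.
  by case/andP: xab => ax xb; rewrite (le_trans a0) // (le_trans xb).
apply: le_trans (sum_pivotal_le_dperc _ _ x01 (@incr_connR _ _)).
have := sum_pivotal_ge x01 uE (fun S => H x S xab) uvs uE.
by rewrite mul1r; apply.
Qed.

End Percolation.

(** * Influence of the boundary is dominated by percolation *)

Section Influence.
Variables (T Ed : eqType) (R : realType) (e1 e2 : Ed -> T).
Implicit Types (s t : conf T) (vs A : seq T) (f w : conf T -> R) (u v x o : T).
Implicit Types (e : Ed) (E : seq Ed) (b p K M : R) (k : T -> R) (n : nat) (c : bool).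
Notation "s `_[ x ]" := (spin R (s x)) (at level 2, format "s `_[ x ]").
Notation wt := (wt e1 e2).
Notation bond := (bond R e1 e2).
Notation inside := (inside e1 e2).
Notation del := (del e1 e2).
Notation connR := (connR R e1 e2).

Definition fw k A s : R := expR (\sum_(x <- A) k x * s`_[x]).

Lemma lat_fw k A : lat (fw k A).
Proof. by apply: lat_exp_sum => x; apply: lat_field. Qed.

(** Finite energy: an update at [v] changes at most one term of the exponent, by at most $2K$. *)
Lemma fw_flip k A K s v c c' : uniq A -> 0 <= K -> (forall x, x \in A -> `|k x| <= K) ->
  fw k A (upd s v c) <= expR (2 * K) * fw k A (upd s v c').
Proof.
move=> uA K0 kK; rewrite /fw -expRD ler_expR -lerBlDr -sumrB.
apply: (@le_trans _ _ (\sum_(x <- A) (x == v)%:R * (2 * K))).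
  rewrite big_seq [leRHS]big_seq; apply: ler_sum => x /kK; rewrite ler_norml => /andP[h1 h2].
  rewrite /upd; case: eqP => _; last by rewrite subrr mul0r.
  by rewrite mul1r; case: c; case: c' => /=; lra.
rewrite -mulr_suml -natr_sum.
have [vA|vA] := boolP (v \in A).
  by rewrite (bigD1_seq v) //= eqxx big1 ?addn0 ?mul1r // => x /negbTE ->.
rewrite big_seq big1 ?mul0r; last by move=> x xA; case: eqP xA vA => // -> ->.
by rewrite mulr_ge0.
Qed.

Definition touch v e := (v == e1 e) || (v == e2 e).

Lemma wt_flip b E n s v c c' : 0 <= b -> (count (touch v) E <= n)%N ->
  wt b E (upd s v c) <= expR (2 * b * n%:R) * wt b E (upd s v c').
Proof.
move=> b0 cn; rewrite -expRD ler_expR -lerBlDr -mulrBr (mulrC 2) -mulrA ler_wpM2l //.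
apply: (@le_trans _ _ (2 * (count (touch v) E)%:R)); last by rewrite ler_pM2l // ler_nat.
rewrite /en -sumrB -sum1_count natr_sum mulr_sumr big_mkcond [leRHS]big_mkcond /=.
apply: ler_sum => e _; case: ifP => [_|].
  by case: (bondPN R e1 e2 (upd s v c) e) => ->; case: (bondPN R e1 e2 (upd s v c') e) => ->; lra.
by rewrite /touch /bond /upd eq_sym [v == e2 e]eq_sym => /negbT; rewrite negb_or => /andP[/negbTE -> /negbTE ->]; rewrite subrr.
Qed.

Lemma upd_cst (c : bool) v : upd (fun=> c) v c = (fun=> c) :> conf T.
Proof. by apply/funext => x; rewrite /upd; case: ifP. Qed.

Lemma avg_split1 vs w f u s : uniq vs -> u \in vs -> (forall s, 0 < w s) ->
  let ws := [seq x <- vs | x != u] in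
  exists2 q, 0 <= q <= 1 &
  avg vs w f s = (1 - q) * avg ws w f (upd s u false) + q * avg ws w f (upd s u true).
Proof.
move=> uvs uin w0 ws.
have Z0 r : 0 < isum ws w r by apply: isum_gt0.
exists (isum ws w (upd s u true) / isum vs w s).
  rewrite (isum_split1 _ _ uvs uin) -/ws.
  have := Z0 (upd s u true); have := Z0 (upd s u false).
  move: (isum _ _ _) (isum _ _ _) => x y x0 y0.
  apply/andP; split; first by apply: divr_ge0; lra.
  by rewrite ler_pdivrMr ?addr_gt0 // mul1r; lra.
rewrite /avg !(isum_split1 _ _ uvs uin) -/ws.
have := Z0 (upd s u true); have := Z0 (upd s u false).
set x := isum ws w _; set y := isum ws w _.
move: (isum _ _ _) (isum _ _ _) x y => a a' x y x0 y0.
by field; rewrite !gt_eqF // addr_gt0.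
Qed.

(** With the site free, the mean is a mixture over its two values, and by stochastic monotonicity
    the value [c] gives the extreme one. *)
Lemma freeze_mono vs w f e c : uniq vs -> ~~ inside vs e -> lat w -> mono f ->
  if c then avg vs w f (fun=> c) <= avg (del e vs) w f (fun=> c)
  else avg (del e vs) w f (fun=> c) <= avg vs w f (fun=> c).
Proof.
move=> uvs en wl fm.
have aux u v : u \notin vs ->
    if c then avg vs w f (fun=> c) <=
              avg [seq x <- vs | (x != u) && (x != v)] w f (fun=> c)
    else avg [seq x <- vs | (x != u) && (x != v)] w f (fun=> c) <= avg vs w f (fun=> c).
  move=> un.
  have -> : [seq x <- vs | (x != u) && (x != v)] = [seq x <- vs | x != v].
    by apply: eq_in_filter => x xin; case: eqP xin un => // -> ->.
  have [vin|vn] := boolP (v \in vs); last first.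
    rewrite (eq_in_filter (a2 := predT)) ?filter_predT //; first by case: c.
    by move=> x xin; case: eqP xin vn => // -> ->.
  have [q /andP[q0 q1] ->] := avg_split1 f (fun=> c) uvs vin (proj1 wl).
  set as_ := [seq x <- vs | x != v].
  have m : avg as_ w f (upd (fun=> c) v false) <= avg as_ w f (upd (fun=> c) v true).
    apply: avg_mono => //; first exact: filter_uniq.
    by apply: cle_upd => //; apply: cle_refl.
  case: c m => m; rewrite upd_cst in m *; move: m; set x := avg _ _ _ _; set y := avg _ _ _ _ => m.
    have : (1 - q) * (y - x) >= 0 by rewrite mulr_ge0 // subr_ge0.
    lra.
  have : q * (y - x) >= 0 by rewrite mulr_ge0 // subr_ge0.
  lra.
move: en; rewrite negb_and => /orP[|] /aux; first exact.
by move=> /(_ (e1 e)); rewrite (eq_filter (a2 := fun x => (x != e1 e) && (x != e2 e))) // => x; rewrite andbC.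
Qed.

(** This is [openp] when the ratio of [isum (del e vs)] to [isum vs] is $M/(1+M)$, the largest
    possible if flipping a spin costs at most a factor $M$. *)
Definition popen b M : R := (expR b - expR (- b)) * M /
  (expR (- b) * (1 + M) + (expR b - expR (- b)) * M).

(* The end of [e] that gets frozen takes the opposite value with probability
   bounded below, so the bond is open with probability less than
   [1 - expR (- 2 b)]. *)
Lemma openp_le vs w b e c M : 0 <= b -> 0 < M -> (forall s, 0 < w s) -> uniq vs ->
  ~~ inside vs e -> (e1 e \in vs) || (e2 e \in vs) ->
  (forall s v c c', w (upd s v c) <= M * w (upd s v c')) ->
  openp e1 e2 vs w b e c <= popen b M.
Proof.
move=> b0 M0 w0 uvs en ein wM; rewrite /openp /popen.
have d0 : 0 <= expR b - expR (- b) by rewrite subr_ge0 ler_expR; lra.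
have c0 := expR_gt0 (- b).
have Z1 : 0 < isum (del e vs) w (fun=> c) by apply: isum_gt0.
have Z0 : 0 < isum vs w (fun=> c) by apply: isum_gt0.
suff key : (1 + M) * isum (del e vs) w (fun=> c) <= M * isum vs w (fun=> c).
  move: key d0 c0 Z1 Z0; move: (expR b - expR (- b)) => d; move: (expR (- b)) => k.
  move: (isum vs w _) => z; move: (isum _ w _) => z1 key d0 k0 z10 z0.
  have D1 : 0 < k * z + d * z1 by rewrite ltr_pwDl ?mulr_gt0 // mulr_ge0 // ltW.
  have D2 : 0 < k * (1 + M) + d * M.
    by rewrite ltr_pwDl ?mulr_gt0 ?addr_gt0 // mulr_ge0 // ltW.
  rewrite ler_pdivrMr // mulrAC ler_pdivlMr // -subr_ge0.
  rewrite (_ : _ - _ = d * k * (M * z - (1 + M) * z1)); last by ring.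
  by rewrite mulr_ge0 ?subr_ge0 // mulr_ge0 // ltW.
clear Z0 Z1; have aux u v : u \notin vs -> v \in vs ->
   (1 + M) * isum [seq x <- vs | (x != u) && (x != v)] w (fun=> c) <= M * isum vs w (fun=> c).
  move=> un vin.
  have -> : [seq x <- vs | (x != u) && (x != v)] = [seq x <- vs | x != v].
    by apply: eq_in_filter => x xin; case: eqP xin un => // -> ->.
  rewrite (isum_split1 _ _ uvs vin); set ws := [seq x <- vs | x != v].
  have vw : v \notin ws by rewrite mem_filter eqxx.
  have h c1 c2 : isum ws w (upd (fun=> c) v c1) <= M * isum ws w (upd (fun=> c) v c2).
    by rewrite !isum_upd // -isumZ; apply: le_isum => s; apply: wM.
  have -> : isum ws w (fun=> c) = isum ws w (upd (fun=> c) v c) by rewrite upd_cst.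
  case: c h => h; [have := h true false|have := h false true];
    move: (isum _ _ _) (isum _ _ _) => x y; lra.
case/orP: ein => ein.
  have un : e2 e \notin vs by move: en; rewrite /inside ein.
  have := aux _ _ un ein; rewrite (eq_filter (a2 := fun x => (x != e1 e) && (x != e2 e))) //.
  by move=> x; rewrite andbC.
have un : e1 e \notin vs by move: en; rewrite /inside ein andbT.
exact: aux.
Qed.

Lemma influence_le_perc k A K n b p o vs E :
  0 <= b -> uniq A -> (forall x, x \in A -> `|k x| <= K) -> 0 <= K ->
  popen b (expR (2 * K) * expR (2 * b * n%:R)) <= p -> p <= 1 -> uniq vs ->
  (forall v, (count (touch v) E <= n)%N) ->
  avg vs (fun s => wt b E s * fw k A s) (chi R [:: o]) (fun=> true) -
  avg vs (fun s => wt b E s * fw k A s) (chi R [:: o]) (fun=> false) <=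
  2 * perc p E (connR (tgt vs) o) [::].
Proof.
move=> b0 uA kK K0 pp p1 uvs; move: vs E uvs.
set M := expR (2 * K) * _ in pp.
have M0 : 0 < M by rewrite mulr_gt0 ?expR_gt0.
have p0 : 0 <= p.
  have d0 : 0 <= expR b - expR (- b) by rewrite subr_ge0 ler_expR; lra.
  apply: le_trans pp; apply: divr_ge0; first by apply: mulr_ge0 d0 (ltW M0).
  apply: addr_ge0; last by apply: mulr_ge0 d0 (ltW M0).
  by apply: mulr_ge0; [exact: expR_ge0|exact: addr_ge0 (ltW M0)].
have p01 : 0 <= p <= 1 by rewrite p0.
have w0 E s : 0 < wt b E s * fw k A s by rewrite mulr_gt0 ?expR_gt0.
have wl E : lat (fun s => wt b E s * fw k A s).
  by apply: latM; [exact: lat_wt|exact: lat_fw].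
have om : mono (chi R [:: o]) by move=> s t st; rewrite !chi1 spin_mono.
apply: (explore_ind (e1 := e1) (e2 := e2)).
- move=> vs E E' pe IH cE; rewrite -(wt_perm e1 e2 b pe) -(perc_perm _ p01 _ pe); last exact: incr_connR.
  by apply: IH => v; rewrite (permP pe).
- move=> vs E uvs aE _.
  have [oin|on] := boolP (o \in vs); last first.
    rewrite (eq_perc_in _ (g := fun=> 1)); last first.
      by move=> l' _; rewrite /connR asboolT //; apply: conn_in.
    rewrite perc_cst mulr1.
    set x := avg _ _ _ _; set y := avg _ _ _ _.
    have xle : x <= 1.
      rewrite -[leRHS](@avg_cst _ _ vs (fun s => wt b E s * fw k A s) 1 (fun=> true)) //.
      by apply: le_avg => // s; rewrite chi_le1.
    have yge : -1 <= y.
      rewrite -[leLHS](@avg_cst _ _ vs (fun s => wt b E s * fw k A s) (-1) (fun=> false)) //.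
      by apply: le_avg => // s; rewrite chi1 spin_geN1.
    lra.
  (* Frozen spins are opposite in the two states; through the field they contribute only this
     constant ratio of weights. *)
  pose r := expR (\sum_(x <- A | x \notin vs) 2 * k x).
  rewrite (@avg_wscale _ _ _ _ (fun s => wt b E s * fw k A s) r _ _ (fun=> false)).
  + by rewrite subrr mulr_ge0 // perc_ge0 // => l; apply: connR_ge0.
  + by rewrite gt_eqF // expR_gt0.
  move=> s t st sE tE; split; last by rewrite !chi1 st.
  rewrite mulrCA; congr (_ * _).
    congr (expR (_ * _)); apply: eq_big_seq => e /(allP aE)/andP[i1 i2].
    by rewrite /bond !st.
  rewrite /fw /r -expRD; congr (expR _).
  rewrite [X in _ = X + _]big_mkcond -big_split /=; apply: eq_bigr => x _.
  case: (boolP (x \in vs)) => [/st ->|xn]; first by rewrite add0r.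
  rewrite sE // tE //=; ring.
- move=> vs e E uvs en IH1 IH2 cE.
  have cE' v : (count (touch v) E <= n)%N.
    by apply: leq_trans (cE v) => /=; rewrite leq_addl.
  have {}IH1 := IH1 cE'; have {}IH2 := IH2 cE'.
  have thE : perc p (e :: E) (connR (tgt vs) o) [::] =
    (1 - p) * perc p E (connR (tgt vs) o) [::] +
    p * perc p E (connR (tgt (del e vs)) o) [::].
    rewrite /= (perc_acc _ _ _ p01); last exact: incr_connR.
    congr (_ + _ * _); apply: eq_perc => l; exact: connR_del.
  have wE : (fun s => wt b (e :: E) s * fw k A s) =
      fun s => expR (b * bond s e) * (wt b E s * fw k A s).
    by apply/funext => s; rewrite wt_cons mulrA.
  rewrite wE !(avg_freeze _ _ uvs en b0 (w0 E)) thE.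
  have [ein|] := boolP ((e1 e \in vs) || (e2 e \in vs)); last first.
    rewrite negb_or => /andP[n1 n2].
    have dE : del e vs = vs.
      rewrite /del (eq_in_filter (a2 := predT)) ?filter_predT // => x xin.
      by case: eqP xin n1 => [-> ->|_ xin _] //; case: eqP xin n2 => // -> ->.
    rewrite dE -!mulrDl !subrK !mul1r; exact: IH1.
  have wM s v c c' : wt b E (upd s v c) * fw k A (upd s v c) <=
     M * (wt b E (upd s v c') * fw k A (upd s v c')).
    rewrite [leRHS](_ : _ = (expR (2 * b * n%:R) * wt b E (upd s v c')) *
      (expR (2 * K) * fw k A (upd s v c'))); last by rewrite /M; ring.
    by apply: ler_pM; rewrite ?expR_ge0 ?fw_flip ?wt_flip.
  have qT := le_trans (openp_le true b0 M0 (w0 E) uvs en ein wM) pp.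
  have qF := le_trans (openp_le false b0 M0 (w0 E) uvs en ein wM) pp.
  have mT := freeze_mono true uvs en (wl E) om.
  have mF := freeze_mono false uvs en (wl E) om.
  rewrite /= in mT mF; move: IH1 IH2 qT qF mT mF.
  set a := avg vs _ _ _; set a' := avg (del _ _) _ _ _.
  set c := avg vs _ _ _; set c' := avg (del _ _) _ _ _.
  set q := openp _ _ vs _ _ _ true; set q' := openp _ _ vs _ _ _ false.
  set t := perc _ _ (connR (tgt vs) o) _; set t' := perc _ _ (connR (tgt (del e vs)) o) _.
  move: a a' c c' q q' t t' => a a' c c' q q' t t' IH1 IH2 qT qF mT mF.
  (* Freezing raises the plus mean and lowers the minus mean, so replacing [q] and [q'] by [p] only
     widens the gap; [h3] and [h4] are the induction hypotheses weighted by the two outcomes. *)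
  have h1 : (p - q) * (a' - a) >= 0 by rewrite mulr_ge0 // subr_ge0.
  have h2 : (p - q') * (c - c') >= 0 by rewrite mulr_ge0 // subr_ge0.
  have h3 : (1 - p) * (2 * t - (a - c)) >= 0 by rewrite mulr_ge0 // subr_ge0.
  have h4 : p * (2 * t' - (a' - c')) >= 0 by rewrite mulr_ge0 // subr_ge0.
  lra.
Qed.

End Influence.

(** * Gibbs states on the lattice *)

Lemma perm_filterD (U : eqType) (A S : seq U) : uniq A -> uniq S -> {subset S <= A} ->
  perm_eq A ([seq x <- A | x \notin S] ++ S).
Proof.
move=> uA uS SA; apply: uniq_perm => //.
  rewrite cat_uniq filter_uniq // uS andbT /=; apply/hasPn => x xS.
  by rewrite mem_filter xS.
by move=> x; rewrite mem_cat mem_filter; case: (boolP (x \in S)) => [/SA ->|_]; rewrite ?orbT ?orbF.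
Qed.

Section Specification.
Variables (T : eqType) (R : realType).
Implicit Types (vs S : seq T) (f w : conf T -> R).

(** The DLR equations: given the spins off [S], the factor [w1] is constant and cancels from the
    conditional mean. *)
Lemma avg_tower vs S w w0 w1 f s : uniq vs -> uniq S -> {subset S <= vs} ->
  (forall r, 0 < w0 r) -> (forall r, w r = w1 r * w0 r) ->
  (forall r v c, v \in S -> w1 (upd r v c) = w1 r) ->
  avg vs w (avg S w0 f) s = avg vs w f s.
Proof.
move=> uvs uS Svs w00 wE w1i.
have pe := perm_filterD uvs uS Svs.
rewrite /avg; congr (_ / _).
rewrite !(isum_perm _ _ uvs pe) !isum_cat; apply: eq_isum => r.
rewrite (eq_isum _ (g := fun t => avg S w0 f t * w1 t * w0 t)); last first.
  by move=> t; rewrite wE mulrA.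
rewrite (isum_inv _ _ (g := fun t => avg S w0 f t * w1 t)); last first.
  move=> t v c vS; rewrite w1i //; congr (_ * _).
  by congr (_ / _); apply: isum_base => x xS; rewrite updN //; apply: contraNneq xS => ->.
rewrite [RHS](eq_isum _ (g := fun t => w1 t * (f t * w0 t))); last first.
  by move=> t; rewrite wE mulrCA.
by rewrite (isum_inv _ _ (g := w1)) // /avg mulrAC divfK ?gt_eqF ?isum_gt0 // mulrC.
Qed.

Lemma isum_map (tau : T -> T) vs f g s : injective tau ->
  (forall r, f r = g (r \o tau)) ->
  isum (map tau vs) f s = isum vs g (s \o tau).
Proof.
move=> ti fg; elim: vs s => [|v vs IH] s /=; first exact: fg.
rewrite !IH.
have E c : upd s (tau v) c \o tau = upd (s \o tau) v c.
  by apply/funext => x; rewrite /upd /= (inj_eq ti).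
by rewrite !E.
Qed.

End Specification.

Section Lattice_states.
Variables (R : realType) (d : nat).
Notation Ed := (site d * 'I_d)%type.
Implicit Types (x y a : site d) (e : Ed) (A S vs : seq (site d)) (s t : conf (site d)).
Implicit Types (b H : R) (h : site d -> R).

Definition src (e : Ed) : site d := e.1.
Definition dst (e : Ed) : site d := e.1 + delta_mx 0 e.2.

Lemma src_neq_dst e : src e != dst e.
Proof.
rewrite /src /dst -subr_eq0 opprD addrA subrr sub0r oppr_eq0.
by apply/eqP => /matrixP/(_ 0 e.2); rewrite !mxE !eqxx.
Qed.

(** [undup] is there because a bond with both ends in [A] is listed from each of them. *)
Definition edg A : seq Ed :=
  undup ([seq (x, i) | x <- A, i <- enum 'I_d] ++
         [seq (x - delta_mx 0 i, i) | x <- A, i <- enum 'I_d]).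

Lemma edg_uniq A : uniq (edg A).
Proof. exact: undup_uniq. Qed.

Lemma mem_edg A e : (e \in edg A) = (src e \in A) || (dst e \in A).
Proof.
rewrite mem_undup mem_cat; congr (_ || _).
  apply/allpairsP/idP => [[[x i] /= [xA _ ->]]//|eA].
  by exists e; rewrite eA mem_enum; split => //; case: e {eA}.
apply/allpairsP/idP => [[[x i] /= [xA _ ->]]|eA].
  by rewrite /dst /= subrK.
exists (dst e, e.2); rewrite eA mem_enum; split => //.
by rewrite /dst /= addrK; case: e {eA}.
Qed.

Notation inside := (inside src dst).
Notation cut := (cut src dst).
Notation inner := (inner src dst).
Notation outer := (outer src dst).
Notation touch := (touch src dst).

Lemma edg_cut S e : (e \in edg S) = inside S e || cut S e.
Proof. by rewrite mem_edg /inside /cut; case: (_ \in S); case: (_ \in S). Qed.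

Lemma count_touch (E : seq Ed) x : uniq E -> (count (touch x) E <= 2 * d)%N.
Proof.
move=> uE; rewrite -size_filter.
pose F := [seq (x, i) | i <- enum 'I_d] ++ [seq (x - delta_mx 0 i, i) | i <- enum 'I_d].
have -> : (2 * d)%N = size F.
  by rewrite /F size_cat !size_map -!enumT size_enum_ord mul2n addnn.
apply: uniq_leq_size; first exact: filter_uniq.
move=> e; rewrite mem_filter /F => /andP[/orP[] /eqP -> _]; rewrite mem_cat; apply/orP.
  by left; apply/mapP; exists e.2; rewrite ?mem_enum //; case: e.
by right; apply/mapP; exists e.2; rewrite ?mem_enum // /dst addrK; case: e.
Qed.

Definition bd S : seq (site d) := undup [seq outer S e | e <- [seq e <- edg S | cut S e]].

Lemma bd_uniq S : uniq (bd S). Proof. exact: undup_uniq. Qed.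

Lemma mem_bd S y : (y \in bd S) = has (fun e => cut S e && (outer S e == y)) (edg S).
Proof.
rewrite mem_undup; apply/mapP/hasP => [[e + ->]|[e eS /andP[ce /eqP <-]]].
  by rewrite mem_filter => /andP[ce eS]; exists e; rewrite ?ce ?eqxx.
by exists e; rewrite ?mem_filter ?ce.
Qed.

Lemma bd_notin S y : y \in bd S -> y \notin S.
Proof.
by rewrite mem_bd => /hasP[e _ /andP[ce /eqP <-]]; apply: cut_outer ce.
Qed.

Definition gw b H h A s : R := wt src dst b (edg A) s * fw (fun x => H * h x) A s.

Lemma gw_gt0 b H h A s : 0 < gw b H h A s.
Proof. by rewrite mulr_gt0 ?expR_gt0. Qed.

Lemma lat_gw b H h A : 0 <= b -> lat (gw b H h A).
Proof. by move=> b0; apply: latM; [exact: lat_wt|exact: lat_fw]. Qed.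

Lemma gw_tower b H h A S f s : uniq A -> uniq S -> {subset S <= A} ->
  avg A (gw b H h A) (avg S (gw b H h S) f) s = avg A (gw b H h A) f s.
Proof.
move=> uA uS SA.
pose w1 r := wt src dst b [seq e <- edg A | e \notin edg S] r *
  fw (fun x => H * h x) [seq x <- A | x \notin S] r.
apply: (@avg_tower _ _ _ _ _ _ w1) => // [r|r|r v c vS]; first exact: gw_gt0.
  have sE : {subset edg S <= edg A}.
    by move=> e; rewrite !mem_edg => /orP[/SA ->|/SA ->]; rewrite ?orbT.
  have pe := perm_filterD (edg_uniq A) (edg_uniq S) sE.
  have pv := perm_filterD uA uS SA.
  rewrite /gw /w1 (wt_perm src dst b pe) wt_cat mulrACA; congr (_ * _).
  by rewrite /fw (perm_big _ pv) big_cat /= expRD.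
rewrite /w1; congr (_ * _).
  congr (expR (_ * _)); apply: eq_big_seq => e; rewrite mem_filter mem_edg negb_or.
  move=> /andP[/andP[n1 n2] _]; rewrite /bond !updN //.
    by apply: contraNneq n2 => ->.
  by apply: contraNneq n1 => ->.
congr (expR _); apply: eq_big_seq => x; rewrite mem_filter => /andP[xS _].
by rewrite updN //; apply: contraNneq xS => ->.
Qed.

(** The spatial Markov property: frozen spins enter the weight only through cut bonds. *)
Lemma gw_local b H h S o s t : o \in S -> {in bd S, s =1 t} ->
  avg S (gw b H h S) (chi R [:: o]) s = avg S (gw b H h S) (chi R [:: o]) t.
Proof.
move=> oS st; apply: (@avg_wscale _ _ _ _ _ 1) => [|s' t' st' s'E t'E].
  exact: oner_neq0.
rewrite mul1r !chi1 st' //; split=> //; congr (_ * _); last first.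
  by congr (expR _); apply: eq_big_seq => x xS; rewrite st'.
congr (expR (_ * _)); apply: eq_big_seq => e; rewrite edg_cut => /orP[/andP[i1 i2]|ce].
  by rewrite /bond !st'.
have oE := cut_outer ce; rewrite !(bond_io _ _ _ S) (st' _ (cut_inner ce)) (s'E _ oE) (t'E _ oE).
rewrite st // mem_bd; apply/hasP; exists e; last by rewrite ce eqxx.
by rewrite edg_cut ce orbT.
Qed.

Definition shift a x : site d := a + x.

Lemma shift_inj a : injective (shift a).
Proof. exact: addrI. Qed.

Lemma edg_shift a S : perm_eq (edg (map (shift a) S)) [seq (shift a e.1, e.2) | e <- edg S].
Proof.
apply: uniq_perm; first exact: edg_uniq.
  rewrite map_inj_uniq ?edg_uniq // => -[x i] [y j] [/shift_inj -> ->] //.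
have mapS z : (z \in map (shift a) S) = (z - a \in S).
  by rewrite -[z in LHS](subrK a) addrC (mem_map (@shift_inj a)).
move=> [x i]; rewrite mem_edg !mapS /src /dst /= addrAC; apply/orP/mapP.
  move=> h; exists (x - a, i); last by rewrite /shift /= addrC subrK.
  by rewrite mem_edg; apply/orP.
case=> -[y j] + [-> ->]; rewrite mem_edg /src /dst /shift /= => /orP.
by have -> : a + y - a = y by rewrite addrAC subrr add0r.
Qed.

Lemma gw_shift b H h a S o s :
  avg (map (shift a) S) (gw b H h (map (shift a) S)) (chi R [:: shift a o]) s =
  avg S (gw b H (h \o shift a) S) (chi R [:: o]) (s \o shift a).
Proof.
have gE r : gw b H h (map (shift a) S) r = gw b H (h \o shift a) S (r \o shift a).
  rewrite /gw (wt_perm src dst b (edg_shift a S)); congr (_ * _).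
    rewrite /wt /en big_map; congr (expR (_ * _)); apply: eq_bigr => e _.
    by rewrite /bond /src /dst /shift /= addrA.
  by rewrite /fw big_map.
by rewrite /avg; congr (_ / _); apply: isum_map => //; try exact: shift_inj;
   move=> r; rewrite gE // !chi1.
Qed.

(** Each use of the inequality moves by at most [m] and gains a factor [rho]; from the origin,
    $\lfloor L/m\rfloor$ uses remain in the range where it is assumed. *)
Lemma iterate_kernel (I : Type) (r : seq I) (K : I -> R) (pos : I -> site d)
    (C rho : R) (m L : nat) (f : site d -> R) :
  0 <= C -> (forall i, 0 <= K i) -> \sum_(i <- r) K i <= rho -> (0 < m)%N ->
  (forall i j, `|pos i 0 j| <= m%:Z) -> (forall x, f x <= C) ->
  (forall x, (forall j, `|x 0 j| + m%:Z <= L%:Z) -> f x <= \sum_(i <- r) K i * f (x + pos i)) ->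
  f 0 <= C * rho ^+ (L %/ m).
Proof.
move=> C0 K0 Kr m0 posm fC fK.
have rho0 : 0 <= rho by apply: le_trans Kr; apply: sumr_ge0.
have main k x : (forall j, `|x 0 j| + (m * k)%N%:Z <= L%:Z) -> f x <= C * rho ^+ k.
  elim: k x => [|k IH] x xL; first by rewrite expr0 mulr1.
  apply: (@le_trans _ _ (\sum_(i <- r) K i * f (x + pos i))).
    apply: fK => j; have := xL j; move: (`|x 0 j|) => z; rewrite mulnS PoszD; lia.
  apply: (@le_trans _ _ (\sum_(i <- r) K i * (C * rho ^+ k))).
    apply: ler_sum => i _; apply: ler_wpM2l => //; apply: IH => j.
    have := xL j; have := posm i j; have := ler_normD (x 0 j) (pos i 0 j).
    rewrite mxE mulnS PoszD; move: (`|x 0 j|) (`|pos i 0 j|) (`|_ + _|) => z1 z2 z3; lia.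
  rewrite -mulr_suml exprS [leRHS]mulrCA; apply: ler_wpM2r => //.
  by rewrite mulr_ge0 // exprn_ge0.
apply: main => j; rewrite mxE normr0 add0r mulnC lez_nat; exact: leq_trunc_div.
Qed.

End Lattice_states.

(** * A finite-size criterion *)

Section Criterion.
Variables (R : realType) (d : nat).
Notation Ed := (site d * 'I_d)%type.
Implicit Types (x y a : site d) (e : Ed) (A S vs : seq (site d)) (s t : conf (site d)).
Implicit Types (b H rho p : R) (h : site d -> R) (K : site d -> R) (m L : nat).
Notation src := (@src d).
Notation dst := (@dst d).
Notation inside := (inside src dst).
Notation cut := (cut src dst).
Notation inner := (inner src dst).
Notation outer := (outer src dst).
Notation wt := (wt src dst).
Notation connR := (connR R src dst).
Notation spn x := (chi R [:: x]).

Definition boxs L : seq (site d) := enum_fset (box d L).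

Lemma boxs_uniq L : uniq (boxs L). Proof. exact: fset_uniq. Qed.

Lemma mem_boxs L x : (x \in boxs L) = [forall i, `|x 0 i| <= L%:Z].
Proof. exact: mem_box. Qed.

(** By monotonicity no pair of boundary conditions gives a larger gap, so its decay at the origin
    suffices; other [x] are needed for the iteration. *)
Definition disagreement b H h L x : R :=
  avg (boxs L) (gw b H h (boxs L)) (spn x) (fun=> true) -
  avg (boxs L) (gw b H h (boxs L)) (spn x) (fun=> false).

(** The field lives on the whole lattice so that the class is stable under translations. *)
Definition bimodal h := forall x, h x = -1 \/ h x = 1.

Lemma avg_spn_le1 vs w x s : (forall t, 0 < w t) -> avg vs w (spn x) s <= 1.
Proof.
move=> w0; rewrite -[leRHS](@avg_cst _ _ vs w 1 s) //.
by apply: le_avg => // t; apply: chi_le1.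
Qed.

Lemma avg_spn_geN1 vs w x s : (forall t, 0 < w t) -> -1 <= avg vs w (spn x) s.
Proof.
move=> w0; rewrite -[leLHS](@avg_cst _ _ vs w (-1) s) //.
by apply: le_avg => // t; rewrite chi1 spin_geN1.
Qed.

(* Raising boundary spins one at a time. *)
Lemma increment_le (F : conf (site d) -> R) K ys s t : uniq ys ->
  (forall y r, y \in ys -> F (upd r y true) - F (upd r y false) <= 2 * K y) ->
  cle s t ->
  F (fun z => if z \in ys then t z else s z) - F s <=
  \sum_(y <- ys) K y * (spin R (t y) - spin R (s y)).
Proof.
move=> + + st; elim: ys => [|y ys IH] /=; first by move=> _ _; rewrite big_nil subrr.
move=> /andP[yn uys] FK; rewrite big_cons.
have {}IH := IH uys (fun z r zy => FK z r (mem_behead (s := y :: ys) zy)).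
set r := fun z => if z \in ys then t z else s z in IH.
have -> : (fun z => if z \in y :: ys then t z else s z) = upd r y (t y).
  apply/funext => z; rewrite in_cons /upd /r.
  by case: (z =P y) => [->|].
have ry : r y = s y by rewrite /r (negbTE yn).
rewrite -(subrKA (F r)) lerD // -{2}(upd_id r y) ry.
have := st y; case: (s y); case: (t y) => //= _; rewrite ?subrr ?mulr0 //.
by apply: (le_trans (FK _ _ (mem_head _ _))); rewrite opprK mulrDr !mulr1 mulrC; lra.
Qed.

(** The influence bound makes $\sum_y K(y)\sigma_{x+y}$ minus the mean spin at [x] in the translate
    of [S] an increasing function [g] of the spins. Its plus mean dominates its minus mean, which
    says that the disagreement $D$ satisfies $D(x)\le\sum_y K(y)D(x+y)$. Translating to [x] shifts
    the field, hence the bound for all bimodal fields. *)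
Lemma finite_size_criterion b H S m K rho :
  0 <= b -> uniq S -> 0 \in S -> (0 < m)%N ->
  (forall x, x \in S -> forall j, `|x 0 j| <= m%:Z) ->
  (forall x, x \in bd S -> forall j, `|x 0 j| <= m%:Z) ->
  (forall y, 0 <= K y) -> \sum_(y <- bd S) K y <= rho ->
  (forall h s y, bimodal h -> y \in bd S ->
     avg S (gw b H h S) (spn 0) (upd s y true) -
     avg S (gw b H h S) (spn 0) (upd s y false) <= 2 * K y) ->
  forall L h, bimodal h -> disagreement b H h L 0 <= 2 * rho ^+ (L %/ m).
Proof.
move=> b0 uS S0 m0 Sm bdm K0 Krho infl L h hb.
(* [iterate_kernel] wants bounded displacements for all indices; off the boundary of [S] the default
   0 complies. *)
pose pos y := if y \in bd S then y else 0.
apply: (@iterate_kernel R d _ (bd S) K pos 2 rho m L (disagreement b H h L)) => //.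
- move=> y j; rewrite /pos; case: ifP => [/bdm|_]; first exact.
  by rewrite mxE normr0.
- move=> x; rewrite /disagreement.
  have := avg_spn_le1 (boxs L) x (fun=> true) (gw_gt0 b H h (boxs L)).
  have := avg_spn_geN1 (boxs L) x (fun=> false) (gw_gt0 b H h (boxs L)).
  lra.
move=> x xL; rewrite /disagreement.
set Sx := map (shift x) S; set A := boxs L.
have SA : {subset Sx <= A}.
  move=> z /mapP[y yS ->]; rewrite mem_boxs; apply/forallP => j.
  have := xL j; have := Sm y yS j; have := ler_normD (x 0 j) (y 0 j).
  rewrite /shift mxE; move: (`|x 0 j|) (`|y 0 j|) (`|_ + _|) => z1 z2 z3; lia.
have uSx : uniq Sx by rewrite map_inj_uniq // => u v; apply: shift_inj.
pose f s := avg Sx (gw b H h Sx) (spn x) s.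
pose F s := avg S (gw b H (h \o shift x) S) (spn 0) s.
have fF s : f s = F (s \o shift x).
  rewrite /F -gw_shift /f; congr (avg _ _ (spn _)).
  by rewrite /shift addr0.
have Finc s t : cle s t -> F t - F s <= \sum_(y <- bd S) K y * (spin R (t y) - spin R (s y)).
  move=> st.
  have -> : F t = F (fun z => if z \in bd S then t z else s z).
    by apply: gw_local => // z zb; rewrite zb.
  apply: increment_le => //; first exact: bd_uniq.
  by move=> y r yS; apply: infl => // z; apply: hb.
pose g s := \sum_(y <- bd S) K y * spin R (s (x + y)) - f s.
have gm : mono g.
  move=> s t st; rewrite /g !fF.
  have := Finc (s \o shift x) (t \o shift x) (fun z => st _).
  rewrite (eq_bigr _ (fun y _ => mulrBr (K y) _ _)) sumrB /shift /=.
  set u := F _; set v := F _; set c := \sum_(y <- _) _; set c' := \sum_(y <- _) _; lra.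
have tower c : avg A (gw b H h A) f (fun=> c) = avg A (gw b H h A) (spn x) (fun=> c).
  by rewrite gw_tower // boxs_uniq.
have := avg_mono (boxs_uniq L) (lat_gw H h A b0) gm (s := fun=> false) (t := fun=> true).
move=> /(_ (fun _ => isT)); rewrite !avgB !tower !avg_sum => hh.
have E c y : avg A (gw b H h A) (fun t => K y * spin R (t (x + y))) (fun=> c) =
   K y * avg A (gw b H h A) (spn (x + y)) (fun=> c).
  by rewrite avgZ; congr (_ * _); apply: eq_avg => s; rewrite chi1.
move: hh; rewrite !(eq_bigr _ (fun y _ => E _ y)).
rewrite [X in _ -> _ <= X](_ : _ =
  \sum_(i <- bd S) (K i * avg A (gw b H h A) (spn (x + i)) (fun=> true)) -
  \sum_(i <- bd S) (K i * avg A (gw b H h A) (spn (x + i)) (fun=> false))); last first.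
  by rewrite -sumrB; apply: eq_big_seq => y yb; rewrite /pos yb mulrBr.
rewrite -/A; set u := avg _ _ _ _; set v := avg _ _ _ _.
set c := \sum_(y <- _) _; set c' := \sum_(y <- _) _; lra.
Qed.

End Criterion.

(** * Union bound over the open cut bonds *)

Section Star.
Variables (T Ed : eqType) (R : realType) (e1 e2 : Ed -> T).
Implicit Types (l E : seq Ed) (e : Ed) (o : T) (p : R) (S : seq T).
Notation inside := (inside e1 e2).
Notation cut := (cut e1 e2).
Notation inner := (inner e1 e2).
Notation connR := (connR R e1 e2).
Notation conn := (conn e1 e2).

Lemma perc_cat p E (f : seq Ed -> R) l l1 :
  perc p E f (l ++ l1) = perc p E (fun r => f (r ++ l1)) l.
Proof. by elim: E l => //= e E IH l; rewrite -!IH. Qed.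

(** A connection from [o] stays on inside bonds until it first uses a cut bond, at the inner end of
    the latter. *)
Lemma conn_star S l1 l2 o : o \in S -> all (cut S) l1 -> all (inside S) l2 ->
  conn (tgt S) (l2 ++ l1) o -> exists2 e, e \in l1 & conn (pred1 (inner S e)) l2 o.
Proof.
move=> oS /allP c1 i2 co.
have cl2 : conn (fun y => tgt S y || (y \in map (inner S) l1)) l2 o.
  elim: co {oS} => [x xS|e el _ IH|e el _ IH]; first by apply: conn_in; rewrite xS.
    move: el; rewrite mem_cat => /orP[el|el]; first exact: conn_fwd el IH.
    apply: conn_in; rewrite /tgt; case: (boolP (e1 e \in S)) => //= eS.
    by apply/mapP; exists e => //; rewrite /inner eS.
  move: el; rewrite mem_cat => /orP[el|el]; first exact: conn_bwd el IH.
  apply: conn_in; rewrite /tgt; case: (boolP (e2 e \in S)) => //= eS.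
  apply/mapP; exists e => //; rewrite /inner.
  by move: (c1 _ el); rewrite /cut eS; case: (e1 e \in S).
case: (conn_predU cl2) => [/(conn_inside i2)/(_ oS)[y yS]|c].
  by rewrite /tgt yS.
elim: c => [x /mapP[e el ->]|e el _ [e' el' c']|e el _ [e' el' c']].
- by exists e => //; apply: conn_in => /=.
- by exists e' => //; apply: conn_fwd.
- by exists e' => //; apply: conn_bwd.
Qed.

(** The state of a cut bond is independent of the inside bonds, whence the product. In [gen], the
    list [l1] holds the cut bonds already found open. *)
Lemma perc_star S p es E o : 0 <= p <= 1 -> o \in S -> all (cut S) es -> all (inside S) E ->
  perc p (es ++ E) (connR (tgt S) o) [::] <=
  \sum_(e <- es) p * perc p E (connR (pred1 (inner S e)) o) [::].
Proof.
move=> p01 oS ces iE; set X := fun e => perc p E (connR (pred1 (inner S e)) o) [::].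
have gen l1 : all (cut S) l1 -> perc p (es ++ E) (connR (tgt S) o) l1 <=
    \sum_(e <- l1) X e + \sum_(e <- es) p * X e.
  have [p0 p1] := andP p01.
  elim: es ces l1 => [|e es IH] ces l1 cl1 /=.
    rewrite big_nil addr0 -{1}(cat0s l1) perc_cat /X -perc_sum.
    apply: le_perc_in => // l; rewrite cats0 => lE.
    have S0 : 0 <= \sum_(i <- l1) connR (pred1 (inner S i)) o l.
      by apply: sumr_ge0 => i _; apply: connR_ge0.
    rewrite {1}/connR; case: asboolP => // co.
    have il : all (inside S) l by apply/allP => e /lE; move/allP: iE; apply.
    have [e el c] := conn_star oS cl1 il co.
    rewrite (big_rem e) //= /connR asboolT //= lerDl.
    by apply: sumr_ge0 => i _; apply: connR_ge0.
  case/andP: ces => ce ces.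
  have h1 := IH ces l1 cl1.
  have h2 : perc p (es ++ E) (connR (tgt S) o) (e :: l1) <=
      \sum_(e0 <- e :: l1) X e0 + \sum_(e0 <- es) p * X e0.
    by apply: IH => //=; rewrite ce cl1.
  rewrite big_cons in h2; rewrite big_cons.
  have h3 : 0 <= (1 - p) * (\sum_(e0 <- l1) X e0 + \sum_(e0 <- es) p * X e0 -
     perc p (es ++ E) (connR (tgt S) o) l1) by rewrite mulr_ge0 ?subr_ge0.
  have h4 := ler_wpM2l p0 h2; move: h3 h4.
  rewrite -/(X e); set u := \sum_(e0 <- l1) _; set v := \sum_(e0 <- es) _.
  by move: (perc _ _ _ l1) (perc _ _ _ (e :: l1)) (X e) u v => z1 z2 z3 u v; lra.
by have := gen [::] isT; rewrite big_nil add0r.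
Qed.

End Star.

(** * Influence of one boundary site of a region *)

Section Kernels.
Variables (R : realType) (d : nat).
Notation Ed := (site d * 'I_d)%type.
Implicit Types (x y a o : site d) (e : Ed) (A S vs : seq (site d)) (s t : conf (site d)).
Implicit Types (b H rho p : R) (h : site d -> R) (K : site d -> R) (m L : nat).
Notation src := (@src d).
Notation dst := (@dst d).
Notation inside := (inside src dst).
Notation cut := (cut src dst).
Notation inner := (inner src dst).
Notation outer := (outer src dst).
Notation wt := (wt src dst).
Notation connR := (connR R src dst).
Notation touch := (touch src dst).
Notation spn x := (chi R [:: x]).

Definition inedg S := [seq e <- edg S | inside S e].

(** The cost of flipping one spin: the first factor is for the field, to which each of at most $2d$
    absorbed boundary neighbours adds $b$; the second is for the remaining bonds at the site. *)
Definition flipK b H : R :=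
  expR (2 * (H + b * (2 * d)%:R)) * expR (2 * b * (2 * d)%:R).

(** Boundary spins other than the one at [y] are moved into the field [k] of their inner neighbours.
    Only the inside bonds and those ending at [y] remain, so the boundary condition may be taken
    constant and [influence_le_perc] applies. *)
Lemma influence_kernel b H p S h s y : 0 <= b -> 0 <= H ->
  popen b (flipK b H) <= p -> p <= 1 -> uniq S -> 0 \in S -> bimodal h -> y \in bd S ->
  avg S (gw b H h S) (spn 0) (upd s y true) -
  avg S (gw b H h S) (spn 0) (upd s y false) <=
  2 * \sum_(e <- edg S | cut S e && (outer S e == y))
        p * perc p (inedg S) (connR (pred1 (inner S e)) 0) [::].
Proof.
move=> b0 H0 pp p1 uS S0 hb yb; have yS := bd_notin yb.
pose star e := cut S e && (outer S e == y).
pose other e := cut S e && (outer S e != y).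
pose E := [seq e <- edg S | star e] ++ inedg S.
pose k x := H * h x + b * \sum_(e <- edg S | other e && (inner S e == x)) spin R (s (outer S e)).
have kK x : x \in S -> `|k x| <= H + b * (2 * d)%:R.
  move=> _; rewrite (le_trans (ler_normD _ _)) // lerD //.
    by rewrite normrM ger0_norm //; case: (hb x) => ->; rewrite ?normrN normr1 mulr1.
  rewrite normrM ger0_norm // ler_wpM2l //.
  apply: (le_trans (ler_norm_sum _ _ _)).
  rewrite (eq_bigr (fun=> 1%:R)); last first.
    by move=> e _; case: (s _); rewrite /= ?normrN normr1.
  rewrite -natr_sum ler_nat sum1_count (leq_trans _ (count_touch x (edg_uniq S))) //.
  apply: sub_count => e /andP[_ /eqP <-]; rewrite /touch /inner.
  by case: ifP; rewrite eqxx ?orbT.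
have wE c : avg S (gw b H h S) (spn 0) (upd s y c) =
    avg S (fun t => wt b E t * fw k S t) (spn 0) (fun=> c).
  apply: (@avg_wscale _ _ _ _ _ 1) => [|r t rt rE tE]; first exact: oner_neq0.
  rewrite mul1r !chi1 rt //; split=> //.
  rewrite /gw /wt /fw -!expRD; congr (expR _).
  have -> : \sum_(x <- S) H * h x * spin R (r x) = \sum_(x <- S) H * h x * spin R (t x).
    by apply: eq_big_seq => x xS; rewrite rt.
  have -> : en R src dst (edg S) r = en R src dst E t +
      \sum_(e <- edg S | other e) spin R (s (outer S e)) * spin R (t (inner S e)).
    rewrite /en /E big_cat !big_filter /= (bigID (inside S)) /= addrC.
    rewrite (bigID (fun e => outer S e == y)) /= addrAC; congr (_ + _ + _).
    - rewrite big_seq_cond [RHS]big_seq_cond; apply: eq_big => e.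
        rewrite /star edg_cut /inside /cut.
        by case: (src e \in S); case: (dst e \in S).
      rewrite edg_cut => /andP[/orP[->//|ce] /andP[_ /eqP oy]].
      by rewrite !(bond_io _ _ _ S) (rt _ (cut_inner ce)) oy (rE _ yS) (tE _ yS) updE.
    - by apply: eq_bigr => e /andP[i1 i2]; rewrite /bond !rt.
    rewrite big_seq_cond [RHS]big_seq_cond; apply: eq_big => e.
      rewrite /other edg_cut /inside /cut.
      by case: (src e \in S); case: (dst e \in S).
    rewrite edg_cut => /andP[/orP[->//|ce] /andP[_ oy]].
    by rewrite !(bond_io _ _ _ S) (rt _ (cut_inner ce)) (rE _ (cut_outer ce)) updN // mulrC.
  have -> : \sum_(x <- S) k x * spin R (t x) = \sum_(x <- S) H * h x * spin R (t x) +
      b * \sum_(e <- edg S | other e) spin R (s (outer S e)) * spin R (t (inner S e)).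
    rewrite mulr_sumr.
    under eq_bigr do rewrite mulrDl.
    rewrite big_split /=; congr (_ + _).
    under eq_bigr do rewrite -mulrA mulr_suml mulr_sumr.
    rewrite (exchange_big_dep other) /=; last by move=> x e _ /andP[].
    apply: eq_bigr => e oe; rewrite (eq_bigl (fun x => x == inner S e)); last first.
      by move=> x; rewrite oe eq_sym.
    by rewrite -big_filter filter_pred1_uniq ?big_seq1 ?cut_inner //; case/andP: oe.
  ring.
rewrite !wE.
have K0 : 0 <= H + b * (2 * d)%:R by rewrite addr_ge0 // mulr_ge0.
have uE : uniq E.
  rewrite cat_uniq !filter_uniq ?edg_uniq //= andbT; apply/hasPn => e.
  rewrite !mem_filter /star => /andP[ie _]; apply/negP => /andP[/andP[ce _] _].
  by move: ie ce; rewrite /inside /cut => /andP[-> ->].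
have p0 : 0 <= p.
  apply: le_trans pp; rewrite /popen.
  have d0 : 0 <= expR b - expR (- b) by rewrite subr_ge0 ler_expR; lra.
  have M0 : 0 <= flipK b H by rewrite mulr_ge0 ?expR_ge0.
  apply: divr_ge0; first exact: mulr_ge0.
  by apply: addr_ge0; apply: mulr_ge0 => //; first [exact: expR_ge0|exact: addr_ge0].
have h1 := @influence_le_perc _ _ R src dst k S _ (2 * d)%N b p 0 S E b0 uS kK K0 pp p1 uS
  (fun v => count_touch v uE).
apply: (le_trans h1); rewrite ler_wpM2l //.
rewrite -big_filter; apply: perc_star => //; rewrite ?p0 //.
  by apply/allP => e; rewrite mem_filter => /andP[/andP[]].
by apply/allP => e; rewrite mem_filter => /andP[].
Qed.

End Kernels.

(** * Geometric and exponential rates *)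

Section Rates.
Variable R : realType.
Implicit Types (a rho C : R) (d k L m n : nat).

Lemma polynomial_le_geometric d rho C : rho < 1 -> 0 <= rho ->
  exists2 k, (0 < k)%N & C * k%:R ^+ d * rho ^+ k < 1.
Proof.
move=> r1 r0.
(* [rho] may be 0, so a positive rate is substituted before taking its logarithm. *)
have [r [r0' r1' rr]] : exists r, [/\ 0 < r, r < 1 & rho <= r].
  exists (Num.max rho 2^-1); rewrite lt_max gt_max r1 le_max lexx; split=> //; last lra.
  by rewrite invr_gt0 ltr0n orbT.
set a := - ln r; have a0 : 0 < a by rewrite oppr_gt0 ln_lt0 // r0'.
have f0 : 0 < (d.+1)`!%:R :> R by rewrite ltr0n fact_gt0.
(* Bounding $e^{ak}$ below by $(ak)^{d+1}/(d+1)!$ leaves at most $D/k$. *)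
pose D := `|C| * (d.+1)`!%:R / a ^+ d.+1.
exists (Num.truncn D).+1 => //; set k := (Num.truncn D).+1.
have Dk : D < k%:R by apply: truncnS_gt.
have k0 : 0 < k%:R :> R by rewrite ltr0n.
have rk : rho ^+ k <= (d.+1)`!%:R / (a * k%:R) ^+ d.+1.
  apply: (@le_trans _ _ (r ^+ k)); first by rewrite lerXn2r ?nnegrE // ltW.
  have -> : r ^+ k = (expR (a * k%:R))^-1.
    by rewrite -expRN mulrC -mulrN /a opprK expRM_natl lnK.
  rewrite -[leRHS]invrK lef_pV2 ?posrE ?expR_gt0 ?invr_gt0 ?divr_gt0 ?exprn_gt0 ?mulr_gt0 //.
  rewrite invf_div; apply: le_trans (expR_ge1Dxn d _); last by rewrite mulr_ge0 // ltW.
  by rewrite lerDr.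
apply: (@le_lt_trans _ _ (`|C| * k%:R ^+ d * ((d.+1)`!%:R / (a * k%:R) ^+ d.+1))).
  apply: (@le_trans _ _ (`|C| * k%:R ^+ d * rho ^+ k)).
    by rewrite ler_wpM2r ?exprn_ge0 // ler_wpM2r ?exprn_ge0 // ler_norm.
  by rewrite ler_wpM2l // mulr_ge0 ?exprn_ge0.
rewrite [ltLHS](_ : _ = D / k%:R); first by rewrite ltr_pdivrMr // mul1r.
rewrite /D exprMn (exprS k%:R); field.
by rewrite !gt_eqF ?exprn_gt0.
Qed.

Lemma geometric_le_expR rho m : rho < 1 -> 0 <= rho -> (0 < m)%N ->
  exists C1 C2 : R, 0 < C1 /\ 0 < C2 /\
    forall L, 2 * rho ^+ (L %/ m) <= C2 * expR (- (C1 * L%:R)).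
Proof.
move=> r1 r0 m0.
have [r [r0' r1' rr]] : exists r, [/\ 0 < r, r < 1 & rho <= r].
  exists (Num.max rho 2^-1); rewrite lt_max gt_max r1 le_max lexx; split=> //; last lra.
  by rewrite invr_gt0 ltr0n orbT.
have m0' : 0 < m%:R :> R by rewrite ltr0n.
(* The factor $1/r$ pays for rounding down in [L %/ m]. *)
exists (- ln r / m%:R), (2 / r); split; last split.
- by rewrite divr_gt0 // oppr_gt0 ln_lt0 // r0'.
- by rewrite divr_gt0.
move=> L; rewrite -mulrA ler_pM2l //.
apply: (@le_trans _ _ (r ^+ (L %/ m))); first by rewrite lerXn2r ?nnegrE // ltW.
rewrite ler_pdivlMl // -exprS -[r in leLHS]lnK ?posrE // -expRM_natl ler_expR.
have lr : ln r < 0 by rewrite ln_lt0 // r0'.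
rewrite [leRHS](_ : _ = (L%:R / m%:R) * ln r); last by field; rewrite gt_eqF.
rewrite ler_nM2r // ler_pdivrMr // -natrM ler_nat.
by rewrite ltnW // -ltn_divLR.
Qed.

End Rates.

(** * Decay from a region with small boundary sum *)

Section Decay.
Variables (R : realType) (d : nat).
Notation Ed := (site d * 'I_d)%type.
Implicit Types (x y a o : site d) (e : Ed) (A S vs : seq (site d)) (s t : conf (site d)).
Implicit Types (b H rho p : R) (h : site d -> R) (K : site d -> R) (m L : nat).
Notation src := (@src d).
Notation dst := (@dst d).
Notation inside := (inside src dst).
Notation cut := (cut src dst).
Notation inner := (inner src dst).
Notation outer := (outer src dst).
Notation wt := (wt src dst).
Notation connR := (connR R src dst).
Notation bond := (bond R src dst).
Notation spn x := (chi R [:: x]).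
Notation plus := (@plus (site d)).

Lemma ex_radius (r : seq (site d)) :
  exists2 m : nat, (0 < m)%N & forall x, x \in r -> forall j, `|x 0 j| <= m%:Z.
Proof.
elim: r => [|x r [m m0 rm]]; first by exists 1%N.
exists (m + \sum_j absz (x 0%R j))%N; first by rewrite addn_gt0 m0.
move=> y; rewrite in_cons => /orP[/eqP ->|/rm h] j.
  by rewrite (bigD1 j) //= -abszE lez_nat addnCA leq_addr.
by apply: (le_trans (h j)); rewrite lez_nat leq_addr.
Qed.

Definition decays b H := exists C1 C2 : R, 0 < C1 /\ 0 < C2 /\
  forall L h, bimodal h -> disagreement b H h L 0 <= C2 * expR (- (C1 * L%:R)).

Lemma percolation_criterion b H p S : 0 <= b -> 0 <= H -> uniq S -> 0 \in S ->
  popen b (flipK d b H) <= p -> 0 <= p <= 1 ->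
  p * \sum_(e <- edg S | cut S e)
    perc p (inedg S) (connR (pred1 (inner S e)) 0) [::] < 1 ->
  decays b H.
Proof.
move=> b0 H0 uS S0 pp p01; have [p0 p1] := andP p01; set rho := p * _ => r1.
pose K y := \sum_(e <- edg S | cut S e && (outer S e == y))
  p * perc p (inedg S) (connR (pred1 (inner S e)) 0) [::].
have X0 e : 0 <= p * perc p (inedg S) (connR (pred1 (inner S e)) 0) [::].
  by rewrite mulr_ge0 // perc_ge0 // => l; apply: connR_ge0.
have K0 y : 0 <= K y by apply: sumr_ge0.
have Krho : \sum_(y <- bd S) K y <= rho.
  rewrite /K (exchange_big_dep (cut S)) /=; last by move=> y e _ /andP[].
  rewrite /rho mulr_sumr big_seq_cond [leRHS]big_seq_cond.
  apply: ler_sum => e /andP[eS ce].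
  rewrite (eq_bigl (fun y => y == outer S e)); last by move=> y; rewrite ce eq_sym.
  rewrite -big_filter filter_pred1_uniq ?bd_uniq ?big_seq1 // mem_bd.
  by apply/hasP; exists e => //; rewrite ce eqxx.
have rho0 : 0 <= rho by apply: le_trans Krho; apply: sumr_ge0.
have [m m0 Sm] := ex_radius (S ++ bd S).
have [C1 [C2 [C10 [C20 CE]]]] := geometric_le_expR r1 rho0 m0.
exists C1, C2; do 2 split => //; move=> L h hb; apply: le_trans (CE L).
apply: (@finite_size_criterion R d b H S m K rho) => //.
- by move=> x xS; apply: Sm; rewrite mem_cat xS.
- by move=> x xS; apply: Sm; rewrite mem_cat xS orbT.
- by move=> h' s y hb' yS; apply: influence_kernel.
Qed.

Definition mag b L : R := avg (boxs d L) (wt b (edg (boxs d L))) (spn 0) plus.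

Lemma avg_restrict vs S w (f : conf (site d) -> R) s : uniq vs -> uniq S -> {subset S <= vs} ->
  (forall r, 0 < w r) ->
  (forall r t, {in S, r =1 t} -> w r = w t /\ f r = f t) ->
  avg vs w f s = avg S w f s.
Proof.
move=> uvs uS Svs w0 loc.
have := @avg_tower _ _ vs S w w (fun=> 1) f s uvs uS Svs w0.
move=> <- //; last by move=> r; rewrite mul1r.
rewrite (eq_avg _ _ (g := fun=> avg S w f s)) ?avg_cst // => r.
apply: (@avg_wscale _ _ _ _ _ 1) => [|r' t rt _ _]; first exact: oner_neq0.
by rewrite mul1r; have [] := loc _ _ rt.
Qed.

(** Lieb's inequality is applied in translates of [S]. Its kernel involves only correlations
    interior to the region, hence is the same at every [x] and can be iterated. *)
Lemma ising_criterion b S : 0 <= b -> uniq S -> 0 \in S ->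
  tanhb b * \sum_(e <- edg S | cut S e)
    avg S (wt b (inedg S)) (fun s => spin R (s 0) * bond s e) plus < 1 ->
  exists rho m, [/\ 0 <= rho, rho < 1, (0 < m)%N & forall L, mag b L <= rho ^+ (L %/ m)].
Proof.
move=> b0 uS S0; set rho := tanhb b * _ => r1.
have t0 := tanhb_ge0 b0.
pose K e := tanhb b * avg S (wt b (inedg S)) (chi R [:: 0; inner S e]) plus.
have K0 e : 0 <= K e by apply: mulr_ge0; [exact: t0|exact: GKS1].
pose r := [seq e <- edg S | cut S e].
have KE : \sum_(e <- r) K e = rho.
  rewrite /r big_filter /rho mulr_sumr; apply: eq_bigr => e ce; congr (_ * _).
  congr (_ / _); apply: eq_isum_in => s sE.
  by rewrite chi2 (bond_io _ _ _ S) [s (outer S e)]sE ?cut_outer //= mulr1.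
have [m m0 Sm] := ex_radius (S ++ bd S).
exists rho, m; split => //; first by rewrite -KE; apply: sumr_ge0.
move=> L; rewrite -[leRHS]mul1r; set A := boxs d L.
pose pos e := if e \in r then outer S e else 0.
have inr e : e \in r -> outer S e \in bd S.
  rewrite mem_filter => /andP[ce eS]; rewrite mem_bd; apply/hasP; exists e => //.
  by rewrite ce eqxx.
apply: (@iterate_kernel R d _ r K pos 1 rho m L (fun x => avg A (wt b (edg A)) (spn x) plus)) => //.
- by rewrite KE.
- move=> e j; rewrite /pos; case: ifP => [/inr eb|_]; first by apply: Sm; rewrite mem_cat eb orbT.
  by rewrite mxE normr0.
- by move=> x; apply: avg_spn_le1 => t; apply: wt_gt0.
move=> x xL; set Sx := map (shift x) S.
have mapS z : (shift x z \in Sx) = (z \in S) by rewrite (mem_map (@shift_inj d x)).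
have SA : {subset Sx <= A}.
  move=> z /mapP[y yS ->]; rewrite mem_boxs; apply/forallP => j.
  have := xL j; have := Sm y; rewrite mem_cat yS => /(_ isT j).
  have := ler_normD (x 0 j) (y 0 j).
  rewrite /shift mxE; move: (`|x 0 j|) (`|y 0 j|) (`|_ + _|) => z1 z2 z3; lia.
have uSx : uniq Sx by rewrite map_inj_uniq // => u v; apply: shift_inj.
have xS : x \in Sx by rewrite -[x](addr0 x) mapS.
have := @simon_lieb _ _ R src dst A Sx b (edg A) x b0 (@src_neq_dst d) (boxs_uniq _ _) SA xS.
move=> h1; apply: (le_trans h1).
pose tau e : Ed := (shift x e.1, e.2).
have tau_inj : injective tau by move=> [u i] [v j] [/shift_inj -> ->].
have srct e : src (tau e) = shift x (src e) by [].
have dstt e : dst (tau e) = shift x (dst e) by rewrite /dst /shift /= addrA.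
have cutt e : cut Sx (tau e) = cut S e by rewrite /cut srct dstt !mapS.
have inst e : inside Sx (tau e) = inside S e by rewrite /inside srct dstt !mapS.
have innt e : inner Sx (tau e) = shift x (inner S e).
  by rewrite /inner srct dstt mapS; case: ifP.
have outt e : outer Sx (tau e) = shift x (outer S e).
  by rewrite /outer srct dstt mapS; case: ifP.
(* Identifies the cut and the inside bonds of the translate, as found in the cube, with translates
   of those of [S]. *)
have peP (P Q : pred Ed) : (forall e, P (tau e) = Q e) -> (forall e, P e -> e \in edg Sx) ->
    perm_eq [seq e <- edg A | P e] (map tau [seq e <- edg S | Q e]).
  move=> PQ PS; apply: uniq_perm; rewrite ?filter_uniq ?edg_uniq //.
    by rewrite (map_inj_uniq tau_inj) filter_uniq // edg_uniq.
  move=> e; rewrite mem_filter; apply/andP/mapP => [[Pe eA]|[e' + ->]].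
    have := PS e Pe; rewrite (perm_mem (edg_shift x S)) => /mapP[e' eS eE].
    by exists e' => //; rewrite mem_filter eS andbT -PQ; move: Pe; rewrite eE.
  rewrite mem_filter => /andP[Qe eS]; rewrite PQ; split => //.
  rewrite mem_edg srct dstt; move: eS; rewrite mem_edg -!mapS.
  by case/orP => /SA ->; rewrite ?orbT.
have pe_cut := peP (cut Sx) (cut S) cutt.
have pe_in := peP (inside Sx) (inside S) inst.
rewrite -big_filter (perm_big _ (pe_cut _)); last by move=> e ce; rewrite edg_cut ce orbT.
rewrite big_map le_eqVlt; apply/orP; left; apply/eqP; apply: eq_big_seq => e er.
rewrite /pos er outt; congr (_ * _ * _).
rewrite (wt_perm _ _ _ (pe_in _)); last by move=> e' ie; rewrite edg_cut ie.
rewrite -/(inedg S) innt.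
have loc (q t : conf (site d)) : {in Sx, q =1 t} ->
    wt b (map tau (inedg S)) q = wt b (map tau (inedg S)) t /\
    chi R [:: x; shift x (inner S e)] q = chi R [:: x; shift x (inner S e)] t.
  move=> qt; split.
    rewrite /wt /en !big_map; congr (expR (_ * _)); apply: eq_big_seq => e'.
    rewrite mem_filter -inst => /andP[/andP[i1 i2] _].
    by rewrite /bond !qt.
  rewrite !chi2 !qt // mapS; move: er; rewrite mem_filter => /andP[ce _].
  exact: cut_inner ce.
rewrite (avg_restrict _ (boxs_uniq _ _) uSx SA _ loc); last by move=> q; apply: wt_gt0.
have wE q : wt b (map tau (inedg S)) q = wt b (inedg S) (q \o shift x).
  rewrite /wt /en big_map; congr (expR (_ * _)); apply: eq_bigr => e' _.
  by rewrite /bond srct dstt.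
have xE : shift x 0 = x by rewrite /shift addr0.
rewrite /avg /Sx.
rewrite (isum_map (g := fun t => chi R [:: 0; inner S e] t * wt b (inedg S) t) _ _ (@shift_inj d x)); last first.
  by move=> q; rewrite wE !chi2 /= xE.
by rewrite (isum_map (g := wt b (inedg S)) _ _ (@shift_inj d x)).
Qed.

End Decay.

(** * Perturbation of the zero-field state *)

Section Small_field.
Variables (R : realType) (d : nat).
Notation Ed := (site d * 'I_d)%type.
Implicit Types (x y a o : site d) (e : Ed) (A S vs : seq (site d)) (s t : conf (site d)).
Implicit Types (b H rho p : R) (h : site d -> R) (K : site d -> R) (m L n : nat).
Notation src := (@src d).
Notation dst := (@dst d).
Notation inside := (inside src dst).
Notation cut := (cut src dst).
Notation wt := (wt src dst).
Notation bond := (bond R src dst).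
Notation spn x := (chi R [:: x]).
Notation plus := (@plus (site d)).

Lemma avg_compare vs (w w0 : conf (site d) -> R) C f s :
  (forall t, 0 < w t) -> (forall t, 0 < w0 t) -> (forall t, 0 <= f t) ->
  (forall t, w t <= C * w0 t) -> (forall t, w0 t <= C * w t) ->
  avg vs w f s <= C ^+ 2 * avg vs w0 f s.
Proof.
move=> wp w0p f0 h1 h2.
have Z : 0 < isum vs w s by apply: isum_gt0.
have Z0 : 0 < isum vs w0 s by apply: isum_gt0.
have C0 : 0 < C by have := h1 plus; have := wp plus; have := w0p plus; nra.
have A0 : 0 <= isum vs (fun t => f t * w0 t) s.
  by apply: isum_ge0 => t; rewrite mulr_ge0 // ltW.
have hA : isum vs (fun t => f t * w t) s <= C * isum vs (fun t => f t * w0 t) s.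
  by rewrite -isumZ; apply: le_isum => t; rewrite mulrCA ler_wpM2l.
have hZ : isum vs w0 s <= C * isum vs w s.
  by rewrite -isumZ; apply: le_isum.
rewrite /avg ler_pdivrMr //; apply: (le_trans hA).
move: Z Z0 A0 hZ; move: (isum _ w _) => z; move: (isum _ w0 _) => z0.
move: (isum _ _ _) => a zp z0p a0 hz.
rewrite [leRHS](_ : _ = C * (a / z0) * (C * z)); last by ring.
have -> : C * a = C * (a / z0) * z0 by rewrite -mulrA divfK ?gt_eqF.
by apply: ler_wpM2l => //; rewrite mulr_ge0 ?divr_ge0 // ltW.
Qed.

Lemma spin_flip vs b E x :
  avg vs (wt b E) (spn x) (fun=> false) = - avg vs (wt b E) (spn x) plus.
Proof.
have minusE : (fun=> false) = cxor (fun=> false) plus :> conf (site d) by [].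
have neg t : cxor (fun=> false) t =1 fun y => ~~ t y.
  by move=> y; rewrite /cxor; case: (t y).
have wn t : wt b E (cxor (fun=> false) t) = wt b E t.
  congr (expR (_ * _)); apply: eq_bigr => e _.
  by rewrite /bond !neg !spinN mulrNN.
rewrite /avg minusE -!isum_cxor -mulNr; congr (_ / _).
  by rewrite -mulN1r -isumZ; apply: eq_isum => t; rewrite wn !chi1 neg spinN mulN1r mulNr.
by apply: eq_isum => t; rewrite wn.
Qed.

(** [avg_compare] needs nonnegative observables: it is applied to $1+\sigma_0$ under plus and to
    $1-\sigma_0$ under minus, both of zero-field mean $1+m$, and the results are added. *)
Lemma disagreement_small_field b H h L : 0 <= H -> bimodal h ->
  disagreement b H h L 0 <=
  2 * (expR (2 * H * (size (boxs d L))%:R) * (1 + mag d b L) - 1).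
Proof.
move=> H0 hb; set A := boxs d L; set C := expR (H * (size A)%:R).
have Cs : expR (2 * H * (size A)%:R) = C ^+ 2.
  by rewrite -expRM_natl; congr expR; ring.
have fwC t : fw (fun x => H * h x) A t <= C /\ C^-1 <= fw (fun x => H * h x) A t.
  rewrite /C -expRN /fw !ler_expR.
  have N : `|\sum_(x <- A) H * h x * spin R (t x)| <= H * (size A)%:R.
    apply: (le_trans (ler_norm_sum _ _ _)).
    rewrite (eq_bigr (fun=> H)); last first.
      move=> x _; rewrite !normrM (ger0_norm H0).
      by case: (hb x) => ->; case: (t x); rewrite /= ?normrN !normr1 ?mulr1.
    by rewrite big_const_seq count_predT iter_addr_0 mulr_natr.
  by move: N; rewrite ler_norml => /andP[].
have C0 : 0 < C by apply: expR_gt0.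
have g0 t : 0 < gw b H h A t by apply: gw_gt0.
have w0 t : 0 < wt b (edg A) t by apply: wt_gt0.
have h1 t : gw b H h A t <= C * wt b (edg A) t.
  by rewrite /gw mulrC ler_pM2r //; have [] := fwC t.
have h2 t : wt b (edg A) t <= C * gw b H h A t.
  rewrite /gw mulrCA ler_pMr // mulrC -ler_pdivrMr // div1r.
  by have [] := fwC t.
have f0 t : 0 <= 1 + spn 0 t by have := @spin_geN1 R (t 0); rewrite chi1; lra.
have f1 t : 0 <= 1 + -1 * spn 0 t by have := @spin_le1 R (t 0); rewrite chi1; lra.
have := avg_compare A (fun=> true) g0 w0 f0 h1 h2.
have := avg_compare A (fun=> false) g0 w0 f1 h1 h2.
rewrite !avgD !avg_cst // !avgZ spin_flip -/(mag d b L).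
rewrite -/(disagreement b H h L 0) Cs /disagreement -/A.
move: (avg _ _ _ _) (avg _ _ _ _) (mag _ _ _) (C ^+ 2) => u v m c; lra.
Qed.

Lemma mag_ge0 b L : 0 <= b -> 0 <= mag d b L.
Proof. exact: GKS1. Qed.

(** The influence of a single boundary site is at most half the full disagreement times two, so a
    constant kernel slightly above [mag] satisfies the finite-size criterion. *)
Lemma small_field b L : 0 <= b -> (size (bd (boxs d L)))%:R * mag d b L < 1 ->
  exists2 H1, 0 < H1 & forall H, 0 <= H -> H < H1 -> decays d b H.
Proof.
move=> b0; set N := size (bd _); set m := mag d b L => Nm.
have m0 : 0 <= m by apply: mag_ge0.
(* Division by $N+1$ keeps $N(m+\delta)$ strictly below 1. *)
pose delta := (1 - N%:R * m) / N.+1%:R.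
have d0 : 0 < delta by rewrite divr_gt0 // subr_gt0.
set n := size (boxs d L).
have n0 : 0 < n%:R :> R.
  rewrite ltr0n -has_predT; apply/hasP; exists 0 => //.
  by rewrite mem_boxs; apply/forallP => j; rewrite mxE.
have Nd : N%:R * (m + delta) < 1.
  have : delta * N.+1%:R = 1 - N%:R * m by rewrite divfK ?pnatr_eq0.
  by rewrite -natr1; lra.
have q1 : 1 < 1 + delta / (1 + m) by rewrite ltrDl divr_gt0 // ltr_wpDr.
(* The solution $H$ of $e^{2Hn}(1+m)-1=m+\delta$. *)
exists (ln (1 + delta / (1 + m)) / (2 * n%:R)).
  by rewrite divr_gt0 ?ln_gt0 // mulr_gt0.
move=> H H0; rewrite ltr_pdivlMr ?mulr_gt0 // => HH.
have Hd : expR (2 * H * n%:R) * (1 + m) - 1 <= m + delta.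
  have : expR (2 * H * n%:R) <= 1 + delta / (1 + m).
    rewrite -[leRHS]lnK ?posrE ?(lt_trans _ q1) // ler_expR.
    by rewrite (le_trans _ (ltW HH)) // -mulrA mulrCA.
  have m1 : 0 < 1 + m by rewrite ltr_wpDr.
  move=> hh; rewrite lerBlDr; apply: (le_trans (ler_wpM2r (ltW m1) hh)).
  by rewrite mulrDl mul1r divfK ?gt_eqF //; lra.
have [r r0 Sr] := ex_radius (boxs d L ++ bd (boxs d L)).
have rho0 : 0 <= N%:R * (m + delta) by rewrite mulr_ge0 // addr_ge0 // ltW.
have [C1 [C2 [C10 [C20 CE]]]] := geometric_le_expR Nd rho0 r0.
exists C1, C2; do 2 split => //; move=> L' h hb; apply: le_trans (CE L').
apply: (@finite_size_criterion R d b H (boxs d L) r (fun=> m + delta)) => //.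
- exact: boxs_uniq.
- by rewrite mem_boxs; apply/forallP => j; rewrite mxE.
- by move=> x xS; apply: Sr; rewrite mem_cat xS.
- by move=> x xS; apply: Sr; rewrite mem_cat xS orbT.
- by move=> _; rewrite addr_ge0 // ltW.
- by rewrite big_const_seq count_predT iter_addr_0 mulr_natl.
move=> h' s y hb' _.
have om : mono (spn (0 : site d)) by move=> u v uv; rewrite !chi1 spin_mono.
have am := avg_mono (boxs_uniq d L) (lat_gw H h' (boxs d L) b0) om.
apply: (@le_trans _ _ (disagreement b H h' L 0)).
  rewrite /disagreement lerB // am // => x; rewrite ?implybT //.
apply: (le_trans (disagreement_small_field b L H0 hb')).
by rewrite ler_pM2l.
Qed.

Lemma size_bd_boxs L : (size (bd (boxs d L)) <= 2 * d * L.*2.+1 ^ d)%N.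
Proof.
have h1 A : (size (bd A) <= size (edg A))%N.
  apply: (leq_trans (size_undup _)); rewrite size_map size_filter; exact: count_size.
apply: (leq_trans (h1 _)); apply: (leq_trans (size_undup _)).
have hb : (size (boxs d L) <= L.*2.+1 ^ d)%N.
  rewrite /boxs /box; apply: (leq_trans (leq_imfset_card _ _ _)).
  by rewrite /= -cardE card_ffun !card_ord.
rewrite size_cat !size_allpairs size_enum_ord addnn -mul2n -mulnA leq_mul2l /=.
by rewrite mulnC leq_mul2l hb orbT.
Qed.

(** The exponential decay of [mag] at [b1], inherited by [b] through [ising_mono], beats the
    polynomial size of the boundary of a large cube. *)
Lemma high_temperature b b1 S : 0 <= b -> b <= b1 -> uniq S -> 0 \in S ->
  tanhb b1 * \sum_(e <- edg S | cut S e)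
    avg S (wt b1 (inedg S)) (fun s => spin R (s 0) * bond s e) plus < 1 ->
  exists2 H1, 0 < H1 & forall H, 0 <= H -> H < H1 -> decays d b H.
Proof.
move=> b0 bb uS S0 /(ising_criterion (le_trans b0 bb) uS S0)[rho [m [r0 r1 m0 mE]]].
(* The boundary of the cube of radius $km$ has at most $2d(2km+1)^d\le 2d(2m+1)^dk^d$ sites. *)
have [k k0 kE] := polynomial_le_geometric d ((2 * d)%:R * (m.*2.+1 ^ d)%:R) r1 r0.
apply: (small_field (L := (k * m)%N)) => //.
apply: le_lt_trans kE.
have mk : mag d b (k * m) <= rho ^+ k.
  by rewrite (le_trans (ising_mono _ _ _ _ _ b0 bb)) // -[in leRHS](mulnK k m0) mE.
apply: ler_pM; rewrite ?mag_ge0 // -natrX -!natrM ler_nat.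
apply: (leq_trans (size_bd_boxs _)); rewrite -[leqRHS]mulnA leq_mul2l -expnMn; apply/orP; right.
case: (d) => // d'; rewrite leq_exp2r //; nia.
Qed.

End Small_field.

(** * The finite-volume Gibbs measures *)

Section Finite_functions.
Variables (R : realType) (I : finType) (T : eqType) (tau : I -> T).
Variables (f : conf T -> R) (glue : {ffun I -> bool} -> conf T).
Hypothesis glue_upd : forall (s : {ffun I -> bool}) v c,
  glue [ffun i => if i == v then c else s i] = upd (glue s) (tau v) c.

Lemma isum_ffun (s0 : {ffun I -> bool}) :
  isum [seq tau i | i <- enum I] f (glue s0) = \sum_(s : {ffun I -> bool}) f (glue s).
Proof.
have gen vs : uniq vs -> forall s0 : {ffun I -> bool}, isum (map tau vs) f (glue s0) =
    \sum_(s : {ffun I -> bool} | [forall i, (i \notin vs) ==> (s i == s0 i)]) f (glue s).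
  elim: vs => [_ s1|v vs IH /andP[vn uvs] s1].
    rewrite (eq_bigl (fun s => s == s1)) ?big_pred1_eq // => s.
    by apply/forallP/eqP => [h|-> i]; [apply/ffunP => i; apply/eqP; apply: h|rewrite eqxx].
  rewrite /= -!glue_upd !IH // [RHS](bigID (fun s : {ffun I -> bool} => s v)) /=.
  congr (_ + _); apply: eq_bigl => s.
    apply/forallP/andP => [h|[/forallP h sv] i].
      split; last by move: (h v); rewrite vn ffunE eqxx => /eqP.
      apply/forallP => i; apply/implyP; rewrite in_cons negb_or => /andP[iv ivs].
      by move: (h i); rewrite ivs ffunE (negbTE iv).
    apply/implyP => ivs; rewrite ffunE; case: (i =P v) => [->|/eqP iv]; first by rewrite sv.
    by move: (h i); rewrite in_cons negb_or iv ivs.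
  apply/forallP/andP => [h|[/forallP h sv] i].
    split; last by move: (h v); rewrite vn ffunE eqxx => /eqP ->.
    apply/forallP => i; apply/implyP; rewrite in_cons negb_or => /andP[iv ivs].
    by move: (h i); rewrite ivs ffunE (negbTE iv).
  apply/implyP => ivs; rewrite ffunE; case: (i =P v) => [->|/eqP iv]; first by rewrite (negbTE sv).
  by move: (h i); rewrite in_cons negb_or iv ivs.
rewrite gen ?enum_uniq //; apply: eq_bigl => s.
by apply/forallP => i; rewrite mem_enum.
Qed.

End Finite_functions.

Section Gibbs.
Variables (R : realType) (d : nat).
Notation Ed := (site d * 'I_d)%type.
Implicit Types (x y : site d) (e : Ed) (t : conf (site d)).
Notation src := (@src d).
Notation dst := (@dst d).
Notation step := (@delta_mx int 1 d 0).

Definition steps : seq (site d) :=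
  [seq step i | i <- enum 'I_d] ++ [seq - step i | i <- enum 'I_d].

Lemma step_inj : injective step.
Proof.
move=> i j /rowP/(_ i); rewrite !mxE !eqxx /=.
by case: eqP.
Qed.

Lemma steps_uniq : uniq steps.
Proof.
have step_injN : injective (fun i => - step i).
  by move=> i j /(congr1 (fun v => - v)); rewrite !opprK => /step_inj.
rewrite cat_uniq (map_inj_uniq step_inj) (map_inj_uniq step_injN) !enum_uniq andbT /=.
apply/hasPn => _ /mapP[i _ ->]; apply/negP => /mapP[j _ /rowP/(_ i)].
by rewrite !mxE !eqxx /=; case: eqP.
Qed.

Lemma mem_steps x : (x \in steps) = (x \in unit_steps d).
Proof.
rewrite mem_cat in_fsetU; congr (_ || _); apply/mapP/imfsetP => -[i _ ->];
  by exists i; rewrite ?mem_enum.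
Qed.

Lemma sum_nn (Y : seq (site d)) x (G : site d -> R) : uniq Y ->
  \sum_(y <- Y | nn x y) G y =
  \sum_(i < d) (if x + step i \in Y then G (x + step i) else 0) +
  \sum_(i < d) (if x - step i \in Y then G (x - step i) else 0).
Proof.
move=> uY.
transitivity (\sum_(z <- steps) (if x + z \in Y then G (x + z) else 0)).
  rewrite -big_mkcond -[RHS](big_map (fun z => x + z) (fun y => y \in Y) G).
  rewrite -[LHS]big_filter -[RHS]big_filter; apply: perm_big.
  apply: uniq_perm; rewrite ?filter_uniq // ?(map_inj_uniq (@addrI _ x)) ?steps_uniq //.
  move=> y; rewrite !mem_filter nn_unit_steps -mem_steps andbC; congr (_ && _).
  by rewrite -[X in _ = (X \in _)](subrK x) [X in _ = (X \in _)]addrC (mem_map (@addrI _ x)).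
by rewrite big_cat !big_map -!big_enum.
Qed.

(** Each bond is charged to its source if that lies in [A], and otherwise to its target. *)
Lemma sum_edg (A : seq (site d)) (F : Ed -> R) : uniq A ->
  \sum_(e <- edg A) F e = \sum_(x <- A) \sum_(i < d) F (x, i) +
   \sum_(x <- A) \sum_(i < d) (if x - step i \in A then 0 else F (x - step i, i)).
Proof.
move=> uA.
pose E1 := [seq (x, i) | x <- A, i <- enum 'I_d].
pose E2 := [seq e <- [seq (x - step i, i) | x <- A, i <- enum 'I_d] | e.1 \notin A].
have pe : perm_eq (edg A) (E1 ++ E2).
  apply: uniq_perm; first exact: edg_uniq.
    rewrite cat_uniq; apply/and3P; split.
    - by rewrite allpairs_uniq ?enum_uniq // => -[? ?] [? ?].
    - apply/hasPn => e; rewrite mem_filter => /andP[en _]; apply/negP.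
      by case/allpairsP => -[x i] /= [xA _ eE]; rewrite eE xA in en.
    rewrite filter_uniq // allpairs_uniq ?enum_uniq // => -[x i] [y j] _ _ /= [].
    by move=> h ij; move: h; rewrite ij => /(congr1 (fun z => z + step j)); rewrite !subrK => ->.
  move=> e; rewrite mem_edg mem_cat mem_filter /src /dst; case: e => x i /=.
  have -> : ((x, i) \in E1) = (x \in A).
    apply/allpairsP/idP => [[[y j] /= [yA _ [-> _]]]//|xA].
    by exists (x, i); rewrite xA mem_enum.
  case: (boolP (x \in A)) => //= xn; apply/idP/allpairsP => [xA|[[y j] /= [yA _ [-> ->]]]].
    by exists (x + step i, i); rewrite xA mem_enum addrK.
  by rewrite subrK.
rewrite (perm_big _ pe) big_cat; congr (_ + _).
  rewrite big_allpairs_dep; by apply: eq_bigr => x _; rewrite big_enum.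
rewrite big_filter big_mkcond big_allpairs_dep; apply: eq_bigr => x _ /=.
rewrite big_enum; apply: eq_bigr => i _; by case: (_ \in _).
Qed.

Variables (L : nat) (h : box d L -> R) (eta : spins (ex_boundary (box d L))).
Notation Lam := (box d L).
Notation A := (boxs d L).

(** The default 1 keeps the extension bimodal. *)
Definition extend_field x : R := if insub x is Some u then h u else 1.

(** The default [true] extends the all-plus boundary condition to [plus]. *)
Definition extend_bc x : bool := if insub x is Some u then eta u else true.

Definition glue (s : spins Lam) : conf (site d) :=
  fun x => if insub x is Some u then s u else extend_bc x.

Lemma glue_in s (u : Lam) : glue s (val u) = s u.
Proof. by rewrite /glue valK. Qed.

Lemma glue_bd s (v : ex_boundary Lam) : glue s (val v) = eta v.
Proof.
rewrite /glue insubF; first by rewrite /extend_bc valK.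
by have := fsvalP v; rewrite mem_ex_boundary => /andP[/negbTE].
Qed.

Lemma gibbs_weight_gw b H s :
  gibbs_weight h eta b H s = gw b H extend_field A (glue s).
Proof.
rewrite /gibbs_weight /gw /wt /fw -expRD; congr (expR _).
set t := glue s; pose G x y : R := spin R (t x) * spin R (t y).
have -> : \sum_(x <- A) H * extend_field x * spin R (t x) =
    H * \sum_(u : Lam) h u * spin R (s u).
  rewrite big_seq_fsetE mulr_sumr; apply: eq_bigr => u _.
  by rewrite /extend_field valK /t glue_in mulrA.
congr (_ + _); rewrite -mulrDr; congr (_ * _).
have -> : \sum_(u : Lam) \sum_(v : Lam | nn (val u) (val v)) spin R (s u) * spin R (s v) =
    \sum_(x <- A) \sum_(y <- A | nn x y) G x y.
  rewrite big_seq_fsetE; apply: eq_bigr => u _; rewrite big_seq_fsetE.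
  by apply: eq_bigr => v _; rewrite /G /t !glue_in.
have -> : \sum_(u : Lam) \sum_(v : ex_boundary Lam | nn (val u) (val v)) spin R (s u) * spin R (eta v) =
    \sum_(x <- A) \sum_(y <- enum_fset (ex_boundary Lam) | nn x y) G x y.
  rewrite big_seq_fsetE; apply: eq_bigr => u _; rewrite big_seq_fsetE.
  by apply: eq_bigr => v _; rewrite /G /t glue_in glue_bd.
under eq_bigr do rewrite sum_nn ?boxs_uniq //.
rewrite big_split /=.
under [X in _ + X = _]eq_bigr do rewrite sum_nn ?fset_uniq //.
rewrite big_split /= /en sum_edg ?boxs_uniq //.
pose bdL := enum_fset (ex_boundary Lam).
(* [P] collects ordered pairs inside the cube, [Q] pairs across its boundary and [W] the bonds of
   [edg]; 1 stands for forward steps, 2 for backward ones. Reversing pairs gives [P1 = P2], which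
   cancels the factor one half. *)
pose P1 := \sum_(x <- A) \sum_(i < d) (if x + step i \in A then G x (x + step i) else 0).
pose P2 := \sum_(x <- A) \sum_(i < d) (if x - step i \in A then G x (x - step i) else 0).
pose Q1 := \sum_(x <- A) \sum_(i < d) (if x + step i \in bdL then G x (x + step i) else 0).
pose Q2 := \sum_(x <- A) \sum_(i < d) (if x - step i \in bdL then G x (x - step i) else 0).
pose W1 := \sum_(x <- A) \sum_(i < d) bond R src dst t (x, i).
pose W2 := \sum_(x <- A) \sum_(i < d)
  (if x - step i \in A then 0 else bond R src dst t (x - step i, i)).
rewrite -[LHS]/(2^-1 * (P1 + P2) + (Q1 + Q2)) -[RHS]/(W1 + W2).
have bdE x y : x \in A -> nn x y -> (y \in ex_boundary Lam) = (y \notin A).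
  move=> xA xy; rewrite mem_ex_boundary andbC; case: existsP => //= -[].
  by exists [` xA]%fset.
have nnp x i : nn x (x + step i).
  by rewrite nn_unit_steps addrC addKr -mem_steps mem_cat map_f ?mem_enum.
have nnm x i : nn x (x - step i).
  rewrite nn_unit_steps addrC addKr -mem_steps mem_cat; apply/orP; right.
  by apply/mapP; exists i; rewrite ?mem_enum.
have W1E : W1 = P1 + Q1.
  rewrite /W1 /P1 /Q1 -big_split; apply: eq_big_seq => x xA /=.
  rewrite -big_split; apply: eq_bigr => i _ /=.
  rewrite (bdE _ _ xA (nnp x i)) /bond /src /dst /=.
  by case: (_ \in _); rewrite ?addr0 ?add0r.
have W2E : W2 = Q2.
  rewrite /W2 /Q2; apply: eq_big_seq => x xA; apply: eq_bigr => i _.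
  rewrite (bdE _ _ xA (nnm x i)) /bond /src /dst /= subrK /G mulrC.
  by case: (_ \in _).
have P12 : P1 = P2.
  rewrite /P1 /P2 exchange_big [RHS]exchange_big; apply: eq_bigr => i _ /=.
  rewrite -big_mkcond -[RHS]big_mkcond -big_filter -[RHS]big_filter.
  have pe : perm_eq [seq x <- A | x - step i \in A] (map (fun x => x + step i) [seq x <- A | x + step i \in A]).
    apply: uniq_perm; rewrite ?filter_uniq ?boxs_uniq // ?map_inj_uniq ?filter_uniq ?boxs_uniq //.
      exact: addIr.
    move=> x; rewrite mem_filter -[X in _ = (X \in map _ _)](subrK (step i)) (mem_map (@addIr _ (step i))).
    by rewrite mem_filter subrK andbC.
  rewrite (perm_big _ pe) big_map; apply: eq_bigr => x _.
  by rewrite addrK /G mulrC.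
rewrite W1E W2E -P12; lra.
Qed.

Lemma mean_spin0_avg b H :
  mean_spin0 h eta b H = avg A (gw b H extend_field A) (chi R [:: 0]) extend_bc.
Proof.
have vu (s : spins Lam) v c : glue [ffun i => if i == v then c else s i] = upd (glue s) (val v) c.
  apply/funext => x; rewrite /glue /upd; case: insubP => [u xL <-|xn].
    by rewrite ffunE (inj_eq val_inj).
  by case: eqP xn => // ->; rewrite fsvalP.
have pe : perm_eq A [seq val i | i <- enum {: Lam}].
  by rewrite /boxs enum_fsetE perm_refl.
have sumE (F : conf (site d) -> R) : isum A F extend_bc = \sum_(s : spins Lam) F (glue s).
  rewrite (isum_perm _ _ (boxs_uniq _ _) pe) -(isum_ffun F vu [ffun=> true]).
  apply: isum_base => x xn; rewrite /glue insubF //.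
  by apply: contraNF xn => xL; apply/mapP; exists [` xL]%fset; rewrite ?mem_enum.
rewrite /mean_spin0 /gibbs_mean /gibbs_prob /avg !sumE.
under eq_bigr do rewrite mulrA.
rewrite -mulr_suml; congr (_ / _); last by apply: eq_bigr => s _; exact: gibbs_weight_gw.
apply: eq_bigr => s _; rewrite gibbs_weight_gw chi1; congr (spin R _ * _).
by rewrite -(glue_in s (origin d L)).
Qed.

End Gibbs.

Section Restriction.
Variables (R : realType) (d : nat).
Notation Ed := (site d * 'I_d)%type.
Implicit Types (e : Ed) (A S : seq (site d)).

Lemma filter_edg A S (P : pred Ed) : {subset S <= A} -> (forall e, P e -> e \in edg S) ->
  perm_eq [seq e <- edg A | P e] [seq e <- edg S | P e].
Proof.
move=> SA PS; apply: uniq_perm; rewrite ?filter_uniq ?edg_uniq // => e.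
rewrite !mem_filter; case Pe: (P e) => //=; rewrite PS //.
move: (PS e Pe); rewrite !mem_edg.
by case/orP => /SA ->; rewrite ?orbT.
Qed.

End Restriction.

(** * The critical inverse temperature *)

Section Critical_temperature.
Variables (R : realType) (d : nat).
Implicit Types (b : R) (L : nat) (S : seq (site d)).
Notation src := (@src d).
Notation dst := (@dst d).
Notation cut := (cut src dst).
Notation wt := (wt src dst).
Notation bond := (bond R src dst).
Notation plus := (@plus (site d)).

Lemma gw0 b h A s : gw b 0 h A s = wt b (edg A) s.
Proof.
by rewrite /gw /fw big1 ?expR0 ?mulr1 // => x _; rewrite !mul0r.
Qed.

Lemma mean_spin0_mag b L :
  @mean_spin0 R d L (fun=> 0) [ffun=> true] b 0 = mag d b L.
Proof.
rewrite mean_spin0_avg /mag.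
have -> : extend_bc ([ffun=> true] : spins (ex_boundary (box d L))) = plus.
  by apply/funext => x; rewrite /extend_bc; case: insub => // u; rewrite ffunE.
by congr (avg _ _ _ _); apply/funext => s; rewrite gw0.
Qed.

(** In the larger cube, the small cube sees a random boundary condition, dominated by plus. *)
Lemma mag_nonincreasing b : 0 <= b -> nonincreasing_seq (mag (R := R) d b).
Proof.
move=> b0 L L' LL; rewrite /mag.
have sub : {subset boxs d L <= boxs d L'}.
  move=> x; rewrite !mem_boxs => /forallP h; apply/forallP => i.
  by apply: (le_trans (h i)); rewrite lez_nat.
have gE A : gw b 0 (fun=> 1) A = wt b (edg A) by apply/funext => s; rewrite gw0.
rewrite -!gE -(gw_tower b 0 (fun=> 1) _ _ (boxs_uniq d L') (boxs_uniq d L) sub).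
set m := avg (boxs d L) _ _ plus.
have g0 (A : seq (site d)) t : 0 < gw b 0 (fun=> 1) A t by apply: gw_gt0.
rewrite -[leRHS](@avg_cst _ _ (boxs d L') _ m plus (g0 (boxs d L'))).
apply: le_avg => // t.
apply: (avg_mono (boxs_uniq d L) (lat_gw 0 (fun=> 1) (boxs d L) b0)).
  by move=> u v uv; rewrite !chi1 spin_mono.
by move=> x; exact: implybT.
Qed.

Lemma magnetization_ge b c : 0 <= b -> (forall L, c <= mag d b L) -> c <= magnetization d b.
Proof.
move=> b0 cm; rewrite /magnetization.
have -> : (fun L => @mean_spin0 R d L (fun=> 0) [ffun=> true] b 0) = mag d b.
  by apply/funext => L; exact: mean_spin0_mag.
apply: limr_ge; last by apply: nearW.
apply: nonincreasing_is_cvgn; first exact: mag_nonincreasing.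
by exists c => _ [L _ <-].
Qed.

(** If the criterion failed on a whole interval from [b] to some [b2] below [beta_c], saturation
    would give $m\ge 1-e^{b-b2}>0$ at [b2] in all cubes. It therefore holds somewhere in the
    interval, whence the existential [b1]. *)
Lemma beta_c_criterion b : 0 <= b -> (b%:E < beta_c R d)%E ->
  exists b1 S, [/\ b <= b1, uniq S, 0 \in S &
  tanhb b1 * \sum_(e <- edg S | cut S e)
    avg S (wt b1 (inedg S)) (fun s => spin R (s 0) * bond s e) plus < 1].
Proof.
move=> b0 bc.
have [b2 bb2 b2c] : exists2 b2, b < b2 & (b2%:E < beta_c R d)%E.
  case: (beta_c R d) bc => [r|_|//].
    by rewrite lte_fin => br; exists ((b + r) / 2); rewrite ?lte_fin; lra.
  by exists (b + 1); rewrite ?ltry //; lra.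
apply: contrapT => H.
have mag2 L : 1 - expR (b - b2) <= mag d b2 L.
  apply: ising_saturation => //; rewrite ?boxs_uniq ?edg_uniq ?(ltW bb2) //.
  move=> x S /andP[bx xb2] uS SA S0.
  have x0 := le_trans b0 bx.
  have t0 := tanhb_ge0 x0; have t1 := tanhb_le1 x.
  (* The negated criterion carries the factor [tanhb x], at most 1, so the bare boundary sum is at
     least 1 too. *)
  have : ~~ (tanhb x * \sum_(e <- edg S | cut S e)
    avg S (wt x (inedg S)) (fun s => spin R (s 0) * bond s e) plus < 1).
    by apply/negP => h; apply: H; exists x, S.
  rewrite -leNgt.
  rewrite -big_filter -[in X in _ -> X]big_filter.
  rewrite (perm_big _ (filter_edg SA (P := cut S) _)); last by move=> e ce; rewrite edg_cut ce orbT.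
  rewrite (wt_perm _ _ _ (filter_edg SA (P := inside src dst S) _)); last by move=> e ie; rewrite edg_cut ie.
  rewrite -/(inedg S); set X := \sum_(_ <- _) _ => h.
  have X0 : 0 <= X.
    rewrite leNgt; apply/negP => X0.
    have : tanhb x * X <= 0 by rewrite mulr_ge0_le0 // ltW.
    lra.
  by apply: (le_trans h); rewrite ler_piMl.
have m2 : 0 < magnetization d b2.
  apply: lt_le_trans (magnetization_ge (le_trans b0 (ltW bb2)) mag2).
  by rewrite subr_gt0 -[ltRHS]expR0 ltr_expR subr_lt0.
have : (beta_c R d <= b2%:E)%E.
  by apply: ereal_inf_lbound; exists b2 => //; split => //; rewrite (le_trans b0) // ltW.
by rewrite leNgt b2c.
Qed.

End Critical_temperature.

(** * The percolation threshold *)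

Section Percolation_threshold.
Variables (R : realType) (d : nat).
Notation Ed := (site d * 'I_d)%type.
Implicit Types (p : R) (L : nat) (S A : seq (site d)) (e : Ed) (D E l : seq Ed) (w : edge_config d).
Notation src := (@src d).
Notation dst := (@dst d).
Notation cut := (cut src dst).
Notation inner := (inner src dst).
Notation connR := (connR R src dst).
Notation conn := (conn src dst).

Definition cylinder (D : seq Ed) (c : Ed -> bool) : set (edge_config d) :=
  [set w | forall e, e \in D -> w e = c e].

Lemma measurable_coordinate e c : measurable [set w : edge_config d | w e = c].
Proof.
have m1 : measurable [set w : edge_config d | w e].
  by apply: sub_sigma_algebra; exists e.
case: c; first exact: m1.
have -> : [set w : edge_config d | w e = false] = ~` [set w : edge_config d | w e].
  by apply/seteqP; split => w /=; case: (w e).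
exact: measurableC.
Qed.

Lemma measurable_cylinder D c : measurable (cylinder D c).
Proof.
elim: D => [|e D IH].
  have -> : cylinder [::] c = setT by apply/seteqP; split.
  exact: measurableT.
have -> : cylinder (e :: D) c = [set w : edge_config d | w e = c e] `&` cylinder D c.
  apply/seteqP; split => w /=.
    by move=> h; split; [apply: h; rewrite mem_head|move=> e' eD; apply: h; rewrite in_cons eD orbT].
  by move=> [h1 h2] e'; rewrite in_cons => /orP[/eqP ->|/h2].
by apply: measurableI => //; apply: measurable_coordinate.
Qed.

Lemma cylinder_prob p (P : probability (edge_config d) R) D c : bernoulli_percolation p P ->
  uniq D -> P (cylinder D c) = (\prod_(e <- D) (if c e then p else 1 - p))%:E.
Proof.
move=> bP uD.
have pe : perm_eq [fset e in D]%fset D.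
  by apply: uniq_perm; rewrite ?fset_uniq // => e; rewrite inE.
rewrite -(perm_big _ pe) /= -bP; congr (P _).
by apply/seteqP; split => w /= h e; [rewrite inE; apply: h|move=> eD; apply: h; rewrite inE].
Qed.

Definition set_invariant (Q : seq Ed -> Prop) := forall l l', l =i l' -> Q l -> Q l'.

(** Follows the recursion of [perc]: the bonds of [D] have been revealed with states [c], those of
    [E] are still random. *)
Definition local_event (Q : seq Ed -> Prop) D E c : set (edge_config d) :=
  cylinder D c `&` [set w | Q ([seq e <- E | w e] ++ [seq e <- D | c e])].

Lemma local_eventS Q D e E c : set_invariant Q -> e \notin D ->
  local_event Q D (e :: E) c =
  local_event Q (e :: D) E (fun e' => if e' == e then true else c e') `|`
  local_event Q (e :: D) E (fun e' => if e' == e then false else c e').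
Proof.
move=> Qi eD.
have ne e' : e' \in D -> (e' == e) = false.
  by move=> e'D; apply/negbTE; apply: contraNneq eD => <-.
have cylE x w : cylinder (e :: D) (fun e' => if e' == e then x else c e') w <->
    w e = x /\ cylinder D c w.
  split=> [h|[h1 h2] e'].
    split; first by rewrite h ?mem_head // eqxx.
    by move=> e' eD'; rewrite h ?in_cons ?eD' ?orbT // ne.
  rewrite in_cons => /orP[/eqP ->|eD']; first by rewrite eqxx.
  by rewrite ne // h2.
have listE x (w : edge_config d) : w e = x ->
    [seq e' <- e :: E | w e'] ++ [seq e' <- D | c e'] =i
    [seq e' <- E | w e'] ++ [seq e' <- e :: D | if e' == e then x else c e'].
  move=> wx e'; rewrite !mem_cat !mem_filter !in_cons.
  case: (e' =P e) => [->|_] /=; last by [].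
  rewrite wx (negbTE eD) andbF orbF andbT. by case: x {wx} => //=; rewrite orbT.
apply/seteqP; split => w.
  move=> [cD q]; case we : (w e); [left|right]; split; try by apply/cylE.
    exact: (Qi _ _ (listE true w we)).
  exact: (Qi _ _ (listE false w we)).
case=> -[/cylE[we cD] q]; split=> //; apply: Qi q => e'; by rewrite (listE _ w we).
Qed.

Lemma measurable_local_event Q D E c : set_invariant Q -> uniq (D ++ E) ->
  measurable (local_event Q D E c).
Proof.
move=> Qi; elim: E D c => [|e E IH] D c u.
  rewrite /local_event /=.
  case: (pselect (Q [seq e <- D | c e])) => q.
    have -> : [set _ | Q [seq e <- D | c e]] = [set: edge_config d] by apply/seteqP; split.
    by rewrite setIT; apply: measurable_cylinder.
  have -> : [set _ | Q [seq e <- D | c e]] = set0 :> set (edge_config d) by apply/seteqP; split.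
  by rewrite setI0.
have eD : e \notin D.
  by move: u; rewrite -cat_rcons cat_uniq rcons_uniq => /andP[/andP[]].
have u' : uniq ((e :: D) ++ E).
  by move: u; rewrite -cat1s uniq_catCA.
by rewrite local_eventS //; apply: measurableU; apply: IH.
Qed.

(** Revealing the bonds of [E] one at a time reduces the event to cylinders, whose probabilities are
    what [bernoulli_percolation] prescribes. *)
Lemma local_event_prob p (P : probability (edge_config d) R) Q D E c :
  bernoulli_percolation p P -> set_invariant Q -> uniq (D ++ E) ->
  P (local_event Q D E c) = (\prod_(e <- D) (if c e then p else 1 - p) *
    perc p E (fun l => (`[< Q l >])%:R) [seq e <- D | c e])%:E.
Proof.
move=> bP Qi; elim: E D c => [|e E IH] D c u.
  rewrite /local_event /=; case: asboolP => q.
    have -> : [set _ | Q [seq e <- D | c e]] = [set: edge_config d] by apply/seteqP; split.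
    rewrite setIT mulr1; apply: cylinder_prob => //.
    by move: u; rewrite cats0.
  have -> : [set _ | Q [seq e <- D | c e]] = set0 :> set (edge_config d) by apply/seteqP; split.
  by rewrite setI0 mulr0 measure0.
have eD : e \notin D.
  by move: u; rewrite -cat_rcons cat_uniq rcons_uniq => /andP[/andP[]].
have u' : uniq ((e :: D) ++ E).
  by move: u; rewrite -cat1s uniq_catCA.
have ne e' : e' \in D -> (e' == e) = false.
  by move=> e'D; apply/negbTE; apply: contraNneq eD => <-.
rewrite local_eventS //; set X1 := local_event _ _ _ _; set X2 := local_event _ _ _ _.
have -> : P (X1 `|` X2) = (P X1 + P X2)%E.
  apply: measureU; try exact: measurable_local_event.
  apply/seteqP; split => // w [[h1 _] [h2 _]].
  have := h1 e (mem_head _ _); have := h2 e (mem_head _ _).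
  by rewrite eqxx => -> .
rewrite /X1 /X2.
rewrite !IH //= -EFinD !big_cons eqxx; congr (_%:E).
have E1 x : \prod_(e' <- D) (if (if e' == e then x else c e') then p else 1 - p) =
    \prod_(e' <- D) (if c e' then p else 1 - p).
  by apply: eq_big_seq => e' /ne ->.
have E2 x : [seq e' <- D | if e' == e then x else c e'] = [seq e' <- D | c e'].
  by apply: eq_in_filter => e' /ne ->.
rewrite !E1 !E2; ring.
Qed.

Definition opened w E := [seq e <- E | w e].

Definition exits L : set (edge_config d) :=
  [set w | conn (tgt (boxs d L)) (opened w (edg (boxs d L))) 0].

Lemma conn_set_invariant C o : set_invariant (fun l => conn C l o).
Proof. by move=> l l' ll; apply: conn_sub => // e; rewrite ll. Qed.

Lemma exits_local L : exits L =
  local_event (fun l => conn (tgt (boxs d L)) l 0) [::] (edg (boxs d L)) (fun=> false).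
Proof.
by apply/seteqP; split => w; rewrite /local_event /exits /opened /= cats0;
  [move=> h; split|case].
Qed.

Lemma measurable_exits L : measurable (exits L).
Proof.
rewrite exits_local; apply: measurable_local_event; last exact: edg_uniq.
exact: conn_set_invariant.
Qed.

Lemma exits_prob p (P : probability (edge_config d) R) L : bernoulli_percolation p P ->
  P (exits L) = (perc p (edg (boxs d L)) (connR (tgt (boxs d L)) 0) [::])%:E.
Proof.
move=> bP; rewrite exits_local (local_event_prob _ bP) ?edg_uniq ?big_nil ?mul1r //.
exact: conn_set_invariant.
Qed.

(** Up to its first exit, an open path from the origin uses only bonds touching the cube. *)
Lemma exitsP L w : exits L w <-> exists2 y, cluster w 0 y & y \notin boxs d L.
Proof.
rewrite /exits /=; set A := boxs d L; split.
  elim=> [x xA|e + _ [y [q [qp qy]] yA]|e + _ [y [q [qp qy]] yA]].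
  - by exists x => //; exists [::].
  - rewrite mem_filter => /andP[we _]; exists y => //; exists (dst e :: q); split => //=.
    rewrite qp andbT; apply/existsP; exists e.2; rewrite /dst /src eqxx /=.
    by apply/orP; left; rewrite -surjective_pairing.
  - rewrite mem_filter => /andP[we _]; exists y => //; exists (src e :: q); split => //=.
    rewrite qp andbT; apply/existsP; exists e.2; apply/orP; right.
    by rewrite /dst /src eqxx /= -surjective_pairing.
case=> y [q [qp qy]] yA; move: qp qy; move: (0 : site d) => x.
elim: q x => [|z q IH] x /=; first by move=> _ xy; apply: conn_in; rewrite /tgt xy.
case/andP => /existsP[i xz] qp qy; have cz := IH z qp qy.
case: (boolP (x \in A)) => [xA|xn]; last exact: conn_in.
case/orP: xz => /andP[/eqP E we].
  have eA : (x, i) \in opened w (edg A) by rewrite mem_filter we mem_edg /src xA.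
  have := conn_fwd (e1 := src) (e2 := dst) (C := tgt A) eA.
  by rewrite /src /dst /= -E; apply.
have eA : (z, i) \in opened w (edg A) by rewrite mem_filter we mem_edg /dst /= -E xA orbT.
have := conn_bwd (e1 := src) (e2 := dst) (C := tgt A) eA.
by rewrite /src /dst /= -E; apply.
Qed.

Lemma bigcap_exits : \bigcap_L exits L = [set w | infinite_set (cluster w 0)].
Proof.
apply/seteqP; split => w.
  move=> h fin; have [r rE] := (finite_seqP _).1 fin.
  have [m _ mr] := ex_radius r.
  have [y yc] := (exitsP m w).1 (h m I).
  rewrite rE in yc; rewrite mem_boxs => /negP; apply; apply/forallP => j; exact: mr.
move=> inf L _; apply/exitsP; apply: contrapT => H; apply: inf.
apply: (sub_finite_set (B := [set` boxs d L])); last exact: finite_seq.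
by move=> y yc /=; apply: contrapT => /negP yn; apply: H; exists y.
Qed.

Lemma exits_nonincreasing : nonincreasing_seq exits.
Proof.
move=> L L' LL; apply/subsetPset => w /exitsP[y yc yL]; apply/exitsP; exists y => //.
apply: contra yL; rewrite !mem_boxs => /forallP h; apply/forallP => i.
by apply: (le_trans (h i)); rewrite lez_nat.
Qed.

(** Continuity from above: the events [exits L] decrease to the event of an infinite cluster, so a
    lower bound uniform in [L] survives in the limit. *)
Lemma exits_prob_ge0 p (P : probability (edge_config d) R) c : bernoulli_percolation p P ->
  P [set w | infinite_set (cluster w 0)] = 0%E ->
  (forall L, c <= perc p (edg (boxs d L)) (connR (tgt (boxs d L)) 0) [::]) -> c <= 0.
Proof.
move=> bP P0 cL.
have mI : measurable (\bigcap_L exits L) by apply: bigcap_measurable => // k _; exact: measurable_exits.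
have PI : P (\bigcap_L exits L) = 0%E by rewrite bigcap_exits.
have cv : P \o exits @ \oo --> P (\bigcap_L exits L).
  apply: nonincreasing_cvg_mu => //; [|exact: measurable_exits|exact: exits_nonincreasing].
  suff : (P (exits 0%N) < +oo)%E by [].
  by rewrite (exits_prob _ bP) ltry.
suff : (c%:E <= P (\bigcap_L exits L))%E by rewrite PI lee_fin.
rewrite -(cvg_lim _ cv) //.
apply: lime_ge; first exact: cvgP cv.
by apply: nearW => L /=; rewrite (exits_prob _ bP) lee_fin.
Qed.

Lemma p_c_criterion p : 0 <= p -> p < p_c_bond R d ->
  exists q S, [/\ p <= q, q <= 1, uniq S, 0 \in S &
  q * \sum_(e <- edg S | cut S e)
    perc q (inedg S) (connR (pred1 (inner S e)) 0) [::] < 1].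
Proof.
move=> p0; rewrite /p_c_bond; set X := [set _ | _] => pX.
(* The supremum of the empty set is 0, which is not above [p]. *)
have X0 : X !=set0.
  apply/set0P; apply: contraTneq pX => ->; rewrite sup0 -leNgt //.
have [p2 [/andP[p20 p21] [P bP P0]] pp2] := sup_gt X0 pX.
apply: contrapT => H.
suff h : 1 - expR (p - p2) <= 0.
  move: h; rewrite subr_le0 -[leLHS]expR0 ler_expR subr_ge0; rewrite leNgt pp2 //.
apply: (exits_prob_ge0 bP P0) => L.
apply: perc_saturation => //; rewrite ?boxs_uniq ?edg_uniq ?(ltW pp2) //.
move=> x S /andP[bx xb2] uS SA S0.
have x0 := le_trans p0 bx; have x1 := le_trans xb2 p21.
have x01 : 0 <= x <= 1 by rewrite x0.
have : ~~ (x * \sum_(e <- edg S | cut S e)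
    perc x (inedg S) (connR (pred1 (inner S e)) 0) [::] < 1).
  by apply/negP => h; apply: H; exists x, S.
rewrite -leNgt.
rewrite -big_filter -[in X in _ -> X]big_filter.
rewrite (perm_big _ (filter_edg SA (P := cut S) _)); last by move=> e ce; rewrite edg_cut ce orbT.
set Y := \sum_(_ <- _) _ => h.
have Y0 : 0 <= Y by apply: sumr_ge0 => e _; apply: perc_ge0 => // l; apply: connR_ge0.
apply: (le_trans h); apply: (@le_trans _ _ Y); first by rewrite ler_piMl.
rewrite le_eqVlt; apply/orP; left; apply/eqP; apply: eq_bigr => e _.
apply/esym/perc_perm => //; first exact: incr_connR.
by apply: filter_edg => // e' ie; rewrite edg_cut ie.
Qed.

End Percolation_threshold.

(** * Comparison of the thresholds and conclusion *)

Section Thresholds.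
Variables (R : realType) (d : nat).
Implicit Types (b H M : R) (L : nat).

Lemma popen_lt b M : 0 < b -> 0 < M -> popen b M < 1 - expR (- (2 * b)).
Proof.
move=> b0 M0; have e0 := expR_gt0 b; have k0 := expR_gt0 (- b).
have d0 : 0 < expR b - expR (- b) by rewrite subr_gt0 ltr_expR; lra.
have -> : expR (- (2 * b)) = expR (- b) / expR b.
  by rewrite -expRN -expRD; congr expR; ring.
rewrite /popen; move: e0 k0 d0; move: (expR b) (expR (- b)) => x k x0 k0 d0.
have D0 : 0 < k * (1 + M) + (x - k) * M by rewrite addr_gt0 // mulr_gt0 // addr_gt0.
rewrite ltr_pdivrMr // -subr_gt0.
rewrite (_ : _ - _ = k * (x - k) / x); last by field; rewrite gt_eqF.
by rewrite divr_gt0 // mulr_gt0.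
Qed.

Lemma le_p_c b : (b%:E <= beta_P R d)%E -> 1 - expR (- (2 * b)) <= p_c_bond R d.
Proof.
have := beta_PE R d; case: (beta_P R d) => [r| |] /=.
- by move=> [<-]; rewrite lee_fin => br; rewrite lerB // ler_expR; lra.
- by rewrite gt0_muley ?lte_fin //= sube0 => -[<-] _; rewrite gerBl expR_ge0.
- by rewrite leNgt ltNyr.
Qed.

Lemma decays_le_beta_P b H : 0 <= b -> 0 <= H -> (b%:E <= beta_P R d)%E -> decays d b H.
Proof.
move=> b0 H0 bP.
have M0 : 0 < flipK d b H by rewrite mulr_gt0 ?expR_gt0.
have [b1|] := ltP 0 b; last first.
  (* At [b = 0] the strict inequality [popen_lt] degenerates, but there is no interaction: a single
     site with [p = 0] satisfies the criterion. *)
  move=> bn; have {bn bP b0}-> : b = 0 by apply/eqP; rewrite eq_le bn.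
  apply: (@percolation_criterion R d 0 H 0 [:: 0]); rewrite ?mem_head ?lexx ?ler01 ?mul0r //.
  by rewrite /popen oppr0 subrr !mul0r.
have p0 : 0 <= popen b (flipK d b H).
  have d0 : 0 <= expR b - expR (- b) by rewrite subr_ge0 ler_expR; lra.
  apply: divr_ge0; first by apply: mulr_ge0 (ltW M0).
  by apply: addr_ge0; apply: mulr_ge0 => //; first [exact: expR_ge0|exact: ltW|exact: addr_ge0 (ltW M0)].
have [q [S [pq q1 uS S0 h]]] := p_c_criterion p0 (lt_le_trans (popen_lt b1 M0) (le_p_c bP)).
by apply: (percolation_criterion b0 H0 uS S0 pq _ h); rewrite q1 (le_trans p0).
Qed.

Lemma mean_spin0_disagreement b H L (h : box d L -> R) eta eta' : 0 <= b ->
  mean_spin0 h eta b H - mean_spin0 h eta' b H <= disagreement b H (extend_field h) L 0.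
Proof.
move=> b0; rewrite !mean_spin0_avg /disagreement.
have om : mono (chi R [:: (0 : site d)]) by move=> u v uv; rewrite !chi1 spin_mono.
have am := avg_mono (boxs_uniq d L) (lat_gw H (extend_field h) (boxs d L) b0) om.
by rewrite lerB // am // => x; rewrite implybT.
Qed.

Lemma decays_sup b H : 0 <= b -> decays d b H ->
  exists C1 C2 : R, 0 < C1 /\ 0 < C2 /\
    forall (L : nat) (h : box d L -> R), (forall u, h u = -1 \/ h u = 1) ->
      sup [set mean_spin0 h eta b H - mean_spin0 h eta' b H
            | eta in [set: spins (ex_boundary (box d L))]
            & eta' in [set: spins (ex_boundary (box d L))]]
      <= C2 * expR (- (C1 * L%:R)).
Proof.
move=> b0 [C1 [C2 [C10 [C20 CE]]]]; exists C1, C2; do 2 split => //.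
move=> L h hb; have hb' : bimodal (extend_field h).
  by move=> x; rewrite /extend_field; case: insub => [u|]; [exact: hb|right].
apply: le_trans (CE L _ hb'); apply: ge_sup.
  exists (mean_spin0 h [ffun=> true] b H - mean_spin0 h [ffun=> true] b H).
  by exists [ffun=> true] => //; exists [ffun=> true].
by move=> _ [eta _ [eta' _ <-]]; apply: mean_spin0_disagreement.
Qed.

End Thresholds.

Theorem theorem1 (R : realType) (beta : R)
    (beta_ge0 : 0 <= beta) (beta_lt : (beta%:E < beta_c R 2)%E) :
  exists H1 : \bar R,
    [/\ (0 < H1)%E,
        (beta%:E <= beta_P R 2)%E -> H1 = +oo%E,
        (beta_P R 2 < beta%:E)%E -> (H1 < +oo)%E &
        forall H : R, 0 <= H -> (H%:E < H1)%E ->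
          exists C1 C2 : R, 0 < C1 /\ 0 < C2 /\
            forall (L : nat) (h : box 2 L -> R),
              (forall u, h u = -1 \/ h u = 1) ->
              sup [set mean_spin0 h eta beta H - mean_spin0 h eta' beta H
                    | eta in [set: spins (ex_boundary (box 2 L))]
                    & eta' in [set: spins (ex_boundary (box 2 L))]]
              <= C2 * expR (- (C1 * L%:R))].
Proof.
have [bP|bP] := leP beta%:E (beta_P R 2).
  exists +oo%E; split => //.
  by move=> H H0 _; apply: decays_sup => //; apply: decays_le_beta_P.
have [b1 [S [bb1 uS S0 h]]] := beta_c_criterion beta_ge0 beta_lt.
have [H1 H10 HH] := high_temperature beta_ge0 bb1 uS S0 h.
exists H1%:E; split => [||_|H H0].
- by rewrite lte_fin.
- by [].
- exact: ltry.
by rewrite lte_fin => HH1; apply: decays_sup => //; apply: HH.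
Qed.
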